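(* Let $n\ge 2$ and let $X$ be a contractible pure simplicial complex of dimension $n$ such that all the links of $X$ of dimension $>0$ are connected, and such that there is an integer $0\le r\le n-2$ for which the link of every $r$-simplex is finite. Let $\Gamma$ be a locally compact, unimodular group acting cocompactly by automorphisms on $X$, and assume that for every simplex $\eta$ of dimension $r$ the point-wise stabilizer $\Gamma_\eta\subset\Gamma$ is compact. Let $k$ be an integer with $r<k\le n-1$. If $$\lambda(X_\tau)>\frac{k(n-k)}{k+1}\quad\text{for every simplex }\tau\text{ of } X \text{ of dimension }k-1\ (\ge r),$$ then: (1) for every $r<j\le k$ we have $H^{j}(X,\rho)=0$ for any unitary representation $\rho$ of $\Gamma$; (2) $\Gamma$ has property (T).
   Context: Pure of dimension $n$: every simplex is contained in at least one $n$-simplex. Cocompactly: finitely many $\Gamma$-orbits of simplices. Stabilizers $\Gamma_\sigma$ are point-wise; for every simplex $\sigma$ of dimension $\ge r$ the group $\Gamma_\sigma$ is compact with Haar measure $0<|\Gamma_\sigma|<\infty$. Links and eigenvalues. For a simplex $\tau$ of dimension $k-1$ with $k\geq r+1$, $X_\tau$ is its link, a finite pure simplicial complex of dimension $n-k$. For a simplex $\sigma$ of $X_\tau$ let $m_\tau(\sigma)$ be the number of (unordered) $n$-simplices of $X$ containing $\tau\cup\sigma$. The (untwisted) Laplacian on real functions $f$ on the vertices of $X_\tau$ is $$\Delta^+_\tau f(v)=(n-k)f(v)-\sum_{u:\{u,v\}\text{ edge of }X_\tau}\frac{m_\tau(\{u,v\})}{m_\tau(\{v\})}f(u),$$ which is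 a positive semi-definite self-adjoint operator for the inner product $\sum_v m_\tau(\{v\})f(v)g(v)$; $\lambda(X_\tau)$ denotes its smallest positive eigenvalue. (When $k=n-1$ the link is a graph and $\Delta_\tau^+ f(v)=f(v)-\frac{1}{\mathrm{val}(v)}\sum_{u\sim v}f(u)$, where $\mathrm{val}(v)$ is the valence of $v$.) Twisted cohomology. For a unitary representation $\rho$ of $\Gamma$ on a complex Hilbert space $H$, let $\Sigma(k)$ be the set of ordered $k$-simplices of $X$ and let $C^k(X,\rho)$ be the space of alternating maps $\phi:\Sigma(k)\to H$ with $\phi(\gamma x)=\rho(\gamma)\phi(x)$ for all $\gamma\in\Gamma$, $x\in\Sigma(k)$. The differential $d:C^k(X,\rho)\to C^{k+1}(X,\rho)$ is $d\phi(v_0,\dots,v_{k+1})=\sum_{i=0}^{k+1}(-1)^i\phi(v_0,\dots,\hat v_i,\dots,v_{k+1})$, and $H^k(X,\rho)=\ker(d:C^k\to C^{k+1})/\operatorname{im}(d:C^{k-1}\to C^k)$. Property (T). A topological group $\Gamma$ has property (T) if there are $\kappa>0$ and a compact $Q\subset\Gamma$ such that every unitary representation $\rho$ of $\Gamma$ on a complex Hilbert space $H$ either has a nonzero invariant vector or satisfies $\max_{\gamma\in Q}|\rho(\gamma)\xi-\xi|\ge\kappa$ for every unit vector $\xi\in H$. *)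

(* Defs.v *)
From HB Require Import structures.
From mathcomp Require Import all_boot all_order all_algebra all_fingroup.
From mathcomp Require Import finmap sesquilinear complex.
From mathcomp Require Import all_classical all_reals all_analysis.

Set Implicit Arguments.
Unset Strict Implicit.
Unset Printing Implicit Defensive.
Import Order.TTheory GRing.Theory Num.Theory.
Import numFieldNormedType.Exports.

Local Open Scope classical_set_scope.
Local Open Scope ring_scope.

(* The vertices are the [v] such that [[fset v]] is a simplex; the empty set is
   not counted as a simplex. *)
Record simplicialComplex (V : choiceType) := SimplicialComplex {
  simplex :> {fset V} -> Prop;
  simplex_neq0 : forall s, simplex s -> s != fset0;
  simplex_face : forall s t, simplex s -> (t `<=` s)%fset -> t != fset0 ->
    simplex t }.

Section Complexes.
Context {V : choiceType}.
Implicit Types (X : simplicialComplex V) (s t : {fset V}).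

Definition has_dim (d : nat) s : Prop := #|` s| = d.+1.

Definition dimension_eq X (d : nat) : Prop :=
  (exists2 s, X s & has_dim d s) /\ (forall s, X s -> (#|` s| <= d.+1)%N).

Definition pure X (n : nat) : Prop :=
  forall s, X s -> exists t, [/\ X t, has_dim n t & (s `<=` t)%fset].

Definition link_simplex X (t : {fset V}) : set {fset V} :=
  [set s | [/\ s != fset0, [disjoint s & t]%fset & X (t `|` s)%fset]].

Lemma link_simplex_face X t s s' : link_simplex X t s ->
  (s' `<=` s)%fset -> s' != fset0 -> link_simplex X t s'.
Proof.
case=> s0 dst Xts ss' s'0; split=> //; first exact: fdisjointWl ss' dst.
apply: simplex_face Xts _ _; first exact: fsetUS.
by apply: contraNneq s'0 => /eqP; rewrite fsetU_eq0 => /andP[].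
Qed.

Definition link X (t : {fset V}) : simplicialComplex V :=
  @SimplicialComplex V (link_simplex X t)
    (fun s => fun h => let: And3 s0 _ _ := h in s0)
    (@link_simplex_face X t).

End Complexes.

Section Realization.
Context (R : realType) {V : choiceType}.

(* Barycentric coordinates supported in the closed simplex spanned by [s]. *)
Definition closed_simplex (s : {fset V}) : set (V -> R) :=
  [set w | [/\ forall v, 0 <= w v, forall v, v \notin s -> w v = 0 &
               \sum_(v <- s) w v = 1]].

Record realization (X : simplicialComplex V) := Realization {
  bary : V -> R;
  baryP : exists2 s, X s & closed_simplex s bary }.

HB.instance Definition _ X := gen_eqMixin (realization X).
HB.instance Definition _ X := gen_choiceMixin (realization X).

(* Coherent (weak) topology: a set is open when its trace on every closed
   simplex is open. On a closed simplex the product topology of [V -> R] is the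
   Euclidean one, since only finitely many coordinates are nonzero there. *)
Definition coherent_open (X : simplicialComplex V) : set_system (realization X) :=
  [set U | forall s, X s -> exists2 W : set {ptws V -> R}, open W &
     forall p, closed_simplex s (bary p) -> U p <-> W (bary p)].

Lemma coherent_openT X : coherent_open (X := X) setT.
Proof. by move=> s _; exists setT => //; exact: openT. Qed.

Lemma coherent_openI X : setI_closed (coherent_open (X := X)).
Proof.
move=> A B oA oB s Xs.
have [WA oWA hA] := oA s Xs; have [WB oWB hB] := oB s Xs.
exists (WA `&` WB); first exact: openI.
by move=> p ps; split=> -[/(hA _ ps) ? /(hB _ ps) ?]; split.
Qed.

Lemma coherent_open_bigU X (I : Type) (f : I -> set (realization X)) :
  (forall i, coherent_open (f i)) -> coherent_open (\bigcup_i f i).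
Proof.
move=> of_ s Xs.
have /choice[W hW] : forall i, exists W : set {ptws V -> R}, open W /\
    forall p, closed_simplex s (bary p) -> f i p <-> W (bary p).
  by move=> i; have [W oW h] := of_ i s Xs; exists W.
exists (\bigcup_i W i); first by apply: bigcup_open => i _; case: (hW i).
move=> p ps; split=> -[i _ fip]; exists i => //.
- by apply/(proj2 (hW i) p ps).
- by apply/(proj2 (hW i) p ps).
Qed.

HB.instance Definition _ X := isOpenTopological.Build (realization X)
  (@coherent_openT X) (@coherent_openI X) (@coherent_open_bigU X).

End Realization.

Definition contractible (R : realType) (T : topologicalType) : Prop :=
  exists (x0 : T) (h : T * R -> T),
    [/\ {within [set: T] `*` `[0, 1], continuous h},
        forall x, h (x, 0) = x & forall x, h (x, 1) = x0].

Section Laplacian.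
Context (R : realType) {V : choiceType} (X : simplicialComplex V) (n : nat).
Implicit Types t s : {fset V}.

Definition link_vertex t : set V := [set v | link X t [fset v]%fset].

(* [fset_set] is the junk value [fset0] on an infinite set; the counted set is
   finite as soon as the link of [t] is. *)
Definition link_mult t s : nat :=
  #|` fset_set [set u : {fset V} | [/\ X u, has_dim n u & (t `|` s `<=` u)%fset]]|.

Definition link_adj t (v : V) : set V :=
  [set u | u != v /\ link X t [fset u; v]%fset].

(* For [t] of dimension [k - 1] one has [k = #|` t|]. *)
Definition link_laplacian t (f : link_vertex t -> R) (v : link_vertex t) : R :=
  (n%:R - #|` t|%:R) * f v -
  \sum_(u \in [set u : link_vertex t | link_adj t (val v) (val u)])
    (link_mult t [fset val u; val v]%fset)%:R /
    (link_mult t [fset val v]%fset)%:R * f u.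

Definition link_eigenvalue t (l : R) : Prop :=
  exists2 f : link_vertex t -> R, (exists v, f v != 0) &
    forall v, link_laplacian f v = l * f v.

(* A finite link has finitely many eigenvalues, so this infimum is a minimum. *)
Definition link_lambda t : R := inf [set l | 0 < l /\ link_eigenvalue t l].

End Laplacian.

HB.mixin Record isTopologicalGroup G & Topological G & monoid.Group G := {
  mulg_continuous : continuous (fun xy : G * G => (xy.1 * xy.2)%g);
  invg_continuous : continuous (fun x : G => (x^-1)%g) }.

#[short(type="topGroupType")]
HB.structure Definition TopologicalGroup :=
  {G of Topological G & monoid.Group G & isTopologicalGroup G}.

(* Measurable types are pointed. *)
Definition pointed_group (G : topGroupType) : Type := G.
HB.instance Definition _ (G : topGroupType) := Choice.on (pointed_group G).
HB.instance Definition _ (G : topGroupType) :=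
  isPointed.Build (pointed_group G) (1%g : G).

Definition borel_group (G : topGroupType) :=
  g_sigma_algebraType (@open G : set (set (pointed_group G))).

Section Haar.
Context (R : realType) (G : topGroupType).
Local Open Scope ereal_scope.

Record left_haar (mu : {measure set (borel_group G) -> \bar R}) : Prop :=
  LeftHaar {
  haar_neq0 : mu setT != 0;
  haar_compact : forall K : set G, compact K -> mu K < +oo;
  haar_outer : forall A : set (borel_group G), measurable A ->
    mu A = ereal_inf [set mu U | U in [set U : set G | open U /\ A `<=` U]];
  haar_inner : forall U : set G, open U ->
    mu U = ereal_sup [set mu K | K in [set K : set G | compact K /\ K `<=` U]];
  haar_left : forall (g : G) (A : set (borel_group G)), measurable A ->
    mu [set (g * x)%g | x in (A : set G)] = mu A }.

Definition right_invariant (mu : {measure set (borel_group G) -> \bar R}) :=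
  forall (g : G) (A : set (borel_group G)), measurable A ->
    mu [set (x * g)%g | x in (A : set G)] = mu A.

Definition unimodular : Prop :=
  exists2 mu : {measure set (borel_group G) -> \bar R},
    left_haar mu & right_invariant mu.

End Haar.

Definition locally_compact_group (G : topGroupType) : Prop :=
  hausdorff_space G /\ locally_compact [set: G].

Record simplicialAction (G : groupType) (V : choiceType)
    (X : simplicialComplex V) := SimplicialAction {
  act :> G -> V -> V;
  act1 : forall v, act 1%g v = v;
  actM : forall g h v, act (g * h)%g v = act g (act h v);
  act_simplex : forall g s, X s -> X [fset act g v | v in s]%fset }.

Section Actions.
Context {G : groupType} {V : choiceType} {X : simplicialComplex V}.
Variable a : simplicialAction G X.

Definition simplex_orbit (s : {fset V}) : set {fset V} :=
  [set [fset a g v | v in s]%fset | g in [set: G]].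

Definition cocompact : Prop :=
  finite_set [set simplex_orbit s | s in [set s | X s]].

Definition pointwise_stabilizer (s : {fset V}) : set G :=
  [set g | forall v, v \in s -> a g v = v].

Lemma act_inj g : injective (a g).
Proof.
by move=> u v /(congr1 (a g^-1%g)); rewrite -!actM mulVg !act1.
Qed.

End Actions.

Record hilbertSpace (R : realType) := HilbertSpace {
  hcarrier :> completeNormedModType R[i];
  hdot : {dot hcarrier for Num.conj};
  hdot_norm : forall x : hcarrier, hdot x x = `|x| ^+ 2 }.

(* As usual for topological groups, representations are strongly continuous. *)
Record unitaryRep (R : realType) (G : topGroupType) (H : hilbertSpace R) :=
  UnitaryRep {
  rep :> G -> {linear H -> H};
  rep1 : forall x, rep 1%g x = x;
  repM : forall g h x, rep (g * h)%g x = rep g (rep h x);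
  rep_dot : forall g x y, hdot H (rep g x) (rep g y) = hdot H x y;
  rep_continuous : forall x : H, continuous (fun g => rep g x) }.

(* The maximum over [Q] is at least [kappa] iff some value over [Q] is. *)
Definition property_T (R : realType) (G : topGroupType) : Prop :=
  exists (kappa : R) (Q : set G), [/\ 0 < kappa, compact Q &
    forall (H : hilbertSpace R) (rho : unitaryRep G H),
      (exists2 xi : H, xi != 0 & forall g, rho g xi = xi) \/
      (forall xi : H, `|xi| = 1 ->
         exists2 g, Q g & (kappa%:C)%C <= `|rho g xi - xi|)].

Section Cohomology.
Context {V : choiceType} (X : simplicialComplex V).

Record osimplex (k : nat) := OSimplex {
  overt :> 'I_k.+1 -> V;
  overt_inj : injective overt;
  osimplexP : X [fset overt i | i in 'I_k.+1]%fset }.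

Lemma osimplex_face_subproof k (x : osimplex k.+1) (i : 'I_k.+2) :
  X [fset x (lift i j) | j in 'I_k.+1]%fset.
Proof.
apply: (simplex_face (osimplexP x)).
  by apply/fsubsetP => v /imfsetP[j _ ->]; apply/imfsetP; exists (lift i j).
by apply/fset0Pn; exists (x (lift i ord0)); apply/imfsetP; exists ord0.
Qed.

Definition osimplex_face k (x : osimplex k.+1) (i : 'I_k.+2) : osimplex k :=
  @OSimplex k (fun j => x (lift i j))
    (inj_comp (@overt_inj _ x) (@lift_inj _ i))
    (osimplex_face_subproof x i).

Lemma osimplex_perm_subproof k (x : osimplex k) (s : 'S_k.+1) :
  X [fset x (s j) | j in 'I_k.+1]%fset.
Proof.
apply: (simplex_face (osimplexP x)).
  by apply/fsubsetP => v /imfsetP[j _ ->]; apply/imfsetP; exists (s j).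
by apply/fset0Pn; exists (x (s ord0)); apply/imfsetP; exists ord0.
Qed.

Definition osimplex_perm k (x : osimplex k) (s : 'S_k.+1) : osimplex k :=
  @OSimplex k (fun j => x (s j))
    (inj_comp (@overt_inj _ x) (@perm_inj _ s)) (osimplex_perm_subproof x s).

Context {G : topGroupType} (a : simplicialAction G X).

Lemma osimplex_act_subproof k (g : G) (x : osimplex k) :
  X [fset a g (x j) | j in 'I_k.+1]%fset.
Proof.
apply: (simplex_face (act_simplex a g (osimplexP x))).
  apply/fsubsetP => v /imfsetP[j _ ->]; apply/imfsetP; exists (x j) => //=.
  by apply/imfsetP; exists j.
by apply/fset0Pn; exists (a g (x ord0)); apply/imfsetP; exists ord0.
Qed.

Definition osimplex_act k (g : G) (x : osimplex k) : osimplex k :=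
  @OSimplex k (fun j => a g (x j))
    (inj_comp (@act_inj _ _ _ a g) (@overt_inj _ x))
    (osimplex_act_subproof g x).

Context {R : realType} {H : hilbertSpace R} (rho : unitaryRep G H).

Definition cochain (k : nat) : set (osimplex k -> H) :=
  [set phi |
    (forall (s : 'S_k.+1) x, phi (osimplex_perm x s) = (-1) ^+ s *: phi x) /\
    (forall g x, phi (osimplex_act g x) = rho g (phi x))].

Definition differential (k : nat) (phi : osimplex k -> H) : osimplex k.+1 -> H :=
  fun x => \sum_(i < k.+2) (-1) ^+ i *: phi (osimplex_face x i).

Definition cocycle (k : nat) : set (osimplex k -> H) :=
  [set phi | cochain phi /\ differential phi = cst 0].

Definition coboundary (k : nat) : set (osimplex k -> H) :=
  match k with
  | 0 => [set cst 0]
  | k'.+1 => [set differential psi | psi in cochain (k := k')]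
  end.

(* The quotient of the cocycles by the coboundaries is zero. *)
Definition cohomology_eq0 (k : nat) : Prop :=
  cocycle (k := k) `<=` coboundary (k := k).

End Cohomology.

(* Main.v *)
(** The proof is Garland's method, written for equivariant functions of a random
    ordered n-simplex (x_0, ..., x_n) of [X] modulo [G], an orbit being weighted by
    the inverse Haar measure of its stabilizer.  Unimodularity makes this weight
    constant on orbits, and the conditional expectation given the first [l > r]
    vertices is then the average over a finite link.

    Say that level [i] has gap [nu] if, for the functions f of x_0, ..., x_i that
    are orthogonal to the functions of x_0, ..., x_(i-1), exchanging x_i and
    x_(i+1) satisfies <f, s_i f> <= nu |f|^2.  The eigenvalue hypothesis is a gap
    smaller than 1 / (k + 1) at level [k].  As the links are connected, a gap [nu]
    at level i + 1 gives the gap nu / (1 - nu) at level i, hence gaps smaller than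
    1 / (i + 1) at all levels i <= k; below level [r] this only involves orthogonal
    projections, so that the infinite links do no harm.

    (1) For a cocycle f of degree j one has <f, s_j f> = |f|^2 / (j + 1), so the gap
    at level j bounds the component of f depending on x_0, ..., x_(j-1) from below.
    This component is the codifferential of f up to a factor, and the resulting
    contraction produces a primitive of f.

    (2) By descending induction on l <= r + 1, a vector that is almost invariant
    under a suitable compact set is close to a vector fixed by the stabilizer of
    (x_0, ..., x_(l-1)): one spreads it to an equivariant function of
    x_0, ..., x_l and projects onto the functions of x_0, ..., x_(l-1).  The case
    l = 0 is property (T). *)
Require Import Defs.
From HB Require Import structures.
From mathcomp Require Import all_boot all_order all_algebra all_fingroup.
From mathcomp Require Import finmap sesquilinear complex.
From mathcomp Require Import all_classical all_reals all_analysis.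
From mathcomp Require Import ring lra zify.

Set Implicit Arguments.
Unset Strict Implicit.
Unset Printing Implicit Defensive.
Import Order.TTheory GRing.Theory Num.Theory.
Import numFieldNormedType.Exports.

Local Open Scope classical_set_scope.
Local Open Scope ring_scope.

(** * Semi-inner products on modules over R[i] *)

(** The link Laplacian is (n - k)(1 - M), where M is the random walk replacing x_k by x_(k+1). So
    lambda > k(n - k)/(k + 1) says that the eigenvalues of M other than 1 are less than 1/(k + 1).
    This threshold fits the whole proof: nu/(1 - nu) sends 1/(i + 2) to 1/(i + 1), and 1/(j + 1) is
    also the value of <f, s_j f>/|f|^2 on cocycles.

    The obstacle is at levels l <= r, where the fibre over x_0, ..., x_(l-1) may be infinite and its
    stabilizer need not be compact: neither averages over fibres nor weights of prefixes are
    available. Hence all levels are subspaces of one space of functions on ordered n-simplices,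
    whose weights are finite, and the passage between levels uses complete subspaces, isometric
    swaps and the braid relation, the axioms of [tower].

    The weights also need stabilizers of positive Haar measure, which comes from the countability of
    the set of simplices. Property (T) asks for constants common to all representations, so each gap
    is produced before the representation is introduced. *)

Record semidot (R : realType) (L : lmodType R[i]) := Semidot {
  sdot :> L -> L -> R;
  sdotC : forall x y, sdot x y = sdot y x;
  sdotDl : forall x y z, sdot (x + y) z = sdot x z + sdot y z;
  sdotZl : forall (r : R) x y, sdot (r%:C%C *: x) y = r * sdot x y;
  sdot_ge0 : forall x, 0 <= sdot x x }.

Arguments sdot : simpl never.

Section SemiHilbert.
Context (R : realType) (L : lmodType R[i]) (dot : semidot L).
Implicit Types (x y z p : L) (r e : R) (U S : set L) (u : nat -> L).

Lemma sdotDr x y z : dot x (y + z) = dot x y + dot x z.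
Proof. by rewrite sdotC sdotDl !(sdotC _ x). Qed.

Lemma sdotZr r x y : dot x (r%:C%C *: y) = r * dot x y.
Proof. by rewrite sdotC sdotZl sdotC. Qed.

Lemma sdot0l x : dot 0 x = 0.
Proof. by rewrite -(scale0r (0 : L)) -[0 : R[i]]/(0%:C)%C sdotZl mul0r. Qed.

Lemma sdotNl x y : dot (- x) y = - dot x y.
Proof. by apply/eqP; rewrite -addr_eq0 -sdotDl addNr sdot0l. Qed.

Lemma sdotNr x y : dot x (- y) = - dot x y.
Proof. by rewrite sdotC sdotNl sdotC. Qed.

Lemma sdotBl x y z : dot (x - y) z = dot x z - dot y z.
Proof. by rewrite sdotDl sdotNl. Qed.

Lemma sdotBr x y z : dot x (y - z) = dot x y - dot x z.
Proof. by rewrite sdotDr sdotNr. Qed.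

Lemma sdot_suml I (r : seq I) (F : I -> L) z :
  dot (\sum_(i <- r) F i) z = \sum_(i <- r) dot (F i) z.
Proof.
elim/big_rec2: _ => [|i x y _ <-]; first exact: sdot0l.
by rewrite sdotDl.
Qed.

Definition sdotE := (sdotBl, sdotBr, sdotDl, sdotDr, sdotNl, sdotNr, sdotZl,
  sdotZr).

Definition snorm x : R := Num.sqrt (dot x x).

Lemma snorm_ge0 x : 0 <= snorm x. Proof. exact: sqrtr_ge0. Qed.

Lemma sqr_snorm x : snorm x ^+ 2 = dot x x.
Proof. by rewrite sqr_sqrtr ?sdot_ge0. Qed.

Lemma snorm0 : snorm 0 = 0. Proof. by rewrite /snorm sdot0l sqrtr0. Qed.

Lemma snormN x : snorm (- x) = snorm x.
Proof. by rewrite /snorm sdotNl sdotNr opprK. Qed.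

Lemma snorm_distC x y : snorm (x - y) = snorm (y - x).
Proof. by rewrite -snormN opprB. Qed.

Lemma snormZ r x : snorm (r%:C%C *: x) = `|r| * snorm x.
Proof.
by rewrite /snorm sdotZl sdotZr mulrA -expr2 sqrtrM ?sqr_ge0 // sqrtr_sqr.
Qed.

Lemma sdot_CS_sqr x y : dot x y ^+ 2 <= dot x x * dot y y.
Proof.
have key (t : R) : 0 <= dot x x - 2 * t * dot x y + t ^+ 2 * dot y y.
  have := sdot_ge0 dot (x - t%:C%C *: y); rewrite !sdotE (sdotC _ y x).
  by congr (_ <= _); ring.
have [c0|c0] := eqVneq (dot y y) 0.
  have [->|b0] := eqVneq (dot x y) 0; first by rewrite c0 expr0n mulr0.
  have := key ((dot x x + 1) / (2 * dot x y)); rewrite c0 mulr0 addr0.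
  have -> : 2 * ((dot x x + 1) / (2 * dot x y)) * dot x y = dot x x + 1.
    by field.
  by lra.
have c_gt0 : 0 < dot y y by rewrite lt_def c0 sdot_ge0.
have := key (dot x y / dot y y).
have -> : dot x x - 2 * (dot x y / dot y y) * dot x y +
    (dot x y / dot y y) ^+ 2 * dot y y = dot x x - dot x y ^+ 2 / dot y y.
  by field.
by rewrite subr_ge0 ler_pdivrMr.
Qed.

Lemma sdot_CS x y : `|dot x y| <= snorm x * snorm y.
Proof.
rewrite -(@ler_pXn2r _ 2) ?nnegrE ?mulr_ge0 ?snorm_ge0 //.
by rewrite exprMn !sqr_snorm real_normK ?num_real // sdot_CS_sqr.
Qed.

Lemma sdot_le x y : dot x y <= snorm x * snorm y.
Proof. exact: le_trans (ler_norm _) (sdot_CS x y). Qed.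

Lemma ler_snormD x y : snorm (x + y) <= snorm x + snorm y.
Proof.
rewrite -(@ler_pXn2r _ 2) ?nnegrE ?addr_ge0 ?snorm_ge0 //.
rewrite sqrrD !sqr_snorm !sdotE (sdotC _ y x).
by have := sdot_le x y; lra.
Qed.

Lemma ler_snorm_dist x y z : snorm (x - z) <= snorm (x - y) + snorm (y - z).
Proof. by rewrite -(subrKA y x) ler_snormD. Qed.

Lemma snorm_le_sdot x y : dot x x <= dot y y -> snorm x <= snorm y.
Proof. exact: ler_wsqrtr. Qed.

Lemma snorm_eq0 x : (snorm x == 0) = (dot x x == 0).
Proof. by rewrite sqrtr_eq0 eq_le sdot_ge0 andbT. Qed.

Definition sconv u x :=
  forall e, 0 < e -> exists N, forall m, (N <= m)%N -> snorm (u m - x) <= e.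

Definition scauchy u :=
  forall e, 0 < e -> exists N, forall m m' : nat, (N <= m)%N -> (N <= m')%N ->
    snorm (u m - u m') <= e.

Definition scomplete U := forall u, (forall m, U (u m)) -> scauchy u ->
  exists2 x, U x & sconv u x.

(** Real scalars suffice, because only real parts of Hermitian products enter the inequalities. *)
Definition subspace U := [/\ U 0, forall x y, U x -> U y -> U (x + y) &
  forall r x, U x -> U (r%:C%C *: x)].

Lemma subspace0 U : subspace U -> U 0. Proof. by case. Qed.

Lemma subspaceD U x y : subspace U -> U x -> U y -> U (x + y).
Proof. by case=> _ + _; apply. Qed.

Lemma subspaceZ U r x : subspace U -> U x -> U (r%:C%C *: x).
Proof. by case=> _ _; apply. Qed.

Lemma subspaceN U x : subspace U -> U x -> U (- x).
Proof.
move=> sU Ux; rewrite -scaleN1r.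
by rewrite -[-1](rmorphN1 (real_complex R)); exact: subspaceZ.
Qed.

Lemma subspaceB U x y : subspace U -> U x -> U y -> U (x - y).
Proof. by move=> sU Ux Uy; apply: subspaceD => //; exact: subspaceN. Qed.

Lemma geometric_small (c q e : R) : 0 <= q -> q < 1 -> 0 < e ->
  exists N, forall m, (N <= m)%N -> c * q ^+ m <= e.
Proof.
move=> q0 q1 e0.
have qn : `|q| < 1 by rewrite ger0_norm.
have /cvgrPdist_le/(_ e e0)[N _ h] := cvg_geometric c qn.
exists N => m Nm; have := h m Nm; rewrite /= sub0r normrN.
by move=> hm; exact: le_trans (ler_norm _) hm.
Qed.

Lemma scauchy_geometric u (c q : R) : 0 <= q -> q < 1 ->
  (forall m, snorm (u m.+1 - u m) <= c * q ^+ m) -> scauchy u.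
Proof.
move=> q0 q1 hu.
have c0 : 0 <= c by have := le_trans (snorm_ge0 _) (hu 0%N); rewrite expr0 mulr1.
have tail m (p : nat) : snorm (u (m + p)%N - u m) <= c / (1 - q) * q ^+ m * (1 - q ^+ p).
  elim: p => [|p IHp].
    by rewrite addn0 subrr snorm0 expr0 subrr mulr0.
  rewrite addnS; apply: le_trans (ler_snorm_dist _ (u (m + p)%N) _) _.
  apply: le_trans (lerD (hu _) IHp) _.
  rewrite le_eqVlt; apply/orP; left; apply/eqP.
  by rewrite exprD exprS; field; rewrite subr_eq0 gt_eqF.
move=> e e0.
have e20 : 0 < e / 2 by rewrite divr_gt0.
have [N hN] := geometric_small (c / (1 - q)) q0 q1 e20.
have near m : (N <= m)%N -> snorm (u m - u N) <= e / 2.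
  move=> Nm; rewrite -(subnKC Nm); apply: le_trans (tail _ _) _.
  apply: le_trans (hN N (leqnn N)).
  rewrite ler_piMr ?lerBlDr ?lerDl ?exprn_ge0 //.
  by rewrite mulr_ge0 ?divr_ge0 ?exprn_ge0 // subr_ge0 ltW.
exists N => m p Nm Np; apply: le_trans (ler_snorm_dist _ (u N) _) _.
rewrite (snorm_distC (u N)) (splitr e).
exact: lerD (near _ Nm) (near _ Np).
Qed.

Lemma scauchy_contraction u (q : R) : q < 1 ->
  (forall m, dot (u m.+2 - u m.+1) (u m.+2 - u m.+1) <=
             q * dot (u m.+1 - u m) (u m.+1 - u m)) -> scauchy u.
Proof.
move=> q1 hu; pose q' := Num.max q 0.
have q'0 : 0 <= q' by rewrite le_max lexx orbT.
have q'1 : Num.sqrt q' < 1.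
  by rewrite -sqrtr1 ltr_sqrt ?ltr01 // gt_max q1 ltr01.
apply: (@scauchy_geometric _ (snorm (u 1%N - u 0%N)) _ (sqrtr_ge0 _) q'1).
elim=> [|m IHm]; first by rewrite expr0 mulr1.
rewrite exprSr mulrA.
apply: (@le_trans _ _ (snorm (u m.+1 - u m) * Num.sqrt q')).
  rewrite /snorm -sqrtrM ?sdot_ge0 // ler_wsqrtr // mulrC.
  apply: le_trans (hu m) _; apply: ler_wpM2r; first exact: sdot_ge0.
  by rewrite le_max lexx.
by rewrite ler_wpM2r // sqrtr_ge0.
Qed.

(** A minimizing sequence is Cauchy by the parallelogram law, for which midpoints are enough. This
    serves both the orthogonal projections and the fixed vectors of almost invariant orbits. *)
Lemma min_norm U : U !=set0 -> scomplete U ->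
  (forall x y, U x -> U y -> U ((2^-1)%:C%C *: (x + y))) ->
  exists2 p, U p & forall y, U y -> dot p p <= dot y y.
Proof.
move=> [x0 Ux0] cU mU; pose D := [set dot x x | x in U].
have D0 : D !=set0 by exists (dot x0 x0), x0.
have Dlb : has_lbound D by exists 0 => _ [x _ <-]; exact: sdot_ge0.
have hD : has_inf D by [].
have dle y : U y -> inf D <= dot y y by move=> Uy; apply: ge_inf => //; exists y.
have /choice[u hu] : forall m, exists x, U x /\ dot x x < inf D + (m.+1%:R)^-1.
  move=> m; have m0 : 0 < (m.+1%:R)^-1 :> R by rewrite invr_gt0.
  by have [_ [x Ux <-] hx] := inf_adherent m0 hD; exists x.
have dist x y : U x -> U y ->
    dot (x - y) (x - y) <= 2 * dot x x + 2 * dot y y - 4 * inf D.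
  move=> Ux Uy; have := dle _ (mU _ _ Ux Uy).
  by rewrite !sdotE (sdotC _ y x); lra.
have small e : 0 < e -> exists N, forall m, (N <= m)%N -> (m.+1%:R)^-1 <= e.
  move=> e0; exists (Num.truncn e^-1) => m Nm.
  rewrite -(invrK e) lef_pV2 ?posrE ?invr_gt0 //.
  have := truncnS_gt e^-1; move=> /ltW/le_trans; apply.
  by rewrite ler_nat.
have cu : scauchy u.
  move=> e e0; have [|N hN] := small (e ^+ 2 / 4); first by rewrite divr_gt0 ?exprn_gt0.
  exists N => m p Nm Np.
  rewrite -(@ler_pXn2r _ 2) ?nnegrE ?snorm_ge0 ?(ltW e0) // sqr_snorm.
  have [Um dm] := hu m; have [Up dp] := hu p.
  apply: le_trans (dist _ _ Um Up) _.
  move: dm dp (hN _ Nm) (hN _ Np).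
  move: (m.+1%:R^-1) (p.+1%:R^-1) (dot _ _) (dot _ _) => a b c d.
  by lra.
have [p Up up] := cU u (fun m => (hu m).1) cu.
exists p => // y Uy; apply: le_trans (dle y Uy).
suff : snorm p <= Num.sqrt (inf D).
  rewrite -(@ler_pXn2r _ 2) ?nnegrE ?snorm_ge0 ?sqrtr_ge0 //.
  rewrite sqr_snorm sqr_sqrtr //.
  by apply: lb_le_inf => // _ [x _ <-]; exact: sdot_ge0.
have d0 : 0 <= inf D by apply: lb_le_inf => // _ [x _ <-]; exact: sdot_ge0.
apply/ler_addgt0Pr => e e0.
have e20 : 0 < e / 2 by rewrite divr_gt0.
have [N1 h1] := up _ e20.
have [N2 h2] : exists N, forall m, (N <= m)%N -> (m.+1%:R)^-1 <= (e / 2) ^+ 2.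
  by apply: small; rewrite exprn_gt0.
pose m := maxn N1 N2.
have := h1 m (leq_maxl _ _); have hm2 := h2 m (leq_maxr _ _).
move=> hm1; have -> : p = u m - (u m - p) by rewrite opprB addrC subrK.
apply: le_trans (ler_snormD _ _) _; rewrite snormN.
suff : snorm (u m) <= Num.sqrt (inf D) + e / 2 by lra.
rewrite -(@ler_pXn2r _ 2) ?nnegrE ?snorm_ge0 ?addr_ge0 ?sqrtr_ge0 ?(ltW e20) //.
rewrite sqr_snorm sqrrD sqr_sqrtr //; have [_ /ltW] := hu m.
have : 0 <= Num.sqrt (inf D) * (e / 2).
  by rewrite mulr_ge0 ?sqrtr_ge0 ?(ltW e20).
move: hm2; set k := _ * (e / 2); move: (m.+1%:R^-1) (dot _ _) k => a b k.
by lra.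
Qed.

Definition orthogonal_to U x := forall y, U y -> dot x y = 0.

Lemma projection_ex U x : subspace U -> scomplete U ->
  exists2 p, U p & orthogonal_to U (x - p).
Proof.
move=> sU cU; pose W := [set w | U (x - w)].
(* The shortest vector [p] of the coset [x + U] is the component orthogonal to [U], so the
   projection is [x - p]. *)
have [||x1 x2 Wx1 Wx2|p Wp pmin] := @min_norm W.
- by exists x; rewrite /W /= subrr; exact: subspace0.
- move=> u Wu cu; have [||l Ul ul] := cU (fun m => x - u m).
  + exact: Wu.
  + move=> e /cu[N hN]; exists N => m p Nm Np.
    by rewrite opprB addrC subrKA snorm_distC hN.
  exists (x - l); first by rewrite /W /= opprB addrC subrK.
  move=> e /ul[N hN]; exists N => m Nm.
  by rewrite snorm_distC addrAC; exact: hN.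
- rewrite /W /=.
  have half y : (2^-1)%:C%C *: (y + y) = y.
    rewrite scalerDr -scalerDl -rmorphD /=.
    have -> : (2^-1 + 2^-1 : R) = 1 by lra.
    by rewrite rmorph1 scale1r.
  rewrite -{1}(half x) -scalerBr opprD addrACA.

  by apply: subspaceZ => //; exact: subspaceD.
exists (x - p) => // y Uy; rewrite opprB addrC subrK.
(* With b = <p, y> and c = <y, y>, moving from p to p - t y lowers the square norm by b^2 (c + 2)/(c
   + 1)^2, so minimality forces b = 0. Dividing by c + 1 instead of c covers the degenerate case c =
   0. *)
pose t := dot p y / (dot y y + 1).
have c1 : 0 < dot y y + 1 by rewrite ltr_wpDl ?sdot_ge0.
have /pmin : W (p + (- t)%:C%C *: y).
  by rewrite /W /= opprD addrA; apply: subspaceB => //; exact: subspaceZ.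
rewrite !sdotE (sdotC _ y p) => h.
have : 0 <= - (dot p y ^+ 2 * (dot y y + 2)) / (dot y y + 1) ^+ 2.
  move: h; rewrite -subr_ge0; congr (_ <= _).
  by rewrite /t; field; rewrite gt_eqF.
rewrite pmulr_lge0 ?invr_gt0 ?exprn_gt0 // oppr_ge0 pmulr_lle0; last first.
  by rewrite ltr_wpDl ?sdot_ge0.
by move=> b2; apply/eqP; rewrite -sqrf_eq0 eq_le b2 sqr_ge0.
Qed.

(** The form may be degenerate, so a foot of the perpendicular is chosen; [proj_unique] shows that
    in a tower there is only one. *)
Definition proj U x : L := xget 0 [set p | U p /\ orthogonal_to U (x - p)].

Lemma projP U x : subspace U -> scomplete U ->
  U (proj U x) /\ orthogonal_to U (x - proj U x).
Proof.
move=> sU cU; rewrite /proj; case: xgetP => [p _ //|h].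
by have [p Up xp] := projection_ex x sU cU; case: (h p).
Qed.

Lemma proj_dot U x y : subspace U -> scomplete U -> U y ->
  dot (proj U x) y = dot x y.
Proof.
move=> sU cU Uy; have [_ /(_ y Uy)/eqP] := projP x sU cU.
by rewrite sdotBl subr_eq0 => /eqP.
Qed.

Lemma proj_pythagoras U x : subspace U -> scomplete U ->
  dot (x - proj U x) (x - proj U x) = dot x x - dot (proj U x) (proj U x).
Proof.
move=> sU cU; have [Up _] := projP x sU cU.
by have := proj_dot x sU cU Up; rewrite !sdotE (sdotC _ _ x) => ->; ring.
Qed.

Lemma proj_le U x : subspace U -> scomplete U ->
  dot (proj U x) (proj U x) <= dot x x.
Proof. by move=> sU cU; rewrite -subr_ge0 -proj_pythagoras // sdot_ge0. Qed.

End SemiHilbert.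

(** * Coercivity from a spectral gap, exactness from a contraction *)

Section Coercivity.
Context (R : realType) (L : lmodType R[i]) (dot : semidot L).
Implicit Types (x y z : L) (S U C Z : set L).

Lemma small_seq_le (a b k : R) :
  (forall e, 0 < e -> e <= 1 -> a <= b + e * k) -> a <= b.
Proof.
move=> h; apply/ler_addgt0Pr => d d0.
have k0 : 0 < `|k| + 1 by rewrite ltr_wpDl.
pose e := Num.min 1 (d / (`|k| + 1)).
have e0 : 0 < e by rewrite lt_min ltr01 divr_gt0.
have e1 : e <= 1 by rewrite ge_min lexx.
apply: le_trans (h e e0 e1) _; rewrite lerD2l.
apply: (@le_trans _ _ (e * (`|k| + 1))).
  by rewrite ler_pM2l //; apply: le_trans (ler_norm _) _; rewrite lerDl.
by rewrite -ler_pdivlMr // ge_min lexx orbT.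
Qed.

(* The spectrum of [A] on [S] avoids the interval (0, c) and the kernel is
   trivial; without spectral calculus, [x - A x / 2] is iterated to write each
   element of [S] as a limit of elements of the range, where the bound holds. *)
Lemma coercive_of_gap S (A : L -> L) (c : R) :
  subspace S -> scomplete dot S -> (forall x, S x -> S (A x)) ->
  (forall x y, S x -> S y -> A (x + y) = A x + A y) ->
  (forall (r : R) x, S x -> A (r%:C%C *: x) = r%:C%C *: A x) ->
  (forall x y, S x -> S y -> dot (A x) y = dot x (A y)) ->
  (forall x, S x -> dot (A x) (A x) <= 2 * dot x (A x)) ->
  0 < c -> (forall x, S x -> c * dot x (A x) <= dot (A x) (A x)) ->
  (forall x, S x -> dot (A x) (A x) = 0 -> dot x x = 0) ->
  forall x, S x -> c * dot x x <= dot x (A x).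
Proof.
move=> sS cS SA AD AZ Asym A2 c0 Agap Aker.
have AN x : S x -> A (- x) = - A x.
  move=> Sx; have -> : - x = (-1)%:C%C *: x by rewrite rmorphN1 scaleN1r.
  by rewrite AZ // rmorphN1 scaleN1r.
have AB x y : S x -> S y -> A (x - y) = A x - A y.
  by move=> Sx Sy; rewrite AD ?AN //; exact: subspaceN.
have Apos x : S x -> 0 <= dot x (A x).
  by move=> Sx; have := A2 x Sx; have := sdot_ge0 dot (A x); lra.
(* Expand the positivity of [A] at A x - c x, then bound c^2 <x, A x> by c |A x|^2 with the gap
   assumption. *)
have range x : S x -> c * dot (A x) (A x) <= dot (A x) (A (A x)).
  move=> Sx; have SAx := SA x Sx.
  have Scx : S (c%:C%C *: x) by exact: subspaceZ.
  have := Apos _ (subspaceB sS SAx Scx); rewrite AB // AZ //.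
  rewrite !sdotE -(Asym x) // => h.
  have := ler_wpM2l (ltW c0) (Agap x Sx); move: h.
  by lra.
have Ale x : S x -> snorm dot (A x) <= 2 * snorm dot x.
  move=> Sx; have [->|n0] := eqVneq (snorm dot (A x)) 0.
    by rewrite mulr_ge0 ?snorm_ge0.
  have ngt0 : 0 < snorm dot (A x) by rewrite lt_def n0 snorm_ge0.
  rewrite -(ler_pM2r ngt0) -expr2 sqr_snorm -mulrA.
  apply: le_trans (A2 x Sx) _; rewrite ler_pM2l //; exact: sdot_le.
move=> x Sx; pose h : R[i] := (2^-1)%:C%C.
(* Since 0 <= A <= 2, the operator 1 - A/2 multiplies square norms on the range of [A] by at most 1
   - c/2. The increments of [u] lie in that range, so [u] converges, and its limit is killed by
   [A]. *)
pose u m := iter m (fun y => y - h *: A y) x.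
have Su m : S (u m).
  by elim: m => //= m IHm; apply: subspaceB => //; apply: subspaceZ => //; exact: SA.
have dE m : u m.+1 - u m = - (h *: A (u m)) by rewrite /= addrAC subrr add0r.
have cu : scauchy dot u.
  apply: (@scauchy_contraction _ _ _ _ (1 - c / 2)); first by rewrite gtrBl divr_gt0.
  move=> m; rewrite !dE !sdotE /=.
  have Shum : S (h *: A (u m)) by apply: subspaceZ => //; exact: SA.
  rewrite AB // AZ; last exact: SA.
  have := range _ (Su m); have := A2 _ (SA _ (Su m)).
  rewrite !sdotE (sdotC dot (A (A _)) (A (u m))).
  by lra.
have [l Sl ul] := cS u Su cu.
have l0 : snorm dot l = 0.
  suff : snorm dot (A l) = 0.
    move/eqP; rewrite snorm_eq0 => /eqP/(Aker _ Sl) l0.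
    by apply/eqP; rewrite snorm_eq0 l0.
  apply/eqP; rewrite eq_le snorm_ge0 andbT.
  apply: (@small_seq_le _ _ 6) => e e0 _; rewrite add0r.
  have [N hN] := ul e e0.
  have -> : A l = A (l - u N) + A (u N) by rewrite -AD ?subrK //; exact: subspaceB.
  apply: le_trans (ler_snormD _ _ _) _.
  have := Ale _ (subspaceB sS Sl (Su N)).
  have := hN N (leqnn N); rewrite snorm_distC => h1.
  have := hN N.+1 (leqnSn N) => h2.
  have : snorm dot (A (u N)) = 2 * snorm dot (u N.+1 - u N).
    by rewrite dE snormN snormZ ger0_norm ?invr_ge0 // mulrA mulfV ?pnatr_eq0 // mul1r.
  have := ler_snorm_dist dot (u N.+1) l (u N).
  by lra.
have small e : 0 < e -> exists2 z, S z /\ snorm dot z <= e &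
    exists2 g, S g & x - z = A g.
  move=> /ul[N hN]; exists (u N).
    split=> //; have := hN N (leqnn N); have := ler_snormD dot (u N - l) l.
    by rewrite subrK l0; lra.
  elim: {hN} N => [|m [g Sg gE]].
    by exists 0; rewrite ?subrr; [exact: subspace0|rewrite -(subrr x) AB ?subrr].
  have Shu : S (h *: u m) by exact: subspaceZ.
  exists (g + h *: u m); first exact: subspaceD.
  by rewrite AD // AZ // -gE /= opprB addrA addrAC.
apply: (@small_seq_le _ _ (2 * c * snorm dot x + 2 * snorm dot (A x) + 2)).
move=> e e0 e1; have [z [Sz ze] [g Sg gE]] := small e e0.
have := range g Sg; rewrite -gE AB // !sdotE.
rewrite (sdotC dot z x) -(Asym x z) // (sdotC dot z (A x)) => hr.
have z0 := snorm_ge0 dot z.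
have b1 : dot x z <= e * snorm dot x.
  by rewrite mulrC; apply: le_trans (sdot_le _ _ _) _; rewrite ler_wpM2l ?snorm_ge0.
have b2 : - dot (A x) z <= e * snorm dot (A x).
  rewrite -sdotNr mulrC; apply: le_trans (sdot_le _ _ _) _.
  by rewrite snormN ler_wpM2l ?snorm_ge0.
have b3 : dot z (A z) <= 2 * e.
  apply: le_trans (sdot_le _ _ _) _.
  apply: le_trans (ler_wpM2l z0 (Ale z Sz)) _.
  rewrite mulrCA ler_pM2l //; apply: le_trans (ler_wpM2l z0 (le_trans ze e1)) _.
  by rewrite mulr1.
have b4 : 0 <= c * dot z z by rewrite mulr_ge0 ?sdot_ge0 // ltW.
have := ler_wpM2l (ltW c0) b1.
by lra.
Qed.

(* [delta] is an approximate right inverse of [d], and the errors decay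
   geometrically. *)
Lemma exact_of_contraction C Z (d delta : L -> L) (q k : R) :
  subspace C -> scomplete dot C -> subspace Z ->
  (forall x, Z x -> dot x x = 0 -> x = 0) ->
  (forall x, C x -> Z (d x)) ->
  (forall x y, C x -> C y -> d (x + y) = d x + d y) ->
  (forall x, C x -> snorm dot (d x) <= k * snorm dot x) ->
  (forall x, Z x -> C (delta x)) ->
  (forall x, Z x -> snorm dot (delta x) <= snorm dot x) ->
  q < 1 -> (forall x, Z x ->
    dot (x - d (delta x)) (x - d (delta x)) <= q * dot x x) ->
  forall x, Z x -> exists2 y, C y & x = d y.
Proof.
move=> sC cC sZ Zdef dZ dD dk ZC delta1 q1 hq x Zx.
pose f m := iter m (fun y => y - d (delta y)) x.
have Zf m : Z (f m).
  by elim: m => //= m Zm; apply: subspaceB => //; apply: dZ; exact: ZC.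
pose u m := \sum_(i < m) delta (f i).
have Cu m : C (u m).
  rewrite /u; elim: m => [|m IHm]; first by rewrite big_ord0; exact: subspace0.
  by rewrite big_ord_recr /=; apply: subspaceD => //; exact: ZC.
have fE m : f m = x - d (u m).
  elim: m => [|m IHm].
    rewrite /u big_ord0; suff -> : d 0 = 0 by rewrite subr0.
    have := dD 0 0 (subspace0 sC) (subspace0 sC).
    by rewrite addr0 -{1}(addr0 (d 0)) => /addrI.
  rewrite [LHS]/= -/(f m) {1}IHm -addrA -opprD -dD ?Cu //; last exact: ZC.
  by rewrite /u big_ord_recr.
pose p := Num.sqrt (Num.max q 0).
have p1 : p < 1 by rewrite -sqrtr1 ltr_sqrt ?ltr01 // gt_max q1 ltr01.
have p0 : 0 <= p := sqrtr_ge0 _.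
have fle m : snorm dot (f m) <= snorm dot x * p ^+ m.
  elim: m => [|m IHm]; first by rewrite expr0 mulr1.
  rewrite exprSr mulrA; apply: le_trans (ler_wpM2r p0 IHm).
  rewrite /snorm -sqrtrM ?sdot_ge0 // ler_wsqrtr // mulrC.
  apply: le_trans (hq _ (Zf m)) _; apply: ler_wpM2r; first exact: sdot_ge0.
  by rewrite le_max lexx.
have cu : scauchy dot u.
  apply: (@scauchy_geometric _ _ _ _ (snorm dot x) p) => // m.
  rewrite /u big_ord_recr /= addrAC subrr add0r.
  exact: le_trans (delta1 _ (Zf m)) (fle m).
have [y Cy uy] := cC u Cu cu; exists y => //; apply/eqP; rewrite -subr_eq0.
apply/eqP; apply: Zdef; first by apply: subspaceB => //; exact: dZ.
apply/eqP; rewrite -snorm_eq0 eq_le snorm_ge0 andbT.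
have k0 : 0 <= `|k| by [].
apply: (@small_seq_le _ _ (1 + `|k|)) => e e0 _; rewrite add0r.
have [N1 h1] := uy e e0.
have [N2 h2] := geometric_small (snorm dot x) p0 p1 e0.
pose m := maxn N1 N2.
have -> : x - d y = f m + d (u m - y).
  have dE : d (u m) = d (u m - y) + d y.
    by rewrite -dD ?subrK //; exact: subspaceB.
  by rewrite fE dE opprD addrA addrAC subrK.
apply: le_trans (ler_snormD _ _ _) _; rewrite mulrDr mulr1; apply: lerD.
  exact: le_trans (fle m) (h2 _ (leq_maxr _ _)).
apply: le_trans (dk _ (subspaceB sC (Cu m) Cy)) _.
apply: le_trans (ler_wpM2r (snorm_ge0 _ _) (ler_norm k)) _.
by rewrite mulrC ler_wpM2r // h1 // leq_maxl.
Qed.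

End Coercivity.

(** * Towers, gaps and trickle-down *)

(* Vectors of [tower_space l] play the role of functions of an ordered
   [n]-simplex that depend only on its first [l] vertices, and [tower_swap i]
   exchanges the vertices of index [i] and [i.+1]. *)
Record tower (R : realType) (L : lmodType R[i]) (n : nat) := Tower {
  tower_dot : semidot L;
  tower_space : nat -> set L;
  tower_swap : nat -> L -> L;
  tower_subspace : forall l, subspace (tower_space l);
  tower_complete : forall l, scomplete tower_dot (tower_space l);
  tower_def : forall l x, tower_space l x -> tower_dot x x = 0 -> x = 0;
  tower_mono : forall l x, tower_space l x -> tower_space l.+1 x;
  tower_swapD : forall i x y,
    tower_swap i (x + y) = tower_swap i x + tower_swap i y;
  tower_swapZ : forall i (r : R) x,
    tower_swap i (r%:C%C *: x) = r%:C%C *: tower_swap i x;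
  tower_swapK : forall i x, tower_swap i (tower_swap i x) = x;
  tower_swap_dot : forall i x y,
    tower_dot (tower_swap i x) (tower_swap i y) = tower_dot x y;
  tower_swap_braid : forall i x, (i.+1 < n)%N ->
    tower_swap i (tower_swap i.+1 (tower_swap i x)) =
    tower_swap i.+1 (tower_swap i (tower_swap i.+1 x));
  tower_swap_space : forall i l x, (i < n)%N -> (i.+2 <= l)%N ->
    tower_space l x -> tower_space l (tower_swap i x);
  tower_swap_fix : forall i l x, (i < n)%N -> (l <= i)%N ->
    tower_space l x -> tower_swap i x = x }.

Section Tower.
Context (R : realType) (L : lmodType R[i]) (n : nat) (T : tower L n).
Implicit Types (x y f g : L) (i l : nat) (nu : R).

Local Notation dot := (tower_dot T).
Local Notation U := (tower_space T).
Local Notation s := (tower_swap T).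
Local Notation P l := (proj dot (U l)).

Let sU l : subspace (U l) := tower_subspace T l.
Let cU l : scomplete dot (U l) := @tower_complete R L n T l.

Definition gap i nu := forall f, U i.+1 f -> orthogonal_to dot (U i) f ->
  dot f (s i f) <= nu * dot f f.

(** This is connectedness of the link of x_0, ..., x_(i-1): a function of its vertices that takes
    the same value at adjacent x_i and x_(i+1) is constant. *)
Definition connected_at i := forall f, U i.+1 f -> s i f = f -> U i f.

Lemma tower_swapN i x : s i (- x) = - s i x.
Proof.
have e y : - y = ((-1 : R)%:C)%C *: y by rewrite rmorphN1 scaleN1r.
by rewrite !e tower_swapZ.
Qed.

Lemma tower_swapB i x y : s i (x - y) = s i x - s i y.
Proof. by rewrite tower_swapD tower_swapN. Qed.

Lemma tower_swap_dotC i x y : dot (s i x) y = dot x (s i y).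
Proof. by rewrite -(tower_swap_dot T i x) tower_swapK. Qed.

Lemma proj_spaceP l x : U l (P l x).
Proof. by have [] := projP x (sU l) (@cU l). Qed.

Lemma proj_unique l x p : U l p -> orthogonal_to dot (U l) (x - p) -> P l x = p.
Proof.
move=> Up xp; have [Uq xq] := projP x (sU l) (@cU l).
have Ud : U l (P l x - p) by exact: subspaceB.
apply/eqP; rewrite -subr_eq0; apply/eqP; apply: (tower_def Ud).
have e : P l x - p = (x - p) - (x - P l x) by rewrite opprB [RHS]addrC subrKA.
by rewrite {1}e sdotBl (xp _ Ud) (xq _ Ud) subrr.
Qed.

(* Pythagoras splits off the component in [U i], on which [s i] is trivial. *)
Lemma gap_decomp i nu f : (i < n)%N -> gap i nu -> U i.+1 f ->
  dot f (s i f) <=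
  nu * dot f f + (1 - nu) * dot (P i f) (P i f).
Proof.
move=> ni hg Uf; have [Up fp] := projP f (sU i) (@cU i).
set p := P i f in Up fp *; pose h := f - p.
have Uh : U i.+1 h by apply: subspaceB => //; exact: tower_mono.
have sp : s i p = p by apply: tower_swap_fix Up.
have hp : dot h p = 0 by exact: fp.
have := hg h Uh fp; have : f = h + p by rewrite subrK.
clearbody h p => ->.
rewrite tower_swapD sp !sdotE (sdotC _ p (s i h)) tower_swap_dotC sp.
by rewrite (sdotC _ p h) hp; lra.
Qed.

(** Here M = P_(i+1) s_i is the random walk at level i. Its eigenvalues satisfy t <= nu + (1 - nu)
    t^2, that is (1 - t)(nu - (1 - nu) t) >= 0, so none lies strictly between nu/(1 - nu) and 1.
    Connectedness excludes 1 on the complement of [U i], and [coercive_of_gap] for A = 1 - M turns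
    this into a bound without an eigenbasis; nu < 1/2 makes the constant positive. *)
Lemma trickle_down i nu : (i.+1 < n)%N -> nu < 1 / 2 -> connected_at i ->
  gap i.+1 nu -> gap i (nu / (1 - nu)).
Proof.
move=> ni nu2 conn hg; have ni' : (i < n)%N by apply: ltnW.
pose S := [set f | U i.+1 f /\ orthogonal_to dot (U i) f].
pose M f := P i.+1 (s i f).
have UM f : U i.+1 (M f) by exact: proj_spaceP.
have Mdot f g : U i.+1 g -> dot (M f) g = dot (s i f) g.
  exact: proj_dot.
have MD f g : M (f + g) = M f + M g.
  apply: proj_unique; first exact: subspaceD.
  by move=> y Uy; rewrite tower_swapD !sdotE !Mdot //; ring.
have MZ (r : R) f : M (r%:C%C *: f) = r%:C%C *: M f.
  apply: proj_unique; first exact: subspaceZ.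
  by move=> y Uy; rewrite tower_swapZ !sdotE !Mdot // subrr.
(* The gap at level i + 1 is applied to s_i f. As s_(i+1) f = f, the braid relation collapses <f,
   s_i s_(i+1) s_i f> to <f, s_i f>. *)
have MM f : U i.+1 f -> dot f (M f) <= nu * dot f f + (1 - nu) * dot (M f) (M f).
  move=> Uf; have sf : s i.+1 f = f by apply: tower_swap_fix Uf.
  have Usf : U i.+2 (s i f).
    by apply: tower_swap_space => //; exact: tower_mono.
  have := gap_decomp ni hg Usf; rewrite tower_swap_dot.
  suff -> : dot (s i f) (s i.+1 (s i f)) = dot f (M f) by [].
  rewrite tower_swap_dotC tower_swap_braid // sf -tower_swap_dotC sf.
  by rewrite sdotC -Mdot // sdotC.
pose A f := f - M f.
have AE f : A f = f - M f by [].
suff key : forall f, S f -> (1 - nu / (1 - nu)) * dot f f <= dot f (A f).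
  move=> f Uf fU; have := key f (conj Uf fU); rewrite AE sdotBr.
  by rewrite (sdotC _ f (M f)) Mdot // (sdotC _ (s i f)); lra.
have c0 : 0 < 1 - nu by lra.
have nuE : (1 - nu) * (1 - nu / (1 - nu)) = 1 - 2 * nu.
  by field; rewrite gt_eqF.
have Mle f : dot (M f) (M f) <= dot f f.
  by rewrite -[leRHS](tower_swap_dot T i) proj_le.
apply: coercive_of_gap.
- split; first by split; [exact: subspace0|move=> y _; exact: sdot0l].
  + move=> x y [Ux xU] [Uy yU]; split; first exact: subspaceD.
    by move=> z Uz; rewrite sdotDl xU // yU // addr0.
  + move=> r x [Ux xU]; split; first exact: subspaceZ.
    by move=> z Uz; rewrite sdotZl xU // mulr0.
- move=> u Su cu; have [l Ul ul] := @cU _ u (fun m => (Su m).1) cu.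
  exists l => //; split=> // z Uz; apply/eqP; rewrite -normr_eq0 eq_le normr_ge0.
  rewrite andbT; apply: (@small_seq_le _ _ _ (snorm dot z)) => e e0 _.
  have [N hN] := ul e e0; rewrite add0r.
  have -> : dot l z = - dot (u N - l) z by rewrite sdotBl (Su N).2 // sub0r opprK.
  rewrite normrN; apply: le_trans (sdot_CS _ _ _) _.
  by rewrite ler_wpM2r ?snorm_ge0 // hN.
- move=> f [Uf fU]; split; first by apply: subspaceB.
  move=> y Uy; rewrite sdotBl fU // Mdot; last exact: tower_mono.
  rewrite tower_swap_dotC (_ : s i y = y) ?fU ?subrr //.
  by apply: tower_swap_fix Uy.
- by move=> f g _ _; rewrite !AE MD opprD addrACA.
- by move=> r f _; rewrite !AE MZ scalerBr.
- move=> f g [Uf _] [Ug _]; rewrite !AE !sdotE Mdot // tower_swap_dotC.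
  by rewrite (sdotC _ f (M g)) Mdot // (sdotC _ (s i g)).
- move=> f [Uf _]; rewrite !AE !sdotE (sdotC _ (M f) f).
  by have := Mle f; lra.
- by rewrite -(pmulr_rgt0 _ c0) nuE; lra.
- move=> f [Uf _]; rewrite -(ler_pM2l c0) mulrA nuE !AE !sdotE (sdotC _ (M f) f).
  by have := MM f Uf; lra.
- move=> f [Uf fU] Af0.
  have Mf : M f = f.
    apply/esym/eqP; rewrite -subr_eq0; apply/eqP.
    by apply: (@tower_def _ _ _ T i.+1) => //; exact: subspaceB.
  (* M f = f means <s_i f, f> = |f|^2 with s_i an isometry, the equality case of Cauchy-Schwarz.
     Then [conn] puts [f] in [U i], to which it is orthogonal. *)
  have sf : s i f = f.
    apply/eqP; rewrite -subr_eq0; apply/eqP.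
    have Usf : U i.+2 (s i f - f).
      apply: subspaceB => //; last exact: tower_mono.
      by apply: tower_swap_space => //; exact: tower_mono.
    apply: (tower_def Usf); rewrite !sdotE tower_swap_dot (sdotC _ f (s i f)).
    by rewrite -(Mdot f f Uf) Mf; ring.
  by apply: fU; exact: conn.
Qed.

(** The form of the gap used for property (T): a function of x_0, ..., x_i that is almost unchanged
    by the swap is close to one of x_0, ..., x_(i-1). *)
Lemma gap_dist i nu f : (i < n)%N -> gap i nu -> U i.+1 f ->
  2 * (1 - nu) * dot (f - P i f) (f - P i f) <= dot (f - s i f) (f - s i f).
Proof.
move=> ni hg Uf; have := gap_decomp ni hg Uf.
rewrite proj_pythagoras; [|exact: sU|exact: (@cU i)].
rewrite !sdotE (sdotC _ (s i f) f) tower_swap_dot.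
by set q := dot (P i f) (P i f); lra.
Qed.

End Tower.

(* A chain of trickle-downs: [1 / (l + 1)] is mapped to [1 / l]. *)
Lemma gap_descent (R : realType) (n k i : nat) (nu : R) : (k < n)%N -> (i <= k)%N ->
  nu < (k.+1%:R)^-1 -> exists2 nu', nu' < (i.+1%:R)^-1 &
    forall (L : lmodType R[i]) (T : tower L n),
      (forall l, (l < k)%N -> connected_at T l) -> gap T k nu -> gap T i nu'.
Proof.
move=> kn ik nuk; rewrite -(subKn ik).
elim: (k - i)%N (leq_subr i k) => [|m IHm] mk; first by rewrite subn0; exists nu.
have [mu muk gm] := IHm (ltnW mk).
pose j := (k - m.+1)%N.
have jE : (k - m)%N = j.+1 by rewrite /j -subSn // subSS.
rewrite -/j; rewrite jE in muk gm.
have j1 : (j.+1 < n)%N by rewrite -jE (leq_ltn_trans _ kn) // leq_subr.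
have jR : 0 < j.+1%:R :> R by rewrite ltr0n.
have hj : mu * (j.+1%:R + 1) < 1.
  by rewrite -ltr_pdivlMr ?ltr_wpDl ?ltr0n // natr1 div1r.
have j1' : 1 <= j.+1%:R :> R by rewrite ler1n.
have mu2 : mu < 1 / 2.
  by apply: lt_le_trans muk _; rewrite div1r lef_pV2 ?posrE ?ltr0n // ler_nat.
exists (mu / (1 - mu)).
  rewrite ltr_pdivrMr; last by lra.
  rewrite -(ltr_pM2l jR) mulrA mulfV ?gt_eqF // mul1r.
  by lra.
move=> L T conn gk; apply: trickle_down => //; last exact: gm.
by apply: conn; rewrite /j -ltnS -jE ltnS leq_subr.
Qed.

(** * Garland's argument for cocycles *)

Section TowerCohomology.
Context (R : realType) (L : lmodType R[i]) (n : nat) (T : tower L n).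
Implicit Types (f g : L) (a c i j l m : nat).

Local Notation dot := (tower_dot T).
Local Notation U := (tower_space T).
Local Notation s := (tower_swap T).
Local Notation P l := (proj dot (U l)).

Lemma signC m : (-1) ^+ m = (((-1) ^+ m : R)%:C)%C :> R[i].
Proof. by rewrite rmorphXn rmorphN1. Qed.

(** The image of the cochains of degree [c]; adjacent transpositions generate the symmetric group,
    so the sign rule is imposed on them alone. *)
Definition alternating c : set L :=
  [set f | U c.+1 f /\ forall a, (a < c)%N -> s a f = - f].

Lemma alternating_subspace c : subspace (alternating c).
Proof.
have sU := tower_subspace T; split.
- split; first exact: subspace0.
  by move=> a _; rewrite -(subrr 0) tower_swapB !subrr oppr0.
- move=> f g [Uf af] [Ug ag]; split; first exact: subspaceD.
  by move=> a ac; rewrite tower_swapD af // ag // opprD.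
- move=> r f [Uf af]; split; first exact: subspaceZ.
  by move=> a ac; rewrite tower_swapZ af // scalerN.
Qed.

Lemma snorm_swap i f : snorm dot (s i f) = snorm dot f.
Proof. by rewrite /snorm tower_swap_dot. Qed.

Lemma alternating_complete c : (c <= n)%N -> scomplete dot (alternating c).
Proof.
move=> cn u au cu.
have [l Ul ul] := @tower_complete _ _ _ T c.+1 u (fun m => (au m).1) cu.
exists l => //; split=> // a ac; apply/eqP; rewrite -addr_eq0; apply/eqP.
have an : (a < n)%N by exact: leq_trans cn.
have Us : U c.+1 (s a l + l).
  by apply: subspaceD => //; [exact: tower_subspace|exact: tower_swap_space].
apply: (tower_def Us); apply/eqP; rewrite -snorm_eq0 eq_le snorm_ge0 andbT.
apply: (@small_seq_le _ _ _ 2) => e e0 _; rewrite add0r.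
have [N hN] := ul e e0.
have -> : s a l + l = s a (l - u N) + (l - u N).
  by rewrite tower_swapB (au N).2 // opprK addrACA subrr addr0.
apply: le_trans (ler_snormD _ _ _) _; rewrite snorm_swap snorm_distC.
by have := hN N (leqnn N); lra.
Qed.

Fixpoint swap_chain c m f := if m is m'.+1 then s (c - m') (swap_chain c m' f) else f.

(* [swap_chain c (c.+1 - i) f] is [f] evaluated on the first [c.+2] vertices with
   the [i]-th one omitted. *)
Definition tower_d c f := \sum_(i < c.+2) (-1) ^+ i *: swap_chain c (c.+1 - i) f.

Lemma swap_chainD c m f g :
  swap_chain c m (f + g) = swap_chain c m f + swap_chain c m g.
Proof. by elim: m => //= m ->; rewrite tower_swapD. Qed.

Lemma tower_dD c f g : tower_d c (f + g) = tower_d c f + tower_d c g.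
Proof.
by rewrite -big_split; apply: eq_bigr => i _; rewrite swap_chainD scalerDr.
Qed.

Lemma snorm_swap_chain c m f : snorm dot (swap_chain c m f) = snorm dot f.
Proof. by elim: m => //= m <-; rewrite snorm_swap. Qed.

Lemma sdot_sign m f g : dot ((-1) ^+ m *: f) g = (-1) ^+ m * dot f g.
Proof. by rewrite signC sdotZl. Qed.

Lemma snorm_tower_d c f : snorm dot (tower_d c f) <= c.+2%:R * snorm dot f.
Proof.
apply: (@le_trans _ _ (\sum_(i < c.+2) snorm dot f)); last first.
  by rewrite sumr_const card_ord mulr_natl.
rewrite /tower_d; elim/big_ind2: _ => [|x1 y1 x2 y2 h1 h2|i _].
- by rewrite snorm0.
- exact: le_trans (ler_snormD _ _ _) (lerD h1 h2).
- by rewrite signC snormZ normrX normrN1 expr1n mul1r snorm_swap_chain.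
Qed.

(** Each swap moved onto the alternating [g] costs a sign, which cancels the sign of the face, so
    all j + 2 faces contribute equally. Thus the adjoint of [tower_d] is a multiple of the
    projection to [U j.+1]. *)
Lemma sdot_tower_d j f g : alternating j.+1 g ->
  dot (tower_d j f) g = (-1) ^+ j.+1 * j.+2%:R * dot f g.
Proof.
move=> [Ug ag]; rewrite /tower_d sdot_suml.
have chain m : (m <= j.+1)%N -> dot (swap_chain j m f) g = (-1) ^+ m * dot f g.
  elim: m => [|m IHm] mj; first by rewrite mul1r.
  rewrite /= tower_swap_dotC ag ?ltnS ?leq_subr // sdotNr IHm 1?ltnW //.
  by rewrite exprS mulN1r mulNr.
rewrite (eq_bigr (fun=> (-1) ^+ j.+1 * dot f g)).
  by rewrite sumr_const card_ord -[LHS]mulr_natr mulrAC.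
move=> i _; rewrite sdot_sign chain ?leq_subr // mulrA -exprD subnKC //.
by rewrite -ltnS.
Qed.

(** The last face gives |f|^2, and each of the other c + 1 faces reduces to <f, s_c f> by the sign
    rule. For a cocycle the left side vanishes, which yields <f, s_c f> = |f|^2/(c + 1). *)
Lemma sdot_tower_d_self c f : alternating c f ->
  dot (tower_d c f) f = (-1) ^+ c.+1 * (dot f f - c.+1%:R * dot f (s c f)).
Proof.
move=> [Uf af]; rewrite /tower_d sdot_suml big_ord_recr /= subnn /=.
have chain m : (m <= c)%N ->
    dot (swap_chain c m.+1 f) f = (-1) ^+ m * dot f (s c f).
  elim: m => [|m IHm] mc; first by rewrite /= subn0 mul1r tower_swap_dotC.
  rewrite [swap_chain _ _ _]/= tower_swap_dotC af; last first.
    by rewrite -subn_gt0 subKn.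
  by rewrite sdotNr [dot _ f]IHm 1?ltnW // exprS mulN1r mulNr.
rewrite (eq_bigr (fun=> (-1) ^+ c * dot f (s c f))).
  rewrite sumr_const card_ord -[X in X + _]mulr_natr sdot_sign exprS; ring.
move=> i _; rewrite sdot_sign subSn -1?ltnS // chain ?leq_subr // mulrA -exprD.
by rewrite subnKC // -ltnS.
Qed.

Lemma proj_alternating j f : (j.+1 < n)%N -> alternating j.+1 f ->
  alternating j (P j.+1 f).
Proof.
move=> jn [Uf af]; split; first exact: proj_spaceP.
move=> a aj; have an : (a < n)%N by apply: ltn_trans aj (ltn_trans _ jn).
rewrite -[LHS]opprK; congr (- _); apply/esym.
have [UP oP] := projP f (tower_subspace T j.+1) (@tower_complete _ _ _ T j.+1).
apply: proj_unique.
  by apply: subspaceN; [exact: tower_subspace|exact: tower_swap_space].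
move=> y Uy; rewrite opprK -[f in f + _]opprK -(af a); last exact: ltnW.
rewrite addrC -tower_swapB tower_swap_dotC -opprB sdotNl oP ?oppr0 //.
exact: tower_swap_space.
Qed.

(* Garland's argument: for a cocycle [f] the mixed term [dot f (s f)] is
   [dot f f / (j + 2)], so the gap bounds the component of [f] in [U j.+1] from
   below, and this component is [delta f] up to a factor. *)
Lemma tower_exact j nu : (j.+1 < n)%N -> gap T j.+1 nu -> nu < (j.+2%:R)^-1 ->
  (forall g, alternating j g ->
     alternating j.+1 (tower_d j g) /\ tower_d j.+1 (tower_d j g) = 0) ->
  forall f, alternating j.+1 f -> tower_d j.+1 f = 0 ->
  exists2 g, alternating j g & f = tower_d j g.
Proof.
move=> jn hg nuj hd f af df0.
pose Z := [set f | alternating j.+1 f /\ tower_d j.+1 f = 0].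
have c0 : 0 < j.+2%:R :> R by rewrite ltr0n.
have nu1 : nu < 1.
  by apply: lt_le_trans nuj _; rewrite invf_le1 ?ler1n.
have d0 c : tower_d c 0 = 0.
  by apply: (@addrI _ (tower_d c 0)); rewrite -tower_dD !addr0.
have dZ c (r : R) g : tower_d c (r%:C%C *: g) = r%:C%C *: tower_d c g.
  rewrite /tower_d scaler_sumr; apply: eq_bigr => i _.
  rewrite scalerA mulrC -scalerA; congr (_ *: _).
  by elim: (c.+1 - i)%N => //= m ->; rewrite tower_swapZ.
(* This factor makes <d (delta x), x> = |P x|^2. As [tower_d] has norm at most j + 2 = 1/|t|, it
   also gives |d (delta x)| <= |P x|, whence |x - d (delta x)|^2 <= |x|^2 - |P x|^2. *)
pose t : R := (-1) ^+ j.+1 / j.+2%:R.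
pose delta g := t%:C%C *: P j.+1 g.
have tE : (-1) ^+ j.+1 * j.+2%:R * t = 1.
  by rewrite /t mulrACA -expr2 sqrr_sign mul1r mulfV ?gt_eqF.
have tn : j.+2%:R * `|t| = 1.
  rewrite /t normrM normrX normrN1 expr1n mul1r ger0_norm ?invr_ge0 ?ltW //.
  by rewrite mulfV ?gt_eqF.
(* Solving |x|^2/(j + 2) <= nu |x|^2 + (1 - nu) |P x|^2 for |P x|^2 gives |P x|^2 >= kappa |x|^2. *)
pose kappa := ((j.+2%:R)^-1 - nu) / (1 - nu).
have kappa0 : 0 < kappa by rewrite divr_gt0 // subr_gt0.
have sA := alternating_subspace; have cj : (j <= n)%N by exact: ltnW (ltnW jn).
apply: (@exact_of_contraction _ _ dot (alternating j) Z (tower_d j) delta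
  (1 - kappa) j.+2%:R) => //.
- exact: alternating_complete.
- split; first by split; [exact: subspace0|exact: d0].
  + move=> x y [ax dx] [ay dy]; split; first exact: subspaceD.
    by rewrite tower_dD dx dy addr0.
  + move=> r x [ax dx]; split; first exact: subspaceZ.
    by rewrite dZ dx scaler0.
- by move=> x [[Ux _] _]; exact: tower_def Ux.
- by move=> x y _ _; exact: tower_dD.
- by move=> x _; exact: snorm_tower_d.
- move=> x [ax _]; apply: subspaceZ => //; exact: proj_alternating.
- move=> x _; rewrite snormZ.
  have t1 : `|t| <= 1.
    by rewrite -(ler_pM2l c0) tn mulr1 ler1n.
  apply: le_trans (_ : snorm dot (P j.+1 x) <= _).
    by rewrite ler_piMl ?snorm_ge0.
  apply: snorm_le_sdot; apply: proj_le; first exact: tower_subspace.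
  exact: tower_complete.
- by rewrite gtrBl.
- move=> x [ax dx]; have Ux := ax.1.
  have xs : dot x x = j.+2%:R * dot x (s j.+1 x).
    have := sdot_tower_d_self ax; rewrite dx sdot0l => /esym/eqP.
    by rewrite mulf_eq0 signr_eq0 /= subr_eq0 => /eqP.
  have := gap_decomp jn hg Ux; set q := dot (P _ x) (P _ x) => hq.
  have kq : kappa * dot x x <= q.
    rewrite /kappa mulrAC ler_pdivrMr ?subr_gt0 // mulrBl.
    have -> : j.+2%:R^-1 * dot x x = dot x (s j.+1 x).
      by rewrite xs mulrA mulVf ?gt_eqF // mul1r.
    by lra.
  have xd : dot (tower_d j (delta x)) x = q.
    rewrite sdot_tower_d // /delta sdotZl mulrA tE mul1r.
    rewrite sdotC /q; apply/esym; apply: proj_dot; last exact: proj_spaceP.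
      exact: tower_subspace.
    exact: tower_complete.
  have dd : dot (tower_d j (delta x)) (tower_d j (delta x)) <= q.
    have := snorm_tower_d j (delta x).
    rewrite /delta snormZ mulrA tn mul1r.
    rewrite -(@ler_pXn2r _ 2) ?nnegrE ?snorm_ge0 // !sqr_snorm.
    by [].
  rewrite !sdotE (sdotC _ x) xd.
  by lra.
Qed.

End TowerCohomology.

(** * Connectivity and combinatorics of simplicial complexes *)

Section Connectivity.
Context (R : realType) {V : choiceType}.
Implicit Types (Y : simplicialComplex V) (A : set V).

Lemma closed_simplex_vertex (s : {fset V}) (w : V -> R) :
  closed_simplex s w -> exists2 v, v \in s & 0 < w v.
Proof.
move=> [w0 _ w1]; apply: contrapT => h.
have : \sum_(v <- s) w v = 0.
  rewrite big_seq big1 // => v vs; apply/eqP; rewrite eq_le w0 andbT leNgt.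
  by apply/negP => wv; apply: h; exists v.
by rewrite w1 => /eqP; rewrite oner_eq0.
Qed.

(** The points with a positive coordinate at some vertex of [A] form an open and closed set:
    vertices of a simplex are adjacent, so the trace on each closed simplex is everything or
    empty. *)
Lemma vertex_induction Y A : connected [set: realization R Y] ->
  (exists2 v, A v & Y [fset v]%fset) ->
  (forall u v, A u -> Y [fset u; v]%fset -> A v) ->
  forall v, Y [fset v]%fset -> A v.
Proof.
move=> conn [v0 Av0 Yv0] hA.
have point v : Y [fset v]%fset -> exists p : realization R Y,
    forall u, bary p u = (u == v)%:R.
  move=> Yv; have cs : exists2 s, Y s & closed_simplex s (fun u => (u == v)%:R : R).
    exists [fset v]%fset => //; split=> [u|u|]; first exact: ler0n.
    - by rewrite inE => /negbTE ->.
    - by rewrite big_seq_fset1 eqxx.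
  by exists (Realization cs).
pose B := [set p : realization R Y | exists2 v, A v & 0 < bary p v].
have same s u v : Y s -> u \in s -> v \in s -> A u -> A v.
  move=> Ys us vs Au; apply: (hA u) => //; apply: simplex_face Ys _ _.
    by apply/fsubsetP => x; rewrite !inE => /orP[] /eqP ->.
  by apply/fset0Pn; exists u; rewrite !inE eqxx.
have Bs s p : Y s -> closed_simplex s (bary p) ->
    B p <-> exists2 v, v \in s & A v.
  move=> Ys cs; split=> [[v Av pv]|[v vs Av]].
    exists v => //; apply: contraPT pv => vs; case: cs => _ /(_ v vs) -> _.
    by rewrite ltxx.
  have [u us pu] := closed_simplex_vertex cs.
  by exists u => //; exact: same vs us Av.
have oB : open B.
  move=> s Ys; have [h|h] := pselect (exists2 v, v \in s & A v).
    by exists setT; [exact: openT|move=> p /(Bs s p Ys) Bp; split=> // _; exact/Bp].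
  by exists set0; [exact: open0|move=> p /(Bs s p Ys) Bp; split=> // /Bp].
have oBc : open (~` B).
  move=> s Ys; have [h|h] := pselect (exists2 v, v \in s & A v).
    by exists set0; [exact: open0|move=> p /(Bs s p Ys) Bp; split=> // Bcp; exact/Bcp/Bp].
  by exists setT; [exact: openT|move=> p /(Bs s p Ys) Bp; split=> // _ /Bp].
have BT : B = setT.
  apply: conn.
  - have [p pE] := point v0 Yv0; exists p, v0 => //.
    by rewrite pE eqxx.
  - by exists B => //; rewrite setTI.
  - by exists B; rewrite ?setTI // -[B]setCK; exact: open_closedC.
move=> v Yv; have [p pE] := point v Yv.
have : B p by rewrite BT.
move=> [u Au]; rewrite pE; case: eqVneq => [<-//|_].
by rewrite ltxx.
Qed.

(** The tracks [h (x, t)], for t in [0, 1], are connected, cover the space and all end at [x0]. *)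
Lemma contractible_connected (T : topologicalType) :
  contractible R T -> connected [set: T] /\ [set: T] !=set0.
Proof.
move=> [x0 [h [hc h0 h1]]]; split; last by exists x0.
pose I x := [set h (x, t) | t in (`[0, 1] : set R)].
have -> : [set: T] = \bigcup_x I x.
  apply/esym; rewrite -subTset => x _; exists x => //; exists 0; last exact: h0.
  by rewrite /= in_itv /= lexx ler01.
apply: bigcup_connected.
  exists x0 => x _; exists 1; last exact: h1.
  by rewrite /= in_itv /= lexx ler01.
move=> x _.
have -> : I x = h @` (pair x @` (`[0, 1] : set R)) by rewrite image_comp.
apply: connected_continuous_connected.
  apply: connected_continuous_connected; first exact: segment_connected.
  apply: continuous_subspaceT => t.
  exact: (@cvg_pair _ _ _ (nbhs t) (nbhs x) (nbhs t) _ _ _ (fun=> x) id (cvg_cst _) cvg_id).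
apply: continuous_subspaceW hc => _ [t t01 <-]; split=> //.
Qed.

End Connectivity.

Lemma finite_set_of_inj (T T' : Type) (f : T -> T') (A : set T) :
  (forall x y, A x -> A y -> f x = f y -> x = y) -> finite_set (f @` A) ->
  finite_set A.
Proof.
move=> fI; rewrite (@eq_finite_set _ _ (f @` A) A) //.
by apply: inj_card_eq => x y; rewrite !inE; exact: fI.
Qed.

Section Osimplices.
Context {V : choiceType} (X : simplicialComplex V).
Implicit Types (s t : {fset V}) (k l : nat).

HB.instance Definition _ k := gen_eqMixin (osimplex X k).
HB.instance Definition _ k := gen_choiceMixin (osimplex X k).

Lemma osimplex_inj k (x y : osimplex X k) : (forall i, x i = y i) -> x = y.
Proof.
case: x y => [x xi xX] [y yi yX] /= xy.
have e : x = y by apply/funext.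
by case: _ / e in yi yX *; congr OSimplex; exact: Prop_irrelevance.
Qed.

Definition support k (x : osimplex X k) : {fset V} :=
  [fset x i | i in 'I_k.+1]%fset.

Lemma supportP k (x : osimplex X k) : X (support x).
Proof. exact: osimplexP. Qed.

Lemma mem_support k (x : osimplex X k) i : x i \in support x.
Proof. by apply/imfsetP; exists i. Qed.

Lemma has_dim_support k (x : osimplex X k) : has_dim k (support x).
Proof.
rewrite /has_dim card_imfset /=; last exact: overt_inj.
by rewrite -[RHS]card_ord cardE.
Qed.

Lemma osimplex_of_seq k s (p : seq V) : X s -> has_dim k s -> uniq p ->
  {subset p <= s} -> exists x : osimplex X k, support x = s /\
    forall i : 'I_k.+1, (i < size p)%N -> forall v, x i = nth v p i.
Proof.
move=> Xs ds up ps.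
pose q := p ++ [seq v <- s | v \notin p].
have uq : uniq q.
  rewrite cat_uniq up filter_uniq ?fset_uniq // andbT /=.
  by apply/hasPn => v; rewrite mem_filter => /andP[].
have qs : q =i s.
  move=> v; rewrite mem_cat mem_filter.
  by case: (boolP (v \in p)) => [/ps ->|].
have sq : size q = k.+1.
  rewrite -ds; apply/eqP; rewrite -uniq_size_uniq ?fset_uniq //.
have [v0 _] : exists v0 : V, v0 \in s.
  by apply/fset0Pn; exact: simplex_neq0 Xs.
have qi : injective (fun i : 'I_k.+1 => nth v0 q i).
  move=> i j /eqP; rewrite nth_uniq ?sq // => /eqP; exact: val_inj.
have sE : [fset nth v0 q (i : 'I_k.+1) | i in 'I_k.+1]%fset = s.
  apply/fsetP => v; rewrite -qs; apply/imfsetP/idP => [[i _ ->]|].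
    by rewrite mem_nth ?sq.
  move=> vq; have ik : (index v q < k.+1)%N by rewrite -sq index_mem.
  by exists (Ordinal ik); rewrite //= nth_index.
have qX : X [fset nth v0 q (i : 'I_k.+1) | i in 'I_k.+1]%fset by rewrite sE.
exists (OSimplex qi qX); split=> // i ip v /=.
by rewrite nth_cat ip; exact: set_nth_default.
Qed.

Lemma finite_orderings k s : finite_set [set x : osimplex X k | (support x `<=` s)%fset].
Proof.
pose F (x : osimplex X k) : {ffun 'I_k.+1 -> option s} :=
  [ffun i => insub (x i)].
apply: (@finite_set_of_inj _ _ F); last exact: finite_finset.
move=> x y /= xs ys /ffunP xy; apply: osimplex_inj => i.
have := xy i; rewrite !ffunE.
have xi : x i \in s by apply: (fsubsetP xs); exact: mem_support.
have yi : y i \in s by apply: (fsubsetP ys); exact: mem_support.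
by rewrite !insubT => -[].
Qed.

End Osimplices.

Lemma fdisjointDX (K : choiceType) (A B : {fset K}) : [disjoint A `\` B & B]%fset.
Proof. by apply/fdisjointP => x; rewrite inE => /andP[]. Qed.

Lemma fsetUD_sub (K : choiceType) (A B : {fset K}) :
  (B `<=` A)%fset -> (B `|` (A `\` B))%fset = A.
Proof. by move=> /fsetIidPr BA; rewrite -{1}BA fsetID. Qed.

(** * Connected links, finite and countable stars *)

Section LinkVertices.
Context {V : choiceType} (X : simplicialComplex V).
Implicit Types (t : {fset V}) (A : set V).

(* Vertices of the link of [t], where the link of the empty set is [X]. *)
Definition link_vert t : set V := [set v | v \notin t /\ X (v |` t)%fset].

(** Connectedness as induction along edges, for links of positive dimension n - #|t|. The empty [t]
    stands for [X] itself and serves level 0 of the tower. *)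
Definition links_connected (n : nat) := forall t A, t = fset0 \/ X t ->
  (#|` t| < n)%N -> (exists2 v, A v & link_vert t v) ->
  (forall u v, A u -> link_vert t u -> link_vert t v ->
     X (u |` (v |` t))%fset -> A v) ->
  forall v, link_vert t v -> A v.

End LinkVertices.

Section Stars.
Context (R : realType) {V : choiceType} (X : simplicialComplex V) (n r : nat).
Hypothesis hconn : connected [set: realization R X].
Hypothesis hne : exists s, X s.
Hypothesis hpure : pure X n.
Hypothesis hlinks : forall (t : {fset V}) (d : nat), X t ->
  dimension_eq (link X t) d -> (0 < d)%N ->
  connected [set: realization R (link X t)].
Hypothesis hr : (r <= n - 2)%N.
Hypothesis hn : (2 <= n)%N.
Hypothesis hfin : forall t : {fset V}, X t -> has_dim r t ->
  finite_set [set s | link X t s].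
Implicit Types (s t : {fset V}) (k l : nat) (A : set V).

Lemma card_simplex s : X s -> (#|` s| <= n.+1)%N.
Proof. by move=> /hpure[t [_ <- st]]; exact: fsubset_leq_card. Qed.

Lemma link_dimension t : X t -> (#|` t| <= n)%N ->
  dimension_eq (link X t) (n - #|` t|).
Proof.
move=> Xt tn; have [s [Xs ds ts]] := hpure Xt; split.
  exists (s `\` t)%fset; last first.
    by rewrite /has_dim cardfsDS // ds subSn.
  split.
  - rewrite -cardfs_gt0 cardfsDS // ds subn_gt0 //.
  - exact: fdisjointDX.
  - by rewrite fsetUD_sub.
move=> u [_ dut Xtu]; have := card_simplex Xtu.
rewrite cardfsU fdisjoint_sym in dut *.
move: dut; rewrite -fsetI_eq0 => /eqP ->.
by rewrite cardfs0 subn0 -subSn // -leq_subRL // ?leq_subr // ltnW.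
Qed.

Lemma link_induction : links_connected X n.
Proof.
move=> t A tX tn [v0 Av0 tv0] hA.
case: (eqVneq t fset0) => [t0|t0].
  move=> v tv; apply: (vertex_induction (A := A) hconn) => //.
  - by exists v0 => //; have [_] := tv0; rewrite t0 fsetU0.
  - move=> x y Ax Xxy.
    have Xx z : z \in [fset x; y]%fset -> link_vert X t z.
      move=> zxy; split; first by rewrite t0 inE.
      rewrite t0 fsetU0; apply: simplex_face Xxy _ _; first by rewrite fsub1set.
      by apply/fset0Pn; exists z; rewrite inE.
    apply: (hA x) => //; try (by apply: Xx; rewrite !inE eqxx ?orbT).
    by rewrite t0 fsetU0.
  - by have [_] := tv; rewrite t0 fsetU0.
have Xt : X t by case: tX => // t0'; rewrite t0' eqxx in t0.
have lv v : link X t [fset v]%fset <-> link_vert X t v.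
  split=> [[_ dt]|[vt Xvt]]; rewrite /link_vert /=.
    by rewrite fdisjoint1X in dt; rewrite fsetUC.
  split; first by apply/fset0Pn; exists v; rewrite inE.
    by rewrite fdisjoint1X.
  by rewrite fsetUC.
move=> v tv.
have conn : connected [set: realization R (link X t)].
  by apply: hlinks (link_dimension Xt (ltnW tn)) _ => //; rewrite subn_gt0.
apply: (vertex_induction (A := A) conn) => //; last exact/lv.
- by exists v0 => //; apply/lv.
- move=> x y Ax xy; have face z : z \in [fset x; y]%fset -> link_vert X t z.
    move=> zxy; apply/lv; apply: (simplex_face xy); first by rewrite fsub1set.
    by apply/fset0Pn; exists z; rewrite inE.
  apply: (hA x) => //; try (by apply: face; rewrite !inE eqxx ?orbT).
  by have [_ _] := xy; rewrite fsetUC -fsetUA.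
Qed.

(** A simplex containing [t] is determined by its part outside an r-dimensional face [e] of [t], and
    this part is empty or a simplex of the finite link of [e]. *)
Lemma star_finite t : X t -> (r < #|` t|)%N ->
  finite_set [set s | X s /\ (t `<=` s)%fset].
Proof.
move=> Xt rt; pose e := [fset v in take r.+1 t]%fset.
have et : (e `<=` t)%fset by apply/fsubsetP => v; rewrite inE => /mem_take.
have de : has_dim r e.
  rewrite /has_dim card_fseq undup_id ?take_uniq ?fset_uniq //.
  by rewrite size_take_min; apply/minn_idPl.
have Xe : X e by apply: simplex_face Xt et _; rewrite -cardfs_gt0 de.
have fin := hfin Xe de.
apply: (@finite_set_of_inj _ _ (fun s => s `\` e)%fset).
  move=> s s' [_ ts] [_ ts'] ss'.
  rewrite -(fsetUD_sub (fsubset_trans et ts)).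
  by rewrite -(fsetUD_sub (fsubset_trans et ts')) ss'.
apply: (@sub_finite_set _ _ ([set fset0] `|` [set s | link X e s])); last first.
  by rewrite finite_setU; split=> //; exact: finite_set1.
move=> _ [s [Xs ts] <-]; case: (eqVneq (s `\` e)%fset fset0) => [->|se0].
  by left.
right; split=> //; first exact: fdisjointDX.
by rewrite fsetUD_sub //; exact: fsubset_trans et ts.
Qed.

(** By induction on r + 1 - #|t|, starting from the finite stars. For smaller [t], each vertex v of
    the link has a countable star over v and t, hence countably many neighbours, and connectedness
    reaches all vertices in countably many steps. The countability is what gives stabilizers
    positive Haar measure. *)
Lemma star_countable t : t = fset0 \/ X t ->
  countable [set s | X s /\ (t `<=` s)%fset].
Proof.
elim: {t}(r.+1 - #|` t|)%N {-2}t (leqnn (r.+1 - #|` t|)) => [|m IHm] t.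
  rewrite leqn0 subn_eq0 => rt [t0|Xt]; first by rewrite t0 cardfs0 in rt.
  exact/finite_set_countable/star_finite.
move=> tm tX; have [rt|tr] := ltnP r #|` t|.
  case: tX => [t0|Xt]; first by rewrite t0 cardfs0 in rt.
  exact/finite_set_countable/star_finite.
have tn : (#|` t| < n)%N by lia.
have ctv v : link_vert X t v -> countable [set s | X s /\ (v |` t `<=` s)%fset].
  move=> [vt Xvt]; apply: IHm; last by right.
  by rewrite cardfsU1 vt add1n subSS; move: tm; rewrite subSn.
have [v0 tv0] : exists v, link_vert X t v.
  have [s0 [Xs0 ds0 ts0]] : exists s, [/\ X s, has_dim n s & (t `<=` s)%fset].
    case: tX => [->|/hpure //]; have [s /hpure[u [Xu du _]]] := hne.
    by exists u.
  have /fset0Pn[v] : (s0 `\` t)%fset != fset0.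
    by rewrite -cardfs_gt0 cardfsDS // ds0 subn_gt0 ltnS ltnW.
  rewrite inE => /andP[vt vs]; exists v; split=> //.
  apply: simplex_face Xs0 _ _; first by rewrite fsubUset fsub1set vs.
  by apply/fset0Pn; exists v; rewrite !inE eqxx.
pose nb u := \bigcup_(s in [set s | X s /\ (u |` t `<=` s)%fset]) [set` s].
(* [W i] contains the link vertices at distance at most [i] from [v0]. *)
pose W := fix W m := if m is m'.+1 then
    W m' `|` \bigcup_(u in W m' `&` link_vert X t) nb u else [set v0].
have cW i : countable (W i).
  elim: i => [|i IHi]; first exact: countable1.
  rewrite /= -bigcup2E; apply: bigcup_countable => // j _.
  rewrite /bigcup2; case: j => [//|[|j]]; last exact: countable0.
  apply: bigcup_countable; first exact: sub_countable (subset_card_le (@subIsetl _ _ _)) IHi.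
  move=> u [_ tu]; apply: bigcup_countable; first exact: ctv.
  by move=> s _; exact: countable_fset.
have all v : link_vert X t v -> (\bigcup_i W i) v.
  apply: link_induction => //; first by exists v0 => //; exists 0%N.
  move=> u w [i _ Wu] tu tw Xuw; exists i.+1 => //; right; exists u => //.
  exists (u |` (w |` t))%fset; last by rewrite /= !inE eqxx orbT.
  by split=> //; apply: fsetUS; exact: fsubsetUr.
have sub : [set s | X s /\ (t `<=` s)%fset] `<=` [set t] `|`
    \bigcup_(v in (\bigcup_i W i) `&` link_vert X t) [set s | X s /\ (v |` t `<=` s)%fset].
  move=> s [Xs ts]; case: (eqVneq s t) => [->|st]; first by left.
  right; have /fset0Pn[v] : (s `\` t)%fset != fset0.
    rewrite fsetD_eq0; apply: contra st => st; rewrite eqEfsubset.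
    by rewrite st ts.
  rewrite inE => /andP[vt vs].
  have sv : (v |` t `<=` s)%fset by rewrite fsubUset fsub1set vs.
  have tv : link_vert X t v.
    split=> //; apply: simplex_face Xs sv _.
    by apply/fset0Pn; exists v; rewrite !inE eqxx.
  by exists v => //; split=> //; exact: all.
apply: sub_countable (subset_card_le sub) _.
rewrite -bigcup2E; apply: bigcup_countable => // j _.
rewrite /bigcup2; case: j => [|[|j]]; [exact: countable1| |exact: countable0].
apply: bigcup_countable; last by move=> v [_ tv]; exact: ctv.
apply: sub_countable (subset_card_le (@subIsetl _ _ _)) _.
by apply: bigcup_countable.
Qed.

Lemma osimplex_countable k : countable [set: osimplex X k].
Proof.
have -> : [set: osimplex X k] =
    \bigcup_(s in [set s | X s /\ (fset0 `<=` s)%fset])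
      [set x : osimplex X k | (support x `<=` s)%fset].
  apply/esym; rewrite -subTset => x _; exists (support x); last exact: fsubset_refl.
  by split; [exact: supportP|exact: fsub0set].
apply: bigcup_countable; first by apply: star_countable; left.
by move=> s _; exact/finite_set_countable/finite_orderings.
Qed.

End Stars.

(** * Orbits and Haar weights *)

Section Representatives.
Context (Y : Type) (e : Y -> Y -> Prop).
Hypothesis e_refl : forall x, e x x.
Hypothesis e_sym : forall x y, e x y -> e y x.
Hypothesis e_trans : forall x y z, e x y -> e y z -> e x z.

(** The choice depends on the predicate [e x], which related points share by extensionality; this
    makes the representative constant on classes. *)
Definition class_rep (x : Y) : Y := sval (cid (ex_intro (e x) x (e_refl x))).

Lemma class_repP x : e x (class_rep x).
Proof. by rewrite /class_rep; case: cid. Qed.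

Lemma class_rep_eq x y : e x y -> class_rep x = class_rep y.
Proof.
move=> exy; have E : e x = e y.
  apply/funext => z; apply/propext; split; first exact: e_trans (e_sym exy).
  exact: e_trans exy.
rewrite /class_rep; move: (ex_intro _ _ _) (ex_intro _ _ _); rewrite E => p q.
by rewrite (Prop_irrelevance p q).
Qed.

Lemma class_rep_rel x y : class_rep x = class_rep y -> e x y.
Proof.
move=> xy; apply: e_trans (class_repP x) _; rewrite xy.
exact/e_sym/class_repP.
Qed.

Lemma class_repK x : class_rep (class_rep x) = class_rep x.
Proof. exact/class_rep_eq/e_sym/class_repP. Qed.

End Representatives.

Section OsimplexAction.
Context {V : choiceType} {X : simplicialComplex V} {G : topGroupType}.
Variable a : simplicialAction G X.
Implicit Types (k : nat) (g h : G).

Local Notation "g ** x" := (osimplex_act a g x) (at level 40).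

Lemma osimplex_act1 k (x : osimplex X k) : 1%g ** x = x.
Proof. by apply: osimplex_inj => i; rewrite /= Defs.act1. Qed.

Lemma osimplex_actM k g h (x : osimplex X k) : (g * h)%g ** x = g ** (h ** x).
Proof. by apply: osimplex_inj => i; rewrite /= Defs.actM. Qed.

Lemma osimplex_actK k g (x : osimplex X k) : g^-1%g ** (g ** x) = x.
Proof. by rewrite -osimplex_actM mulVg osimplex_act1. Qed.

Lemma osimplex_actKV k g (x : osimplex X k) : g ** (g^-1%g ** x) = x.
Proof. by rewrite -osimplex_actM mulgV osimplex_act1. Qed.

Lemma osimplex_act_perm k g (x : osimplex X k) s :
  g ** osimplex_perm x s = osimplex_perm (g ** x) s.
Proof. exact: osimplex_inj. Qed.

Lemma osimplex_permM k (x : osimplex X k) s t :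
  osimplex_perm x (s * t)%g = osimplex_perm (osimplex_perm x t) s.
Proof. by apply: osimplex_inj => i /=; rewrite permM. Qed.

Lemma osimplex_perm1 k (x : osimplex X k) : osimplex_perm x 1%g = x.
Proof. by apply: osimplex_inj => i /=; rewrite perm1. Qed.

Lemma support_act k g (x : osimplex X k) :
  support (g ** x) = [fset a g v | v in support x]%fset.
Proof.
apply/fsetP => v; apply/imfsetP/imfsetP => [[i _ ->]|[u /imfsetP[i _ ->] ->]].
  by exists (x i) => //; exact: mem_support.
by exists i.
Qed.

Definition ostab k (x : osimplex X k) : set G := [set g | g ** x = x].

Lemma ostabE k (x : osimplex X k) : ostab x = pointwise_stabilizer a (support x).
Proof.
apply/seteqP; split=> g.
  by move=> gx v /imfsetP[i _ ->]; rewrite -[in RHS]gx.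
by move=> gx; apply: osimplex_inj => i; apply: gx; exact: mem_support.
Qed.

Definition orbit_rel k (x y : osimplex X k) := exists g, y = g ** x.

Lemma orbit_rel_refl k (x : osimplex X k) : orbit_rel x x.
Proof. by exists 1%g; rewrite osimplex_act1. Qed.

Lemma orbit_rel_sym k (x y : osimplex X k) : orbit_rel x y -> orbit_rel y x.
Proof. by move=> [g ->]; exists g^-1%g; rewrite osimplex_actK. Qed.

Lemma orbit_rel_trans k (x y z : osimplex X k) :
  orbit_rel x y -> orbit_rel y z -> orbit_rel x z.
Proof. by move=> [g ->] [h ->]; exists (h * g)%g; rewrite osimplex_actM. Qed.

Definition orbit_rep k : osimplex X k -> osimplex X k :=
  class_rep (@orbit_rel_refl k).

Lemma orbit_repP k (x : osimplex X k) : exists g, orbit_rep x = g ** x.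
Proof. exact: (class_repP (@orbit_rel_refl k) x). Qed.

Lemma orbit_rep_act k g (x : osimplex X k) : orbit_rep (g ** x) = orbit_rep x.
Proof.
apply: (class_rep_eq _ (@orbit_rel_sym k) (@orbit_rel_trans k)).
by exists g^-1%g; rewrite osimplex_actK.
Qed.

Lemma orbit_rep_rel k (x y : osimplex X k) :
  orbit_rep x = orbit_rep y -> exists g, y = g ** x.
Proof. exact: class_rep_rel (@orbit_rel_sym k) (@orbit_rel_trans k) _ _. Qed.

Lemma orbit_repK k (x : osimplex X k) : orbit_rep (orbit_rep x) = orbit_rep x.
Proof. exact: class_repK (@orbit_rel_sym k) (@orbit_rel_trans k) x. Qed.

Hypothesis hcoc : cocompact a.

(** Cocompactness counts orbits of unordered simplices; one simplex is chosen in each, and it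
    carries finitely many ordered k-simplices. *)
Lemma orbit_cover k : exists2 Y : set (osimplex X k), finite_set Y &
  forall x, exists g, Y (g ** x).
Proof.
pose S0 := (xget fset0) @` [set simplex_orbit a s | s in [set s | X s]].
exists (\bigcup_(s in S0) [set x : osimplex X k | (support x `<=` s)%fset]).
  apply: bigcup_finite; first by apply: finite_image.
  by move=> s _; exact: finite_orderings.
move=> x; pose O := simplex_orbit a (support x).
have Ox : O (support x) by exists 1%g => //; rewrite -support_act osimplex_act1.
have [g _ gO] := xgetI fset0 Ox.
exists g; exists (xget fset0 O).
  by exists O => //; exists (support x) => //; exact: supportP.
by rewrite /= support_act gO fsubset_refl.
Qed.

Lemma finite_orbit_rep k : finite_set (range (@orbit_rep k)).
Proof.
have [Y fY hY] := orbit_cover k.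
apply: sub_finite_set (finite_image (@orbit_rep k) fY) => _ [x _ <-].
by have [g gx] := hY x; exists (g ** x) => //; rewrite orbit_rep_act.
Qed.

Definition reps k : {fset osimplex X k} := fset_set (range (@orbit_rep k)).

Lemma mem_reps k (x : osimplex X k) : (x \in reps k) = (orbit_rep x == x).
Proof.
rewrite in_fset_set; last exact: finite_orbit_rep.
apply/idP/eqP => [|<-]; first by rewrite inE => -[y _ <-]; exact: orbit_repK.
by rewrite inE; exists x.
Qed.

Lemma orbit_rep_mem k (x : osimplex X k) : orbit_rep x \in reps k.
Proof. by rewrite mem_reps orbit_repK. Qed.

End OsimplexAction.

Section Haar.
Context (R : realType) {V : choiceType} {X : simplicialComplex V}.
Context {G : topGroupType} (a : simplicialAction G X) (r : nat).
Hypothesis hsep : hausdorff_space G.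
Hypothesis hstab : forall t : {fset V}, X t -> has_dim r t ->
  compact (pointwise_stabilizer a t).
Hypothesis hctb : forall k, countable [set: osimplex X k].
Variable mu : {measure set (borel_group G) -> \bar R}.
Hypothesis hmu : left_haar mu.
Hypothesis hmu_r : right_invariant mu.
Implicit Types (k : nat) (g h : G).

Local Notation "g ** x" := (osimplex_act a g x) (at level 40).
Local Notation stab := (ostab a).

(** The r-dimensional faces of [s] cover its vertices, so the stabilizer is the intersection of
    theirs, a closed subset of a compact one. *)
Lemma pointwise_stabilizer_compact (s : {fset V}) : X s -> (r < #|` s|)%N ->
  compact (pointwise_stabilizer a s).
Proof.
move=> Xs rs.
have sub v : v \in s -> exists t : {fset V},
    [/\ v \in t, (t `<=` s)%fset & has_dim r t].
  move=> vs; pose t0 := [fset x in take r (s `\ v)%fset]%fset.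
  have t0s : (t0 `<=` s `\ v)%fset.
    by apply/fsubsetP => x; rewrite /t0 in_fset /= => /mem_take.
  exists (v |` t0)%fset; split; first by rewrite !inE eqxx.
    by rewrite fsubUset fsub1set vs (fsubset_trans t0s) ?fsubsetDl.
  have vt0 : v \notin t0 by apply: contraTN vs => /(fsubsetP t0s); rewrite !inE eqxx.
  rewrite /has_dim cardfsU1 vt0 add1n card_fseq undup_id ?take_uniq ?fset_uniq //.
  rewrite size_take_min; congr _.+1; apply/minn_idPl.
  by have := cardfsD1 v s; rewrite vs; move: rs => /[swap] ->; rewrite add1n ltnS.
have subX t : (t `<=` s)%fset -> has_dim r t -> X t.
  by move=> ts dt; apply: simplex_face Xs ts _; rewrite -cardfs_gt0 dt.
pose T := [set t : {fset V} | (t `<=` s)%fset /\ has_dim r t].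
have -> : pointwise_stabilizer a s =
    \bigcap_(t in T) pointwise_stabilizer a t.
  apply/seteqP; split=> g gs.
    by move=> t [ts _] v vt; apply: gs; exact: (fsubsetP ts).
  by move=> v /sub[t [vt ts dt]]; exact: (gs t).
have [v vs] : exists v, v \in s by apply/fset0Pn; exact: simplex_neq0 Xs.
have [t [vt ts dt]] := sub v vs.
apply: (@subclosed_compact _ _ (pointwise_stabilizer a t)).
- apply: closed_bigI => u [us du]; apply: compact_closed => //.
  by apply: hstab => //; exact: subX.
- by apply: hstab => //; exact: subX.
- by move=> g; apply.
Qed.

Lemma stab_compact k (x : osimplex X k) : (r <= k)%N -> compact (stab x).
Proof.
move=> rk; rewrite ostabE; apply: pointwise_stabilizer_compact; first exact: supportP.
by rewrite has_dim_support ltnS.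
Qed.

Lemma closed_borel (A : set G) : closed A -> measurable (A : set (borel_group G)).
Proof.
move=> cA; rewrite -[A]setCK; apply: measurableC; apply: sub_sigma_algebra.
exact: closed_openC.
Qed.

Lemma mulg_left_continuous g : continuous (fun h : G => (g * h)%g).
Proof.
move=> h; apply: (@continuous_comp _ _ _ (fun h : G => (g, h)) (fun p : G * G => (p.1 * p.2)%g)).
  exact: (@cvg_pair _ _ _ (nbhs h) (nbhs g) (nbhs h) _ _ _ (fun=> g) id (cvg_cst _) cvg_id).
exact: mulg_continuous.
Qed.

Definition transporter k (x y : osimplex X k) : set (borel_group G) :=
  [set g | g ** x = y].

Lemma transporterE k g (x : osimplex X k) :
  transporter x (g ** x) = [set (g * h)%g | h in stab x].
Proof.
apply/seteqP; split=> [h /= hx|_ [h /= hx <-]].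
  exists (g^-1 * h)%g; last by rewrite mulKVg.
  by rewrite /ostab /= osimplex_actM hx osimplex_actK.
by rewrite /transporter /= osimplex_actM hx.
Qed.

Lemma transporter_measurable k (x y : osimplex X k) : (r <= k)%N ->
  measurable (transporter x y).
Proof.
move=> rk; have [[g gx]|h] := pselect (exists g, g ** x = y); last first.
  rewrite (_ : transporter x y = set0) // -subset0 => g gx.
  by apply: h; exists g.
rewrite -gx; apply: closed_borel.
rewrite (_ : transporter x _ = (fun h : G => (g^-1 * h)%g) @^-1` stab x).
  apply: preimage_closed; first by move=> h _; exact: mulg_left_continuous.
  by apply: compact_closed => //; exact: stab_compact.
rewrite transporterE; apply/seteqP; split=> [_ [h hx <-]|h hx].
  by rewrite /= mulKg.
by exists (g^-1 * h)%g => //; rewrite mulKVg.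
Qed.

Lemma stab_measurable k (x : osimplex X k) : (r <= k)%N ->
  measurable (stab x : set (borel_group G)).
Proof. exact: transporter_measurable. Qed.

Lemma transporter_measure k g (x : osimplex X k) : (r <= k)%N ->
  mu (transporter x (g ** x)) = mu (stab x).
Proof.
move=> rk; rewrite transporterE; apply: (haar_left hmu).
exact: stab_measurable.
Qed.

(** The group is the union of the countably many transporters of [x], which are empty or left cosets
    of [stab x]; if that were null, so would be the group. *)
Lemma stab_measure_neq0 k (x : osimplex X k) : (r <= k)%N -> mu (stab x) != 0%E.
Proof.
move=> rk; apply/negP => /eqP mu0; have /negP := haar_neq0 hmu; apply.
have null y : mu.-negligible (transporter x y).
  exists (transporter x y); split=> //; first exact: transporter_measurable.
  have [[g <-]|h] := pselect (exists g, g ** x = y).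
    by rewrite transporter_measure.
  rewrite (_ : transporter x y = set0) ?measure0 // -subset0 => g gx.
  by apply: h; exists g.
have /countable_injP[f fI] := hctb k.
have cover : [set: borel_group G] =
    \bigcup_m [set g : borel_group G | f (g ** x) = m].
  by apply/esym; rewrite -subTset => g _; exists (f (g ** x)).
have : mu.-negligible [set: borel_group G].
  rewrite cover; apply: negligible_bigcup => m.
  have [[g gm]|h] := pselect (exists g, f (g ** x) = m).
    apply: negligibleS (null (g ** x)) => h /= hm.
    by apply: fI; rewrite ?inE // hm gm.
  rewrite (_ : mkset _ = set0); first exact: negligible_set0.
  by rewrite -subset0 => g gm; apply: h; exists g.
by move/negligibleP => -> //; exact: eqxx.
Qed.

Definition weight k (x : osimplex X k) : R := (fine (mu (stab x)))^-1.

Lemma stab_measure_fin k (x : osimplex X k) : (r <= k)%N ->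
  mu (stab x) \is a fin_num.
Proof.
move=> rk; rewrite ge0_fin_numE; last exact: measure_ge0.
by apply: (haar_compact hmu); exact: stab_compact.
Qed.

Lemma weight_gt0 k (x : osimplex X k) : (r <= k)%N -> 0 < weight x.
Proof.
move=> rk; rewrite /weight invr_gt0 fine_gt0 //.
rewrite lt0e stab_measure_neq0 // measure_ge0 /=.
by apply: (haar_compact hmu); exact: stab_compact.
Qed.

(** The stabilizer of [g ** x] is the left coset g stab(x) translated on the right by g^-1, so both
    invariances of the Haar measure are used. *)
Lemma weight_act k g (x : osimplex X k) : (r <= k)%N ->
  weight (g ** x) = weight x.
Proof.
move=> rk; rewrite /weight; congr ((fine _)^-1).
have -> : stab (g ** x) = [set (h * g^-1)%g | h in transporter x (g ** x)].
  apply/seteqP; split=> [h hx|_ [h hx <-]].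
    by exists (h * g)%g; rewrite ?mulgK // /transporter /= osimplex_actM.
  by rewrite /ostab /= osimplex_actM osimplex_actK.
rewrite hmu_r; first exact: transporter_measure.
exact: transporter_measurable.
Qed.

Lemma weight_perm k (x : osimplex X k) s : weight (osimplex_perm x s) = weight x.
Proof.
rewrite /weight; congr (fine (mu _))^-1; apply/seteqP; split=> g /=.
  rewrite /ostab /= osimplex_act_perm => gx.
  by rewrite -(osimplex_perm1 (g ** x)) -(mulVg s) osimplex_permM gx
             -osimplex_permM mulVg osimplex_perm1.
by rewrite /ostab /= osimplex_act_perm => ->.
Qed.

(** The transporters from [z] to the points of its orbit under [stab t] partition [stab t] into
    cosets of [stab z], all of measure [mu (stab z)]. *)
Lemma orbit_stabilizer k l (t : osimplex X k) (z : osimplex X l)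
    (Y : {fset osimplex X l}) : (r <= k)%N -> (r <= l)%N ->
  stab z `<=` stab t ->
  (forall y, y \in Y <-> exists2 g, stab t g & y = g ** z) ->
  weight t * #|` Y|%:R = weight z.
Proof.
move=> rk rl zt YE.
have E : stab t = \bigcup_(y in [set` Y]) transporter z y.
  apply/seteqP; split=> [g gt|g [y /= /YE[h ht ->]]].
    by exists (g ** z) => //=; apply/YE; exists g.
  rewrite transporterE => -[h' h'z <-].
  by rewrite /ostab /= osimplex_actM (zt _ h'z).
have : mu (stab t) = (#|` Y|%:R%:E * mu (stab z))%E.
  rewrite E measure_fin_bigcup //=; last first.
  - by move=> y _; exact: transporter_measurable.
  - by move=> y y' _ _ [g [/= <- <-]].
  rewrite fsbig_finite //= set_fsetK.
  rewrite (eq_big_seq (fun=> mu (stab z))).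
    rewrite -(fineK (stab_measure_fin z rl)) sumEFin big_const_seq count_predT.
    by rewrite iter_addr_0 -[in LHS]mulr_natl EFinM.
  by move=> y /YE[g _ ->]; rewrite transporter_measure.
rewrite /weight => ->; rewrite -(fineK (stab_measure_fin z rl)) -EFinM /=.
have z0 : fine (mu (stab z)) != 0.
  by have := weight_gt0 z rl; rewrite /weight invr_gt0 lt_def => /andP[].
have Y0 : #|` Y|%:R != 0 :> R.
  rewrite pnatr_eq0 -lt0n cardfs_gt0; apply/fset0Pn; exists z.
  by apply/YE; exists 1%g; rewrite /ostab /= osimplex_act1.
by rewrite invfM mulrAC mulVf ?mul1r.
Qed.

End Haar.

(** * The tower of equivariant functions *)

Section HilbertReal.
Context (R : realType) (H : hilbertSpace R).
Implicit Types (x y z : H).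

Definition rdot_fun x y : R := complex.Re (hdot H x y).

Lemma rdotC x y : rdot_fun x y = rdot_fun y x.
Proof.
rewrite /rdot_fun (hermC (hdot H) x y) /= expr0 mul1r.
by case: (hdot H y x).
Qed.

Lemma rdotDl x y z : rdot_fun (x + y) z = rdot_fun x z + rdot_fun y z.
Proof. by rewrite /rdot_fun linearDl raddfD. Qed.

Lemma rdotZl (r : R) x y : rdot_fun (r%:C%C *: x) y = r * rdot_fun x y.
Proof.
rewrite /rdot_fun linearZl_LR /=; case: (hdot H x y) => u v /=.
by rewrite mul0r subr0.
Qed.

Lemma hnormE x : `|x| = ((complex.Re `|x|)%:C)%C.
Proof.
have := normr_ge0 x; rewrite lecE /= => /andP[/eqP].
by case: `|x| => u v /= ->.
Qed.

Lemma rdot_normE x : rdot_fun x x = complex.Re `|x| ^+ 2.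
Proof. by rewrite /rdot_fun hdot_norm hnormE -rmorphXn. Qed.

Lemma rdot_ge0 x : 0 <= rdot_fun x x.
Proof. by rewrite rdot_normE sqr_ge0. Qed.

Definition rdot : semidot H := Semidot rdotC rdotDl rdotZl rdot_ge0.

Lemma snorm_rdot x : snorm rdot x = complex.Re `|x|.
Proof.
rewrite /snorm /sdot /= rdot_normE sqrtr_sqr ger0_norm //.
by have := normr_ge0 x; rewrite lecE => /andP[].
Qed.

Lemma norm_rdot x : `|x| = ((snorm rdot x)%:C)%C.
Proof. by rewrite snorm_rdot -hnormE. Qed.

Lemma rdot_eq0 x : rdot x x = 0 -> x = 0.
Proof.
move/eqP; rewrite -snorm_eq0 => /eqP x0; apply/eqP.
by rewrite -normr_eq0 norm_rdot x0.
Qed.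

Lemma rdot_complete : scomplete rdot setT.
Proof.
move=> u _ cu.
have posC (e : R[i]) : 0 < e -> exists2 d : R, 0 < d & e = (d%:C)%C.
  by case: e => x y; rewrite ltcE /= => /andP[/eqP -> x0]; exists x.
have : cauchy (u @ \oo).
  apply: cauchy_exP => _ /posC[d d0 ->].
  have d20 : 0 < d / 2 by rewrite divr_gt0.
  have [N hN] := cu _ d20.
  exists (u N); exists N => // m /= Nm.
  rewrite -ball_normE /= norm_rdot ltcR; apply: le_lt_trans (hN _ _ _ _) _ => //.
  by rewrite ltr_pdivrMr // ltr_pMr // ltr1n.
move=> /cauchy_cvg/cvg_ex[l ul]; exists l => // e e0.
have eC : 0 < (e%:C)%C :> R[i] by rewrite ltcR.
have /cvgrPdist_le/(_ _ eC)[N _ hN] := ul.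
by exists N => m Nm; have := hN m Nm; rewrite norm_rdot lecR snorm_distC.
Qed.

End HilbertReal.

Section RepresentationReal.
Context (R : realType) (G : topGroupType) (H : hilbertSpace R) (rho : unitaryRep G H).

Lemma rdot_rep g (x y : H) : rdot H (rho g x) (rho g y) = rdot H x y.
Proof. by rewrite /sdot /= /rdot_fun rep_dot. Qed.

Lemma snorm_rep g (x : H) : snorm (rdot H) (rho g x) = snorm (rdot H) x.
Proof. by rewrite /snorm rdot_rep. Qed.

Lemma repK g (x : H) : rho g^-1%g (rho g x) = x.
Proof. by rewrite -repM mulVg rep1. Qed.

Lemma repKV g (x : H) : rho g (rho g^-1%g x) = x.
Proof. by rewrite -repM mulgV rep1. Qed.

End RepresentationReal.

Section Prefixes.
Context {V : choiceType} (X : simplicialComplex V) (n : nat).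
Implicit Types (x y z : osimplex X n) (l i : nat).

(** Functions of the first [l] vertices are the functions on ordered n-simplices that are constant
    on the classes of this relation, so that all levels share one domain. *)
Definition agree l x y := forall a : 'I_n.+1, (a < l)%N -> x a = y a.

Lemma agree_sym l x y : agree l x y -> agree l y x.
Proof. by move=> xy a al; rewrite xy. Qed.

Lemma agree_trans l x y z : agree l x y -> agree l y z -> agree l x z.
Proof. by move=> xy yz a al; rewrite xy // yz. Qed.

Lemma agree_le l l' x y : (l' <= l)%N -> agree l x y -> agree l' x y.
Proof. by move=> ll xy a al; apply: xy; exact: leq_trans ll. Qed.

Lemma agree_act (G : topGroupType) (a : simplicialAction G X) g l x y :
  agree l x y -> agree l (osimplex_act a g x) (osimplex_act a g y).
Proof. by move=> xy i il /=; rewrite xy. Qed.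

Definition prefix_seq l x : seq V := [seq x (inord i) | i <- iota 0 l].

Lemma size_prefix_seq l x : size (prefix_seq l x) = l.
Proof. by rewrite size_map size_iota. Qed.

Lemma nth_prefix_seq l x v i : (i < l)%N -> nth v (prefix_seq l x) i = x (inord i).
Proof. by move=> il; rewrite (nth_map 0%N) ?size_iota // nth_iota. Qed.

Lemma mem_prefix_seq l x (a : 'I_n.+1) : (a < l)%N -> x a \in prefix_seq l x.
Proof.
move=> al; apply/mapP; exists (val a); first by rewrite mem_iota.
by rewrite inord_val.
Qed.

Lemma prefix_seq_uniq l x : (l <= n.+1)%N -> uniq (prefix_seq l x).
Proof.
move=> ln; rewrite map_inj_in_uniq ?iota_uniq // => i j.
rewrite !mem_iota !add0n => /andP[_ il] /andP[_ jl] /overt_inj/(congr1 val) /=.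
by rewrite !inordK ?(leq_trans il) ?(leq_trans jl).
Qed.

Lemma eq_prefix_seq l x y : (l <= n.+1)%N ->
  prefix_seq l x = prefix_seq l y <-> agree l x y.
Proof.
move=> ln; split=> [e a al|xy].
  have := nth_prefix_seq x (x a) al; rewrite e nth_prefix_seq // inord_val.
  by move=> ->.
apply/eq_in_map => i; rewrite mem_iota add0n => /andP[_ il].
by apply: xy; rewrite inordK // (leq_trans il).
Qed.

Definition prefix l x : {fset V} := [fset v in prefix_seq l x]%fset.

Lemma card_prefix l x : (l <= n.+1)%N -> #|` prefix l x| = l.
Proof.
by move=> ln; rewrite card_fseq undup_id ?prefix_seq_uniq // size_prefix_seq.
Qed.

Lemma prefix_sub l x : (prefix l x `<=` support x)%fset.
Proof.
apply/fsubsetP => v; rewrite /prefix in_fset /= => /mapP[i _ ->].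
exact: mem_support.
Qed.

Lemma prefix_simplex l x : (l <= n.+1)%N -> prefix l x = fset0 \/ X (prefix l x).
Proof.
move=> ln; case: (eqVneq (prefix l x) fset0) => [->|h]; [by left|right].
exact: simplex_face (supportP x) (prefix_sub l x) h.
Qed.

Lemma osimplex_extend (hpure : pure X n) l x (p : seq V) : (l <= n.+1)%N ->
  uniq (prefix_seq l x ++ p) -> prefix_seq l x ++ p != [::] ->
  X [fset v in prefix_seq l x ++ p]%fset ->
  exists2 z, agree l z x & forall j v, (j < size p)%N -> z (inord (l + j)) = nth v p j.
Proof.
move=> ln up p0 /hpure[s [Xs ds ps]].
have sub : {subset prefix_seq l x ++ p <= s}.
  by move=> v vp; apply: (fsubsetP ps); rewrite in_fset.
have [z [_ hz]] := osimplex_of_seq Xs ds up sub.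
have szn : (size (prefix_seq l x ++ p) <= n.+1)%N.
  have := fsubset_leq_card ps; rewrite ds card_fseq undup_id //.
exists z => [a al|j v jp].
  rewrite (hz a _ (x a)) ?size_cat ?size_prefix_seq ?ltn_addr //.
  by rewrite nth_cat size_prefix_seq al nth_prefix_seq // inord_val.
have lj : (l + j < n.+1)%N.
  by apply: leq_trans szn; rewrite size_cat size_prefix_seq ltn_add2l.
have e : (inord (l + j) : 'I_n.+1) = (l + j)%N :> nat by rewrite inordK.
rewrite (hz (inord (l + j)) _ v) e ?size_cat ?size_prefix_seq ?ltn_add2l //.
by rewrite nth_cat size_prefix_seq ltnNge leq_addr /= addKn.
Qed.

Definition adj_tperm i : 'S_n.+1 := tperm (inord i) (inord i.+1).

Lemma adj_tperm_lt i l (a : 'I_n.+1) : (i < n)%N -> (i.+2 <= l)%N -> (a < l)%N ->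
  (adj_tperm i a < l)%N.
Proof.
move=> ni il al; rewrite /adj_tperm.
by case: tpermP => // _; rewrite inordK; lia.
Qed.

Lemma adj_tperm_id i (a : 'I_n.+1) : (i < n)%N -> (a < i)%N -> adj_tperm i a = a.
Proof.
move=> ni ai; by apply: tpermD; rewrite -val_eqE /= inordK; lia.
Qed.

Lemma adj_tperm_braid i : (i.+1 < n)%N ->
  (adj_tperm i * (adj_tperm i.+1 * adj_tperm i) =
   adj_tperm i.+1 * (adj_tperm i * adj_tperm i.+1))%g.
Proof.
move=> ni; rewrite /adj_tperm.
set a := inord i; set b := inord i.+1; set c := inord i.+2.
have ac : a != c by rewrite -val_eqE /= !inordK //; lia.
have ab : a != b by rewrite -val_eqE /= !inordK //; lia.
have bc : b != c by rewrite -val_eqE /= !inordK //; lia.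
have conj (s t : 'S_n.+1) : (s * s = 1)%g -> (s * (t * s) = t ^ s)%g.
  by move=> ss; rewrite conjgE; congr (_ * _)%g; rewrite -[RHS]mulg1 -ss mulKg.
rewrite !conj ?tperm2 // !tpermJ tpermR tpermL.
by rewrite !tpermD // eq_sym.
Qed.

End Prefixes.

Section Truncation.
Context {V : choiceType} (X : simplicialComplex V) (n c : nat).
Hypothesis hpure : pure X n.
Hypothesis cn : (c <= n)%N.
Let cn' : (c.+1 <= n.+1)%N := cn.
Local Notation S := (osimplex X n).
Implicit Types (x y : S).

Lemma trunc_ex (x : S) : exists t : osimplex X c,
  forall i, t i = x (widen_ord cn' i).
Proof.
have fI : injective (fun i : 'I_c.+1 => x (widen_ord cn' i)).
  by move=> i j /overt_inj/(congr1 val) /= ij; exact: val_inj.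
have fX : X [fset x (widen_ord cn' i) | i in 'I_c.+1]%fset.
  apply: simplex_face (supportP x) _ _.
    by apply/fsubsetP => v /imfsetP[i _ ->]; exact: mem_support.
  apply/fset0Pn; exists (x (widen_ord cn' ord0)).
  by apply/imfsetP; exists ord0.
by exists (OSimplex fI fX).
Qed.

Definition trunc (x : S) : osimplex X c := sval (cid (trunc_ex x)).

Lemma truncE x i : trunc x i = x (widen_ord cn' i).
Proof. by rewrite /trunc; case: cid. Qed.

Lemma trunc_eq x y : trunc x = trunc y <-> agree c.+1 x y.
Proof.
split=> [xy b bc|xy]; last first.
  by apply: osimplex_inj => i; rewrite !truncE; apply: xy; exact: (ltn_ord i).
have := congr1 (fun t : osimplex X c => t (Ordinal bc)) xy; rewrite !truncE.
by have -> : widen_ord cn' (Ordinal bc) = b by exact: val_inj.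
Qed.

Lemma trunc_act (G : topGroupType) (a : simplicialAction G X) g x :
  trunc (osimplex_act a g x) = osimplex_act a g (trunc x).
Proof. by apply: osimplex_inj => i; rewrite truncE /= truncE. Qed.

Lemma trunc_surj (t : osimplex X c) : exists x, trunc x = t.
Proof.
have [s [Xs ds ts]] := hpure (supportP t).
have [|v|x [_ hx]] := @osimplex_of_seq _ X n s [seq t i | i <- enum 'I_c.+1] Xs ds.
- by rewrite map_inj_uniq ?enum_uniq //; exact: overt_inj.
- by move=> /mapP[i _ ->]; apply: (fsubsetP ts); exact: mem_support.
exists x; apply: osimplex_inj => i; rewrite truncE (hx _ _ (t i)).
  by rewrite (nth_map i) ?size_enum_ord //= nth_ord_enum.
by rewrite size_map size_enum_ord /=.
Qed.

End Truncation.

Section EquivariantTower.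
Context (R : realType) {V : choiceType} (X : simplicialComplex V) (n : nat).
Context (G : topGroupType) (a : simplicialAction G X) (wt : osimplex X n -> R).
Hypothesis hcoc : cocompact a.
Hypothesis wt_gt0 : forall x, 0 < wt x.
Hypothesis wt_act : forall g x, wt (osimplex_act a g x) = wt x.
Hypothesis wt_perm : forall x s, wt (osimplex_perm x s) = wt x.
Context (H : hilbertSpace R) (rho : unitaryRep G H).

Local Notation S := (osimplex X n).
Local Notation "g ** x" := (osimplex_act a g x) (at level 40).
Implicit Types (x y z : S) (f : S -> H) (g : G) (l i : nat).

(* The orbits are weighted by [1 / mu (G_x)] in the application. *)
Definition orbit_sum (F : S -> R) : R := \sum_(x <- reps a n) wt x * F x.

Lemma orbit_sum_perm F s : (forall g x, F (g ** x) = F x) ->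
  orbit_sum (fun x => F (osimplex_perm x s)) = orbit_sum F.
Proof.
move=> FG; pose p t x : S := orbit_rep a (osimplex_perm x t).
have pK t : {in reps a n, cancel (p t) (p t^-1%g)}.
  move=> x; rewrite (mem_reps hcoc) => /eqP xr.
  have [g gE] := orbit_repP a (osimplex_perm x t).
  rewrite /p gE osimplex_act_perm -osimplex_permM mulVg osimplex_perm1.
  by rewrite orbit_rep_act xr.
have pR t x : p t x \in reps a n by exact: orbit_rep_mem.
rewrite /orbit_sum [RHS](perm_big [seq p s x | x <- reps a n]) /=; last first.
  apply: uniq_perm; first exact: fset_uniq.
    rewrite map_inj_in_uniq ?fset_uniq // => x y xr yr pxy.
    by rewrite -(pK s x xr) pxy pK.
  move=> x; apply/idP/mapP => [xr|[y _ ->]]; last exact: pR.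
  by exists (p s^-1%g x) => //; rewrite -{1}(invgK s) pK.
rewrite big_map; apply: eq_bigr => x _.
have [g gE] := orbit_repP a (osimplex_perm x s).
by rewrite /p gE wt_act FG wt_perm.
Qed.

(* Symmetrized over the orderings, so that permuting the vertices is an isometry
   on all functions and not only on the equivariant ones. *)
Definition perm_sum (F : S -> R) : R :=
  \sum_(s : 'S_n.+1) orbit_sum (fun x => F (osimplex_perm x s)).

Lemma perm_sum_perm F s : perm_sum (fun x => F (osimplex_perm x s)) = perm_sum F.
Proof.
rewrite /perm_sum [RHS](reindex_inj (mulgI s)).
apply: eq_bigr => t _; apply: eq_bigr => x _.
by rewrite osimplex_permM.
Qed.

Lemma perm_sum_invariant F : (forall g x, F (g ** x) = F x) ->
  perm_sum F = #|{: 'S_n.+1}|%:R * orbit_sum F.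
Proof.
move=> FG; rewrite /perm_sum (eq_bigr (fun=> orbit_sum F)).
  by rewrite sumr_const mulr_natl.
by move=> s _; exact: orbit_sum_perm.
Qed.

Lemma perm_sumD F1 F2 :
  perm_sum (fun x => F1 x + F2 x) = perm_sum F1 + perm_sum F2.
Proof.
rewrite -big_split; apply: eq_bigr => s _.
by rewrite -big_split; apply: eq_bigr => x _; rewrite mulrDr.
Qed.

Lemma perm_sumZ (c : R) F : perm_sum (fun x => c * F x) = c * perm_sum F.
Proof.
rewrite /perm_sum mulr_sumr; apply: eq_bigr => s _.
by rewrite /orbit_sum mulr_sumr; apply: eq_bigr => x _; rewrite mulrCA.
Qed.

Lemma perm_sum_ge0 F : (forall x, 0 <= F x) -> 0 <= perm_sum F.
Proof.
move=> F0; apply: sumr_ge0 => s _; apply: sumr_ge0 => x _.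
by rewrite mulr_ge0 // ltW.
Qed.

Lemma perm_sum_ge x F : (forall y, 0 <= F y) -> (forall g y, F (g ** y) = F y) ->
  wt x * F x <= perm_sum F.
Proof.
move=> F0 FG; have [g gE] := orbit_repP a x.
rewrite -(wt_act g x) -(FG g x) -gE /perm_sum (bigD1 1%g) //=.
rewrite /orbit_sum (big_rem _ (orbit_rep_mem hcoc x)) /= osimplex_perm1.
rewrite -addrA lerDl addr_ge0 //.
  by apply: sumr_ge0 => y _; rewrite mulr_ge0 // ltW.
by apply: sumr_ge0 => s _; apply: sumr_ge0 => y _; rewrite mulr_ge0 // ltW.
Qed.

Definition edot_fun f f' := perm_sum (fun x => rdot H (f x) (f' x)).

Lemma edotC f f' : edot_fun f f' = edot_fun f' f.
Proof. by apply: eq_bigr => s _; apply: eq_bigr => x _; rewrite sdotC. Qed.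

Lemma edotDl f1 f2 f : edot_fun (f1 + f2) f = edot_fun f1 f + edot_fun f2 f.
Proof.
rewrite -perm_sumD; apply: eq_bigr => s _; apply: eq_bigr => x _.
by rewrite sdotDl.
Qed.

Lemma edotZl (c : R) f f' : edot_fun (c%:C%C *: f) f' = c * edot_fun f f'.
Proof.
rewrite -perm_sumZ; apply: eq_bigr => s _; apply: eq_bigr => x _.
by rewrite sdotZl.
Qed.

Lemma edot_ge0 f : 0 <= edot_fun f f.
Proof. by apply: perm_sum_ge0 => x; exact: sdot_ge0. Qed.

Definition edot : semidot (S -> H) := Semidot edotC edotDl edotZl edot_ge0.

Definition equivariant f := forall g x, f (g ** x) = rho g (f x).

Definition prefix_space l : set (S -> H) :=
  [set f | equivariant f /\ forall x y, agree l x y -> f x = f y].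

(** By equivariance |f x| can be read at the representative of the orbit, where it is one term of
    the sum. So evaluation is continuous, which yields definiteness, completeness and later the
    pointwise estimate for property (T). *)
Lemma edot_ge x f : equivariant f -> wt x * rdot H (f x) (f x) <= edot f f.
Proof.
move=> ef; apply: (@perm_sum_ge x (fun x => rdot H (f x) (f x))).
  by move=> y; exact: sdot_ge0.
by move=> g y; rewrite ef rdot_rep.
Qed.

Lemma prefix_space_subspace l : subspace (prefix_space l).
Proof.
split.
- by split=> // g x; rewrite linear0.
- move=> f f' [ef df] [ef' df']; split=> [g x|x y xy].
    change (f (g ** x) + f' (g ** x) = rho g (f x + f' x)).
    by rewrite ef ef' linearD.
  change (f x + f' x = f y + f' y).
  by rewrite (df x y) // (df' x y).
- move=> c f [ef df]; split=> [g x|x y xy].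
    change (c%:C%C *: f (g ** x) = rho g (c%:C%C *: f x)).
    by rewrite ef linearZ.
  change (c%:C%C *: f x = c%:C%C *: f y).
  by rewrite (df x y).
Qed.

Lemma edot_def f : equivariant f -> edot f f = 0 -> f = 0.
Proof.
move=> ef f0; apply/funext => x; apply: rdot_eq0; apply/eqP.
rewrite eq_le sdot_ge0 andbT -(pmulr_rle0 _ (wt_gt0 x)) -f0.
exact: edot_ge.
Qed.

Lemma prefix_space_complete l : scomplete edot (prefix_space l).
Proof.
move=> u Uu cu.
have sU := prefix_space_subspace l.
have cx x : scauchy (rdot H) (fun m => u m x).
  move=> e e0; have se : 0 < Num.sqrt (wt x) by rewrite sqrtr_gt0.
  have [N hN] := cu (Num.sqrt (wt x) * e) (mulr_gt0 se e0).
  exists N => m m' Nm Nm'; rewrite -(ler_pM2l se).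
  apply: le_trans (hN m m' Nm Nm'); rewrite /snorm -sqrtrM; last exact: ltW.
  by apply: ler_wsqrtr; apply: (@edot_ge x (u m - u m')); have [] := subspaceB sU (Uu m) (Uu m').
have /choice[f fP] : forall x, exists v : H, sconv (rdot H) (fun m => u m x) v.
  by move=> x; have [y _ hy] := @rdot_complete R H _ (fun=> I) (cx x); exists y.
have lim0 (y : H) : (forall e : R, 0 < e -> snorm (rdot H) y <= e * 2) -> y = 0.
  move=> h; apply: rdot_eq0; apply/eqP; rewrite -snorm_eq0 eq_le snorm_ge0 andbT.
  by apply: (@small_seq_le _ _ _ 2) => e e0 _; rewrite add0r; exact: h.
exists f.
  split=> [g x|x y xy]; apply/eqP; rewrite -subr_eq0; apply/eqP/lim0 => e e0.
    have [N1 h1] := fP (g ** x) e e0; have [N2 h2] := fP x e e0.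
    pose m := maxn N1 N2.
    have -> : f (g ** x) - rho g (f x) =
        (f (g ** x) - u m (g ** x)) + rho g (u m x - f x).
      by rewrite linearB -(Uu m).1 addrA subrK.
    apply: le_trans (ler_snormD _ _ _) _; rewrite snorm_rep snorm_distC.
    rewrite mulr_natr mulr2n; apply: lerD; [apply: h1|apply: h2].
      exact: leq_maxl.
    exact: leq_maxr.
  have [N1 h1] := fP x e e0; have [N2 h2] := fP y e e0.
  pose m := maxn N1 N2; have := h1 m (leq_maxl _ _); have := h2 m (leq_maxr _ _).
  rewrite -((Uu m).2 x y xy) => h3 h4.
  have := ler_snorm_dist (rdot H) (f x) (u m x) (f y).
  by rewrite (snorm_distC _ (f x) (u m x)); lra.
move=> e e0; pose W := perm_sum (fun=> 1).
have W0 : 0 <= W by apply: perm_sum_ge0.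
pose d := e / Num.sqrt (W + 1).
have W1 : 0 < W + 1 by rewrite ltr_wpDl.
have d0 : 0 < d by rewrite divr_gt0 ?sqrtr_gt0.
(* The form sees functions only at these finitely many points, so pointwise convergence implies
   convergence in norm. *)
pose pts := [seq osimplex_perm x s | s <- enum [set: 'S_n.+1], x <- reps a n].
have [N hN] : exists N, forall m, (N <= m)%N -> forall x, x \in pts ->
    snorm (rdot H) (u m x - f x) <= d.
  elim: pts => [|x s [N1 h1]]; first by exists 0%N.
  have [N2 h2] := fP x d d0; exists (maxn N1 N2) => m.
  rewrite geq_max => /andP[m1 m2] y; rewrite inE => /orP[/eqP ->|ys]; first exact: h2.
  exact: h1.
exists N => m Nm; rewrite -(@ler_pXn2r _ 2) ?nnegrE ?snorm_ge0 ?(ltW e0) //.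
rewrite sqr_snorm; apply: (@le_trans _ _ (d ^+ 2 * W)).
  rewrite -perm_sumZ; apply: ler_sum => s _.
  rewrite /orbit_sum big_seq [leRHS]big_seq; apply: ler_sum => x xr.
  rewrite ler_pM2l // mulr1 -sqr_snorm ler_pXn2r ?nnegrE ?snorm_ge0 ?(ltW d0) //.
  by apply: hN => //; apply: allpairs_f => //; rewrite mem_enum inE.
rewrite /d expr_div_n sqr_sqrtr ?(ltW W1) // mulrAC -mulrA ler_piMr ?sqr_ge0 //.
by rewrite ler_pdivrMr // mul1r lerDl.
Qed.

Definition swap i f : S -> H := fun x => f (osimplex_perm x (adj_tperm n i)).

Lemma swap_space i l f : (i < n)%N -> (i.+2 <= l)%N ->
  prefix_space l f -> prefix_space l (swap i f).
Proof.
move=> ni il [ef df]; split=> [g x|x y xy].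
  by rewrite /swap -ef osimplex_act_perm.
by apply: df => b bl /=; apply: xy; exact: adj_tperm_lt.
Qed.

Lemma swap_fix i l f : (i < n)%N -> (l <= i)%N -> prefix_space l f -> swap i f = f.
Proof.
move=> ni li [_ df]; apply/funext => x; apply: df => b bl /=.
by rewrite adj_tperm_id // (leq_trans bl).
Qed.

Lemma swapK i f : swap i (swap i f) = f.
Proof.
by apply/funext => x; rewrite /swap -osimplex_permM tperm2 osimplex_perm1.
Qed.

Lemma swap_braid i f : (i.+1 < n)%N ->
  swap i (swap i.+1 (swap i f)) = swap i.+1 (swap i (swap i.+1 f)).
Proof.
move=> ni; apply/funext => x; rewrite /swap -!osimplex_permM -!mulgA.
by rewrite adj_tperm_braid.
Qed.

Lemma swap_edot i f f' : edot (swap i f) (swap i f') = edot f f'.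
Proof. exact: (perm_sum_perm (fun x => rdot H (f x) (f' x))). Qed.

(** Kept transparent: later proofs identify its form, spaces and swaps with [edot], [prefix_space]
    and [swap] by conversion. *)
Definition equivariant_tower : tower (S -> H) n.
Proof.
apply: (@Tower _ _ _ edot prefix_space swap).
- exact: prefix_space_subspace.
- exact: prefix_space_complete.
- by move=> l f [ef _]; exact: edot_def.
- move=> l f [ef df]; split=> // x y xy; apply: df; exact: agree_le xy.
- by [].
- by [].
- exact: swapK.
- exact: swap_edot.
- exact: swap_braid.
- by move=> i l f ni; exact: swap_space.
- by move=> i l f ni; exact: swap_fix.
Defined.

Hypothesis hpure : pure X n.
Hypothesis hlink : links_connected X n.

Lemma link_vert_prefix i x : (i < n.+1)%N -> link_vert X (prefix i x) (x (inord i)).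
Proof.
move=> ni; split.
  rewrite /prefix in_fset /=; apply/mapP => -[j]; rewrite mem_iota add0n => /andP[_ ji].
  by move/overt_inj/(congr1 val); rewrite /= !inordK ?(ltn_trans ji) //; lia.
apply: simplex_face (supportP x) _ _.
  by rewrite fsubUset fsub1set mem_support prefix_sub.
by apply/fset0Pn; exists (x (inord i)); rewrite !inE eqxx.
Qed.

Lemma eq_prefix i x y : (i <= n.+1)%N -> agree i x y -> prefix i x = prefix i y.
Proof. by move=> ni /(eq_prefix_seq _ _ ni); rewrite /prefix => ->. Qed.

(** Walk in the link of x_0, ..., x_(i-1) through the vertices z_i with f z = f x. If u is such a
    vertex and v is adjacent to it, extend x_0, ..., x_(i-1), u, v to an n-simplex w: then f w = f
    x, and invariance under the swap puts v at index i. *)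
Lemma equivariant_connected i : (i < n)%N -> connected_at equivariant_tower i.
Proof.
move=> ni f [ef df] sf; split=> // x y xy.
have ni1 : (i <= n.+1)%N by lia.
pose A := [set v | exists z, [/\ agree i z x, z (inord i) = v & f z = f x]].
have agS z z' : agree i z z' -> z (inord i) = z' (inord i) -> agree i.+1 z z'.
  move=> zz zi b; rewrite ltnS leq_eqVlt => /orP[/eqP bi|]; last exact: zz.
  by rewrite -(inord_val b) bi.
have [z [zx zy <-]] : A (y (inord i)).
  apply: (hlink (t := prefix i x)).
  - exact: prefix_simplex.
  - by rewrite card_prefix.
  - exists (x (inord i)); first by exists x; split.
    by apply: link_vert_prefix; lia.
  - move=> u v [z [zx <- fz]] [ut _] [vt Xvt] Xuvt.
    have [vz|vz] := eqVneq v (z (inord i)).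
      by exists z; split.
    have ux : prefix_seq i x = prefix_seq i z by apply/eq_prefix_seq => //; exact: agree_sym.
    set c := z (inord i) in ut Xuvt vz *.
    have [||||w wx hw] := @osimplex_extend _ X n hpure i x [:: c; v].
    + by [].
    + rewrite cat_uniq prefix_seq_uniq //= !inE orbF negb_or.
      move: ut vt; rewrite /prefix !in_fset /= => -> ->.
      by rewrite eq_sym vz.
    + by case: (prefix_seq i x).
    + apply: (eq_ind _ (fun s => X s) Xuvt); apply/fsetP => b.
      rewrite [RHS]in_fset /= mem_cat !in_fset1U /prefix in_fset /= !inE.
      by rewrite orbA orbC.
    have wu : w (inord i) = c by have := hw 0%N c isT; rewrite addn0.
    have wv : w (inord i.+1) = v by have := hw 1%N c isT; rewrite addn1.
    exists (osimplex_perm w (adj_tperm n i)); split.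
    + by move=> b bi /=; rewrite adj_tperm_id // wx.
    + by rewrite /= tpermL wv.
    + rewrite -fz -(df w z); last first.
        by apply: agS; [exact: agree_trans wx (agree_sym zx)|rewrite wu].
      by rewrite -[in RHS]sf.
  - rewrite (eq_prefix ni1 xy); apply: link_vert_prefix; lia.
by apply/df/agS => //; exact: agree_trans zx xy.
Qed.

End EquivariantTower.

(** * The spectral gap of the links *)

(** The rows of [P] are a complex orthonormal eigenbasis with real eigenvalues; [markov_gap] passes
    to their real and imaginary parts. *)
Lemma real_symmetric_spectral (R : realType) (N : nat) (A : 'M[R]_N) :
  (forall i j, A i j = A j i) ->
  exists (P : 'I_N -> 'I_N -> R[i]) (d : 'I_N -> R),
    [/\ forall j k, \sum_i (P i j)^* * P i k = (j == k)%:R,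
        forall j k, ((A j k)%:C)%C = \sum_i (P i j)^* * (((d i)%:C)%C * P i k),
        forall i k, \sum_j ((A k j)%:C)%C * P i j = ((d i)%:C)%C * P i k &
        forall i, exists j, P i j != 0].
Proof.
move=> Asym; pose B : 'M[R[i]]_N := map_mx (real_complex R) A.
have Breal : B \is a realmx.
  by apply/mxOverP => i j; rewrite mxE; apply/complex_realP; exists (A i j).
have Bherm : B \is hermsymmx.
  apply: realsym_hermsym => //; rewrite qualifE /= expr0 scale1r map_mx_id //.
  by apply/eqP/matrixP => i j; rewrite !mxE Asym.
have Pu : spectralmx B \is unitarymx by exact: spectral_unitarymx.
pose P := spectralmx B; pose D := spectral_diag B.
have BE : B = invmx P *m diag_mx D *m P.
  exact/orthomx_spectralP/hermitian_normalmx.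
have Dreal : D \is a realmx by exact: hermitian_spectral_diag_real.
have /choice[d dE] : forall i, exists r : R, D 0 i = (r%:C)%C.
  by move=> i; have /mxOverP/(_ 0 i)/complex_realP[r ->] := Dreal; exists r.
have PtE : invmx P = P ^t*%sesqui by exact: invmx_unitary.
exists (fun i j => P i j), d; split.
- move=> j k; have : invmx P *m P = 1%:M by rewrite mulVmx // spectral_unit.
  rewrite PtE => /matrixP/(_ j k); rewrite !mxE => <-.
  by apply: eq_bigr => i _; rewrite !mxE.
- move=> j k; transitivity (B j k); first by rewrite mxE.
  rewrite BE PtE -mulmxA mxE; apply: eq_bigr => i _.
  rewrite !mxE (bigD1 i) //= big1 ?addr0.
    by rewrite !mxE eqxx dE.
  by move=> l li; rewrite !mxE eq_sym (negbTE li) mulr0n mul0r.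
- move=> i k; have : P *m B = diag_mx D *m P.
    by rewrite BE !mulmxA mulmxV ?spectral_unit // mul1mx.
  move/matrixP/(_ i k); rewrite [LHS]mxE [RHS]mxE => h.
  rewrite (_ : \sum_j _ = \sum_j P i j * B j k); last first.
    by apply: eq_bigr => j _; rewrite mxE Asym mulrC.
  rewrite h (bigD1 i) //= big1 ?addr0; first by rewrite !mxE eqxx dE.
  by move=> l li; rewrite !mxE eq_sym (negbTE li) mulr0n mul0r.
- move=> i; apply: contrapT => h.
  have /unitarymxP/matrixP/(_ i i) := Pu.
  rewrite !mxE eqxx big1 => [/eqP|j _]; first by rewrite eq_sym oner_eq0.
  have [->|Pij] := eqVneq (spectralmx B i j) 0; first by rewrite mul0r.
  by case: h; exists j.
Qed.

Section MarkovGap.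
Context (R : realType) (H : hilbertSpace R) (N : nat).
Variables (m2 : 'I_N -> 'I_N -> R) (m1 : 'I_N -> R).
Hypothesis m2_ge0 : forall i j, 0 <= m2 i j.
Hypothesis m2_sym : forall i j, m2 i j = m2 j i.
Hypothesis m1E : forall i, m1 i = \sum_j m2 i j.
Hypothesis m1_gt0 : forall i, 0 < m1 i.
Hypothesis m2_conn : forall f : 'I_N -> R,
  (forall i j, m2 i j != 0 -> f i = f j) -> forall i j, f i = f j.
Variable L : R.
Hypothesis HL : forall l, 0 < l -> (exists2 f : 'I_N -> R,
  (exists i, f i != 0) &
  forall i, f i - \sum_j m2 i j / m1 i * f j = l * f i) -> L <= l.

(** The Dirichlet form of an eigenfunction, the sum of m2 i j (f i - f j)^2, equals 2 (1 - d) times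
    its weighted square norm, hence vanishes when d >= 1. *)
Lemma markov_constant (f : 'I_N -> R) (d : R) : 1 <= d ->
  (forall i, \sum_j m2 i j / m1 i * f j = d * f i) -> forall i j, f i = f j.
Proof.
move=> d1 hf; apply: m2_conn => i j m2ij.
have e1 : \sum_i \sum_j m2 i j * (f i * f i) = \sum_i m1 i * (f i * f i).
  by apply: eq_bigr => k _; rewrite m1E mulr_suml.
have e2 : \sum_i \sum_j m2 i j * (f i * f j) = d * \sum_i m1 i * (f i * f i).
  rewrite mulr_sumr; apply: eq_bigr => k _.
  transitivity (m1 k * f k * (d * f k)); last by ring.
  rewrite -hf mulr_sumr; apply: eq_bigr => l _.
  by field; rewrite gt_eqF.
have e3 : \sum_i \sum_j m2 i j * (f j * f j) = \sum_i m1 i * (f i * f i).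
  rewrite exchange_big -e1; apply: eq_bigr => k _; apply: eq_bigr => l _.
  by rewrite m2_sym.
have e4 : \sum_i \sum_j m2 i j * (f i - f j) ^+ 2 =
    2 * (1 - d) * \sum_i m1 i * (f i * f i).
  have -> : \sum_i \sum_j m2 i j * (f i - f j) ^+ 2 =
      \sum_i \sum_j m2 i j * (f i * f i) + \sum_i \sum_j m2 i j * (f j * f j)
      - 2 * \sum_i \sum_j m2 i j * (f i * f j).
    rewrite mulr_sumr -big_split -sumrB /=; apply: eq_bigr => k _.
    rewrite mulr_sumr -big_split -sumrB /=; apply: eq_bigr => l _.
    by ring.
  by rewrite e1 e2 e3; ring.
have pos k l : 0 <= m2 k l * (f k - f l) ^+ 2 by rewrite mulr_ge0 ?sqr_ge0.
have : \sum_i \sum_j m2 i j * (f i - f j) ^+ 2 <= 0.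
  rewrite e4 mulr_le0_ge0 ?sumr_ge0 //.
    by lra.
  by move=> k _; apply: mulr_ge0; [exact: ltW|rewrite -expr2 sqr_ge0].
have le : m2 i j * (f i - f j) ^+ 2 <= \sum_i \sum_j m2 i j * (f i - f j) ^+ 2.
  rewrite (bigD1 i) //= (bigD1 j) //= -addrA lerDl addr_ge0 ?sumr_ge0 //.
  by move=> k _; rewrite sumr_ge0.
move=> /(le_trans le) le0.
have : m2 i j * (f i - f j) ^+ 2 == 0 by rewrite eq_le le0 pos.
by rewrite mulf_eq0 (negbTE m2ij) /= sqrf_eq0 subr_eq0 => /eqP.
Qed.

Lemma hdot_sum (c : 'I_N -> R[i]) (psi : 'I_N -> H) :
  hdot H (\sum_j (c j)^* *: psi j) (\sum_j (c j)^* *: psi j) =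
  \sum_j \sum_k (c j)^* * c k * hdot H (psi j) (psi k).
Proof.
rewrite linear_sumlz; apply: eq_bigr => j _; rewrite linear_sumr.
apply: eq_bigr => k _; rewrite linearZl_LR linearZr_LR /= conjCK.
by rewrite mulrA.
Qed.

(** The scalar walk is diagonalized and the Hilbert-valued function expanded in its eigenbasis, with
    components [h i] in [H]. An eigenvalue d < 1 has L <= 1 - d. For d >= 1 the eigenfunction is
    constant, and the component vanishes since [phi] has mean zero. *)
Lemma markov_gap (phi : 'I_N -> H) :
  \sum_i ((m1 i)%:C)%C *: phi i = 0 ->
  \sum_i \sum_j m2 i j * rdot H (phi i) (phi j) <=
  (1 - L) * \sum_i m1 i * rdot H (phi i) (phi i).
Proof.
move=> phi0; pose s i := Num.sqrt (m1 i).
have s_gt0 i : 0 < s i by rewrite sqrtr_gt0.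
have s2 i : s i * s i = m1 i by rewrite -expr2 sqr_sqrtr // ltW.
(* Conjugating the walk m2/m1 by the square roots of the weights makes it symmetric; its
   eigenvectors are those of the walk times [s]. *)
pose A : 'M[R]_N := \matrix_(i, j) (m2 i j / (s i * s j)).
have Asym i j : A i j = A j i by rewrite !mxE m2_sym [s i * _]mulrC.
have [P [d [PP AP eigen Pn0]]] := real_symmetric_spectral Asym.
pose psi i : H := ((s i)%:C)%C *: phi i.
pose h i : H := \sum_j (P i j)^* *: psi j.
have ReE (r : R) (z : R[i]) : complex.Re ((r%:C)%C * z) = r * complex.Re z.
  by case: z => u v /=; rewrite mul0r subr0.
have form (e : 'I_N -> R) (B : 'I_N -> 'I_N -> R) :
    (forall j k, ((B j k)%:C)%C = \sum_i (P i j)^* * (((e i)%:C)%C * P i k)) ->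
    \sum_i e i * rdot H (h i) (h i) =
    \sum_j \sum_k B j k * rdot H (psi j) (psi k).
  move=> BE; have -> : \sum_j \sum_k B j k * rdot H (psi j) (psi k) =
     complex.Re (\sum_j \sum_k ((B j k)%:C)%C * hdot H (psi j) (psi k)).
    rewrite raddf_sum; apply: eq_bigr => j _; rewrite raddf_sum.
    by apply: eq_bigr => k _; exact/esym/ReE.
  have -> : \sum_i e i * rdot H (h i) (h i) =
     complex.Re (\sum_i ((e i)%:C)%C * hdot H (h i) (h i)).
    by rewrite raddf_sum; apply: eq_bigr => j _; exact/esym/ReE.
  congr (complex.Re _).
  under eq_bigr do rewrite hdot_sum mulr_sumr.
  rewrite exchange_big /=; apply: eq_bigr => j _.
  under eq_bigr do rewrite mulr_sumr.
  rewrite exchange_big /=; apply: eq_bigr => k _.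
  rewrite BE mulr_suml; apply: eq_bigr => i _.
  by rewrite !mulrA; congr (_ * _ * _); rewrite mulrC.
have rpsi i j : rdot H (psi i) (psi j) = s i * s j * rdot H (phi i) (phi j).
  by rewrite sdotZl sdotZr mulrA.
have sn0 i : s i != 0 by rewrite gt_eqF.
have -> : \sum_i \sum_j m2 i j * rdot H (phi i) (phi j) =
    \sum_i d i * rdot H (h i) (h i).
  rewrite (form d A AP); apply: eq_bigr => i _; apply: eq_bigr => j _.
  by rewrite rpsi mxE mulrA mulfVK // mulf_neq0.
have -> : \sum_i m1 i * rdot H (phi i) (phi i) = \sum_i 1 * rdot H (h i) (h i).
  rewrite (form (fun=> 1) (fun j k => (j == k)%:R)).
    apply: eq_bigr => i _; rewrite (bigD1 i) //= eqxx mul1r rpsi s2.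
    rewrite big1 ?addr0 // => j ji.
    by rewrite eq_sym (negbTE ji) mul0r.
  move=> j k; rewrite rmorph_nat -PP; apply: eq_bigr => i _.
  by rewrite mul1r.
rewrite mulr_sumr; apply: ler_sum => i _; rewrite mul1r.
have real_eig (f : 'I_N -> R) : (forall k, \sum_j A k j * f j = d i * f k) ->
    forall k, \sum_j m2 k j / m1 k * (f j / s j) = d i * (f k / s k).
  move=> hf k; rewrite mulrA -hf mulr_suml; apply: eq_bigr => j _.
  rewrite mxE -s2; field.
  by rewrite !sn0.
have ReP k : \sum_j A k j * complex.Re (P i j) = d i * complex.Re (P i k).
  rewrite -ReE -eigen raddf_sum; apply: eq_bigr => j _.
  exact/esym/ReE.
have ImE (r : R) (z : R[i]) : complex.Im ((r%:C)%C * z) = r * complex.Im z.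
  by case: z => u v /=; rewrite mul0r addr0.
have ImP k : \sum_j A k j * complex.Im (P i j) = d i * complex.Im (P i k).
  rewrite -ImE -eigen raddf_sum; apply: eq_bigr => j _.
  exact/esym/ImE.
have [d1|d1] := lerP 1 (d i); last first.
  have dL : d i <= 1 - L.
    have big_eig f k : (forall k, \sum_j A k j * f j = d i * f k) -> f k != 0 ->
        d i <= 1 - L.
      move=> hf fk; suff : L <= 1 - d i by lra.
      apply: HL; first by rewrite subr_gt0.
      exists (fun j => f j / s j).
        by exists k; rewrite mulf_neq0 // invr_neq0.
      by move=> j; rewrite real_eig // mulrBl mul1r.
    have [k Pk] := Pn0 i.
    (* [HL] concerns real functions, and one of the real and imaginary parts of the eigenvector is
       nonzero. *)
    have [Rek|Rek] := eqVneq (complex.Re (P i k)) 0; last exact: big_eig ReP Rek.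
    apply: (big_eig _ k ImP); apply: contra Pk => /eqP Imk.
    by rewrite eq_complex Rek Imk /= !eqxx.
  by apply: ler_wpM2r => //; exact: sdot_ge0.
have cst (f : 'I_N -> R) : (forall k, \sum_j A k j * f j = d i * f k) ->
    exists c, forall k, f k = c * s k.
  move=> hf; exists (f i / s i) => k.
  rewrite (@markov_constant (fun k => f k / s k) (d i) d1 (real_eig f hf) i k).
  by rewrite mulfVK.
have [c1 hc1] := cst _ ReP; have [c2 hc2] := cst _ ImP.
have hi0 : h i = 0.
  rewrite /h (_ : \sum_j _ = (c1 +i* c2)^*%C *: \sum_j ((m1 j)%:C)%C *: phi j).
    by rewrite phi0 scaler0.
  rewrite scaler_sumr; apply: eq_bigr => j _; rewrite !scalerA; congr (_ *: _).
  have -> : P i j = (c1 +i* c2)%C * ((s j)%:C)%C.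
    apply/eqP; rewrite eq_complex /= hc1 hc2.
    by rewrite !mulr0 subr0 add0r !eqxx.
  rewrite rmorphM /= -mulrA -s2 rmorphM; congr (_ * (_ * _)).
  by apply/eqP; rewrite eq_complex /= oppr0 !eqxx.
by rewrite hi0 sdot0l !mulr0.
Qed.

End MarkovGap.

Lemma sum_fset_fiber (M : nmodType) (T U : choiceType) (Y : {fset T})
    (S : {fset U}) (f : T -> U) (F : T -> M) : (forall y, y \in Y -> f y \in S) ->
  \sum_(y <- Y) F y = \sum_(s <- S) \sum_(y <- Y | f y == s) F y.
Proof.
move=> fS; rewrite (eq_bigr (fun s => \sum_(y <- Y) if f y == s then F y else 0));
  last by move=> s _; rewrite big_mkcond.
rewrite exchange_big big_seq [RHS]big_seq; apply: eq_bigr => y yY.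
rewrite (bigD1_seq (f y)) ?fset_uniq //=; last exact: fS.
by rewrite eqxx big1 ?addr0 // => s; rewrite eq_sym => /negbTE ->.
Qed.

Lemma card_fset_fiber (T U : choiceType) (Y : {fset T}) (S : {fset U}) (f : T -> U) :
  (forall y, y \in Y -> f y \in S) ->
  #|` Y| = (\sum_(s <- S) #|` [fset y in Y | f y == s]%fset|)%N.
Proof.
move=> fS; rewrite card_fset_sum1 (sum_fset_fiber _ fS).
by apply: eq_bigr => s _; rewrite card_fset_sum1 big_fset.
Qed.

Section Counting.
Context {V : choiceType} (X : simplicialComplex V) (n : nat).
Implicit Types (x y : osimplex X n) (l : nat).

Lemma same_support_perm x y : support x = support y ->
  exists s, y = osimplex_perm x s.
Proof.
move=> xy; have /choice[f fE] : forall i, exists j, y i = x j.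
  move=> i; have := mem_support y i; rewrite -xy => /imfsetP[j _ ->].
  by exists j.
have fI : injective f.
  by move=> i j fij; apply: (@overt_inj _ _ _ y); rewrite !fE fij.
exists (perm fI); apply: osimplex_inj => i.
by rewrite /= permE -fE.
Qed.

(** Such orderings come from [y0] by the permutations moving only indices at least [l]. *)
Lemma card_orderings y0 l (Y : {fset osimplex X n}) :
  (forall y, y \in Y <-> support y = support y0 /\ agree l y y0) ->
  #|` Y| = (n.+1 - l)`!.
Proof.
move=> YE; pose A := [set a : 'I_n.+1 | (l <= a)%N]%SET.
have -> : Y = [fset osimplex_perm y0 s | s in perm_on A]%fset.
  apply/fsetP => y; apply/idP/imfsetP => [/YE[sy ay]|[s sA ->]].
    have [s yE] := same_support_perm (esym sy); exists s => //.
    rewrite unfold_in; apply/fintype.subsetP => i; rewrite inE => si; rewrite inE leqNgt.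
    apply: contra si => il; apply/eqP/(@overt_inj _ _ _ y0).
    by rewrite -(ay i il) yE.
  apply/YE; split.
    apply/fsetP => v; apply/imfsetP/imfsetP => -[i _ ->].
      by exists (s i).
    by exists (s^-1%g i) => //=; rewrite permKV.
  move=> i il /=; rewrite (out_perm sA) // inE -ltnNge //.
rewrite card_imfset /=; last first.
  move=> s t st; apply/permP => i; apply: (@overt_inj _ _ _ y0).
  exact: (congr1 (fun y : osimplex X n => y i) st).
rewrite -cardE card_perm; congr (_ `!)%N.
rewrite cardsE -sum1_card -(big_mkord (fun a => l <= a)%N (fun=> 1%N)).
have /= <- := big_nat_widenl l 0 n.+1 xpredT (fun=> 1%N) (leq0n _).
by rewrite sum_nat_const_nat muln1.
Qed.

Lemma card_extensions (p : seq V) (S : {fset {fset V}}) (Y : {fset osimplex X n}) :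
  uniq p ->
  (forall s, s \in S <-> [/\ X s, has_dim n s & {subset p <= s}]) ->
  (forall y, y \in Y <->
     forall a : 'I_n.+1, (a < size p)%N -> forall v, y a = nth v p a) ->
  (size p <= n.+1)%N ->
  #|` Y| = (#|` S| * (n.+1 - size p)`!)%N.
Proof.
move=> up SE YE pn; have YS y : y \in Y -> support y \in S.
  move=> /YE yp; apply/SE; split; [exact: supportP|exact: has_dim_support|].
  move=> v vp; have ip : (index v p < size p)%N by rewrite index_mem.
  have := yp (inord (index v p)); rewrite inordK; last exact: leq_trans pn.
  by move=> /(_ ip v); rewrite nth_index // => <-; exact: mem_support.
rewrite (card_fset_fiber YS) -sum1_size big_distrl /=.
rewrite big_seq [RHS]big_seq; apply: eq_bigr => s /SE[Xs ds ps].
have [y0 [y0s y0p]] := osimplex_of_seq Xs ds up ps.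
rewrite mul1n; apply: (@card_orderings y0) => y; rewrite !inE /=; split.
  move=> /andP[/YE yp /eqP ->]; split; first exact/esym.
  by move=> a al; rewrite (yp a al (y0 a)) -(y0p a al).
move=> [-> ag]; rewrite y0s eqxx andbT; apply/YE => a al v.
by rewrite (ag a al) (y0p a al v).
Qed.

Lemma fiber_finite r (t : {fset V}) (P : set (osimplex X n)) :
  (forall t : {fset V}, X t -> has_dim r t -> finite_set [set s | link X t s]) ->
  X t -> (r < #|` t|)%N -> (forall y, P y -> (t `<=` support y)%fset) ->
  finite_set P.
Proof.
move=> hfin Xt rt Pt.
apply: (@sub_finite_set _ _ (\bigcup_(s in [set s | X s /\ (t `<=` s)%fset])
    [set y : osimplex X n | (support y `<=` s)%fset])).
  move=> y /Pt ty; exists (support y); last exact: fsubset_refl.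
  by split; first exact: supportP.
by apply: bigcup_finite; [exact: star_finite hfin _ Xt rt|move=> s _; exact: finite_orderings].
Qed.

End Counting.

(** * The random walk on the link of a prefix of k > r vertices *)

Section LocalGap.
Context (R : realType) {V : choiceType} (X : simplicialComplex V) (n r k : nat).
Hypothesis hpure : pure X n.
Hypothesis hlink : links_connected X n.
Hypothesis hfin : forall t : {fset V}, X t -> has_dim r t ->
  finite_set [set s | link X t s].
Hypothesis rk : (r < k)%N.
Hypothesis kn : (k < n)%N.
Variable x0 : osimplex X n.

Local Notation S := (osimplex X n).
Local Notation t := (prefix k x0).
Local Notation p := (prefix_seq k x0).

Let kn1 : (k <= n.+1)%N. Proof. lia. Qed.

Lemma prefix_card : #|` t| = k. Proof. exact: card_prefix. Qed.

Lemma prefix_X : X t.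
Proof.
by have [t0|//] := prefix_simplex x0 kn1; have := prefix_card; rewrite t0 cardfs0; lia.
Qed.

(** The set is finite because k > r, so [fset_set] does not return its default value. *)
Definition prefix_fiber : {fset S} := fset_set [set y | agree k y x0].

Lemma mem_prefix_fiber y : y \in prefix_fiber <-> agree k y x0.
Proof.
rewrite in_fset_set ?inE //.
apply: (fiber_finite hfin prefix_X); first by rewrite prefix_card.
by move=> y' /(eq_prefix kn1) <-; exact: prefix_sub.
Qed.

Local Notation yk y := ((y : S) (inord k)).
Local Notation yk1 y := ((y : S) (inord k.+1)).

Definition link_verts : {fset V} := [fset yk y | y in prefix_fiber]%fset.

Lemma mem_link_verts v : v \in link_verts <-> link_vert X t v.
Proof.
split=> [/imfsetP[y /= /mem_prefix_fiber ag ->]|[vt Xvt]].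
  rewrite -(eq_prefix kn1 ag); apply: link_vert_prefix; lia.
have [||||y ag hy] := @osimplex_extend _ X n hpure k x0 [:: v].
- by [].
- rewrite cat_uniq prefix_seq_uniq //= andbT orbF.
  by move: vt; rewrite /prefix in_fset.
- by case: p.
- apply: (eq_ind _ (fun s => X s) Xvt); apply/fsetP => b.
  by rewrite in_fset1U [RHS]in_fset /= mem_cat inE orbC mem_seq1.
apply/imfsetP; exists y => /=; first exact/mem_prefix_fiber.
by have := hy 0%N v isT; rewrite addn0.
Qed.

Lemma link_mult_finite (s : {fset V}) :
  finite_set [set u : {fset V} | [/\ X u, has_dim n u & (t `|` s `<=` u)%fset]].
Proof.
apply: sub_finite_set (star_finite hfin prefix_X _); last by rewrite prefix_card.
by move=> u [Xu _]; rewrite fsubUset => /andP[tu _]; split.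
Qed.

(** Up to normalization, [count1] and [count2] are the law of x_k and the joint law of (x_k,
    x_(k+1)) given the prefix. They are the multiplicities of the link times (n - k)! and, for
    distinct vertices, (n - k - 1)!, the numbers of orderings of the remaining vertices. *)
Definition count1 u : nat := #|` [fset y in prefix_fiber | yk y == u]%fset|.
Definition count2 u v : nat :=
  #|` [fset y in prefix_fiber | (yk y == u) && (yk1 y == v)]%fset|.

Lemma mult_of_extensions (q : seq V) (Y : {fset S}) : uniq (p ++ q) ->
  (k + size q <= n.+1)%N ->
  (forall y, y \in Y <-> agree k y x0 /\
     forall j v, (j < size q)%N -> y (inord (k + j)) = nth v q j) ->
  #|` Y| = (link_mult X n t [fset v in q]%fset * (n.+1 - (k + size q))`!)%N.
Proof.
move=> uq sq YE.
have sz : size (p ++ q) = (k + size q)%N by rewrite size_cat size_prefix_seq.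
rewrite (@card_extensions _ _ _ (p ++ q) (fset_set [set u : {fset V} |
  [/\ X u, has_dim n u & (t `|` [fset v in q] `<=` u)%fset]])) ?sz //.
- move=> s; rewrite in_fset_set; last exact: link_mult_finite.
  have E : (t `|` [fset v in q] `<=` s)%fset <-> {subset p ++ q <= s}.
    split=> [/fsubsetP h v|h].
      by rewrite mem_cat => vpq; apply: h; rewrite in_fsetU /prefix !in_fset.
    by apply/fsubsetP => v; rewrite in_fsetU /prefix !in_fset -mem_cat => /h.
  by rewrite inE /=; split=> -[Xs ds /E].
- move=> y; split=> [/YE[ag hy] a al v|h].
    rewrite nth_cat size_prefix_seq; case: ltnP => ak.
      by rewrite ag // nth_prefix_seq // inord_val.
    rewrite -hy; first by rewrite subnKC // inord_val.
    lia.
  apply/YE; split=> [a ak|j v jq].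
    rewrite (h a _ (x0 a)); last exact: ltn_addr.
    by rewrite nth_cat size_prefix_seq ak nth_prefix_seq // inord_val.
  have e : (inord (k + j) : 'I_n.+1) = (k + j)%N :> nat by rewrite inordK //; lia.
  rewrite (h (inord (k + j)) _ v) e ?ltn_add2l //.
  by rewrite nth_cat size_prefix_seq ltnNge leq_addr /= addKn.
Qed.

Lemma count1E u : u \in link_verts ->
  count1 u = (link_mult X n t [fset u]%fset * (n - k)`!)%N.
Proof.
move=> /mem_link_verts[ut _].
rewrite /count1 (@mult_of_extensions [:: u]) /=.
- congr (link_mult _ _ _ _ * _`!)%N; last by lia.
  by apply/fsetP => v; rewrite in_fset !inE.
- rewrite cat_uniq prefix_seq_uniq //= andbT orbF.
  by move: ut; rewrite /prefix in_fset.
- lia.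
- move=> y; rewrite !inE /=; split=> [/andP[/mem_prefix_fiber ag /eqP yu]|[ag hy]].
    by split=> // -[|//] v _; rewrite addn0.
  apply/andP; split; first exact/mem_prefix_fiber.
  by have := hy 0%N u isT; rewrite addn0 => /eqP.
Qed.

Lemma count2E u v : u \in link_verts -> v \in link_verts -> u != v ->
  count2 u v = (link_mult X n t [fset u; v]%fset * (n - k.+1)`!)%N.
Proof.
move=> /mem_link_verts[ut _] /mem_link_verts[vt _] uv.
rewrite /count2 (@mult_of_extensions [:: u; v]) /=.
- congr (link_mult _ _ _ _ * _`!)%N; last by lia.
  by apply/fsetP => w; rewrite in_fset !inE.
- rewrite cat_uniq prefix_seq_uniq //= andbT orbF inE uv negb_or.
  by move: ut vt; rewrite /prefix !in_fset /= => -> ->.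
- lia.
- move=> y; rewrite !inE /=; split.
    move=> /andP[/mem_prefix_fiber ag /andP[/eqP yu /eqP yv]].
    by split=> // -[|[|//]] w _; rewrite ?addn0 ?addn1.
  move=> [ag hy]; apply/andP; split; first exact/mem_prefix_fiber.
  have := hy 0%N u isT; have := hy 1%N u isT.
  by rewrite addn0 addn1 /= => /eqP -> /eqP ->.
Qed.

Lemma inord_k_neq : inord k != inord k.+1 :> 'I_n.+1.
Proof. by rewrite -val_eqE /= !inordK; lia. Qed.

Lemma count2_sym u v : u \in link_verts -> v \in link_verts ->
  count2 u v = count2 v u.
Proof.
move=> uW vW; have [->//|uv] := eqVneq u v.
have vu : v != u by rewrite eq_sym.
rewrite count2E // count2E //; congr (_ * _)%N; congr link_mult.
by apply/fsetP => w; rewrite !inE orbC.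
Qed.

Lemma yk1_link y : y \in prefix_fiber -> yk1 y \in link_verts.
Proof.
move=> /mem_prefix_fiber ag.
have -> : yk1 y = yk (osimplex_perm y (adj_tperm n k)) by rewrite /= tpermL.
apply/imfsetP; exists (osimplex_perm y (adj_tperm n k)) => //=.
apply/mem_prefix_fiber => a ak /=.
by rewrite adj_tperm_id // ag.
Qed.

Lemma yk_link y : y \in prefix_fiber -> yk y \in link_verts.
Proof. by move=> yf; apply/imfsetP; exists y. Qed.

Lemma count1_sum u : count1 u = (\sum_(v <- link_verts) count2 u v)%N.
Proof.
rewrite /count1 (@card_fset_fiber _ _ _ link_verts (fun y => yk1 y)); last first.
  by move=> y; rewrite !inE => /andP[/yk1_link].
apply: eq_bigr => v _; congr (#|` _ |); apply/fsetP => y.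
by rewrite !inE /= andbA.
Qed.

Lemma count1_gt0 u : u \in link_verts -> (0 < count1 u)%N.
Proof.
move=> /imfsetP[y /= yf ->]; rewrite cardfs_gt0; apply/fset0Pn; exists y.
by rewrite !inE yf /=.
Qed.

Lemma count2_gt0 u v : u \in link_verts -> v \in link_verts -> u != v ->
  X (u |` (v |` t))%fset -> (0 < count2 u v)%N.
Proof.
move=> uW vW uv Xuvt; rewrite count2E // muln_gt0 fact_gt0 andbT cardfs_gt0.
have [s [Xs ds ss]] := hpure Xuvt; apply/fset0Pn; exists s.
rewrite in_fset_set ?inE; last exact: link_mult_finite.
split=> //; apply: fsubset_trans ss; apply/fsubsetP => w; rewrite !inE.
by move=> /orP[->|/orP[]->]; rewrite ?orbT.
Qed.

Lemma sum_fiber1 (M : nmodType) (F : V -> M) :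
  \sum_(y <- prefix_fiber) F (yk y) = \sum_(u <- link_verts) F u *+ count1 u.
Proof.
rewrite (sum_fset_fiber _ yk_link); apply: eq_bigr => u _.
rewrite big_fset_condE (eq_big_seq (fun=> F u)).
  by rewrite big_const_seq count_predT iter_addr_0.
by move=> y; rewrite !inE => /andP[_ /eqP ->].
Qed.

Lemma sum_fiber2 (M : nmodType) (F : V -> V -> M) :
  \sum_(y <- prefix_fiber) F (yk y) (yk1 y) =
  \sum_(u <- link_verts) \sum_(v <- link_verts) F u v *+ count2 u v.
Proof.
rewrite (sum_fset_fiber _ yk_link); apply: eq_bigr => u _.
rewrite big_fset_condE (@sum_fset_fiber _ _ _ _ link_verts (fun y => yk1 y)); last first.
  by move=> y; rewrite !inE => /andP[/yk1_link].
apply: eq_bigr => v _.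
rewrite big_fset_condE (eq_big_seq (fun=> F u v)).
  rewrite big_const_seq count_predT iter_addr_0; congr (_ *+ _).
  congr (#|` _ |); apply/fsetP => y.
  by rewrite !inE /= andbA.
by move=> y; rewrite !inE -andbA => /and3P[_ /eqP -> /eqP ->].
Qed.

Lemma count2_adj u v : count2 u v != 0%N -> u != v /\ link X t [fset v; u]%fset.
Proof.
rewrite cardfs_eq0 => /fset0Pn[y]; rewrite !inE /= => /andP[/mem_prefix_fiber ag].
move=> /andP[/eqP <- /eqP <-]; split.
  by apply: contra inord_k_neq => /eqP/overt_inj ->.
have nt (i : 'I_n.+1) : (k <= i)%N -> y i \notin t.
  move=> ki; rewrite -(eq_prefix kn1 ag) /prefix in_fset /=.
  apply/mapP => -[j]; rewrite mem_iota add0n => /andP[_ jk] /overt_inj ij.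
  by move: ki; rewrite ij inordK; lia.
split.
- by apply/fset0Pn; exists (yk y); rewrite !inE eqxx orbT.
- apply/fdisjointP => w; rewrite in_fset2 => /orP[] /eqP ->; apply: nt;
    by rewrite inordK; lia.
- apply: simplex_face (supportP y) _ _.
    rewrite fsubUset -{1}(eq_prefix kn1 ag) prefix_sub /=.
    by apply/fsubsetP => w; rewrite !inE => /orP[] /eqP ->; exact: mem_support.
  by apply/fset0Pn; exists (yk y); rewrite !inE eqxx !orbT.
Qed.

Lemma link_vertexE v : link_vertex X t v <-> v \in link_verts.
Proof.
rewrite mem_link_verts; split=> [[_ dt]|[vt Xvt]].
  by rewrite fdisjoint1X in dt; rewrite fsetUC => ?; split.
split; first by apply/fset0Pn; exists v; rewrite inE.
  by rewrite fdisjoint1X.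
by rewrite fsetUC.
Qed.

(** The ratio (n - k)!/(n - k - 1)! of the two counting factors is n - k, which is how the Laplacian
    becomes n - k times the generator of the walk. Ordinals index the vertices so that matrices
    apply. *)
Lemma link_laplacianE (e : 'I_(#|` link_verts|) -> V)
    (idx : V -> 'I_(#|` link_verts|)) (f : 'I_(#|` link_verts|) -> R) :
  (forall i, e i \in link_verts) -> cancel e idx ->
  {in link_verts, cancel idx e} -> forall v : link_vertex X t,
  link_laplacian n (fun u : link_vertex X t => f (idx (val u))) v =
  (n%:R - k%:R) * (f (idx (val v)) - \sum_j
     (count2 (val v) (e j))%:R / (count1 (val v))%:R * f j).
Proof.
move=> eW eK idxK v.
have vW : val v \in link_verts by apply/link_vertexE; exact: set_valP.
rewrite /link_laplacian prefix_card mulrBr; congr (_ - _).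
pose kap j : link_vertex X t := exist _ (e j) (mem_set ((link_vertexE _).2 (eW j))).
set D := [set u : link_vertex X t | _].
have kapK (u : link_vertex X t) : kap (idx (val u)) = u.
  apply: val_inj => /=; apply: idxK; apply/link_vertexE; exact: set_valP.
have fD : finite_set D.
  apply: (@sub_finite_set _ _ (range kap)).
    by move=> u _; exists (idx (val u)).
  by apply: finite_image; exact: finite_finset.
rewrite fsbig_finite //= (perm_big
  [seq kap j | j <- index_enum 'I_(#|` link_verts|) & kap j \in D]) /=; last first.
  apply: uniq_perm; first exact: fset_uniq.
    rewrite map_inj_uniq ?filter_uniq ?index_enum_uniq // => i j /(congr1 val) /=.
    exact: (can_inj eK).
  move=> u; rewrite in_fset_set //; apply/idP/mapP => [uD|[j]].
    exists (idx (val u)); last by rewrite kapK.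
    by rewrite mem_filter kapK uD mem_index_enum.
  by rewrite mem_filter => /andP[jD _ ->].
rewrite big_map big_filter /= big_mkcond mulr_sumr /=.
apply: eq_bigr => j _; rewrite eK.
have f0 m : (m`!)%:R != 0 :> R by rewrite pnatr_eq0 -lt0n fact_gt0.
have c1 := count1_gt0 vW; rewrite count1E // muln_gt0 in c1; case/andP: c1 => mv _.
have mv0 : (link_mult X n t [fset val v]%fset)%:R != 0 :> R by rewrite pnatr_eq0 -lt0n.
case: ifPn => [|jD].
  rewrite inE => -[/= jv _].
  rewrite count2E // 1?eq_sym // count1E // !natrM.
  rewrite (_ : (n - k)%N = (n - k.+1).+1) ?factS ?natrM; last by lia.
  have -> : (n - k.+1).+1%:R = n%:R - k%:R :> R by rewrite -natrB; [congr (_%:R)|]; lia.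
  rewrite (fsetUC [fset e j]%fset); field.
  by rewrite f0 mv0 subr_eq0 eqr_nat gtn_eqF.
suff -> : count2 (val v) (e j) = 0%N by rewrite mul0r mul0r mulr0.
apply/eqP; apply: contraNT jD => /count2_adj[vj lj].
by rewrite inE; split=> //=; rewrite eq_sym.
Qed.

Lemma local_gap (H : hilbertSpace R) (phi : V -> H) :
  0 < link_lambda R X n t -> \sum_(y <- prefix_fiber) phi (yk y) = 0 ->
  \sum_(y <- prefix_fiber) rdot H (phi (yk y)) (phi (yk1 y)) <=
  (1 - link_lambda R X n t / (n%:R - k%:R)) *
    \sum_(y <- prefix_fiber) rdot H (phi (yk y)) (phi (yk y)).
Proof.
move=> lam0 phi0; pose W := link_verts; pose N := #|` W|.
have N0 : (0 < N)%N.
  rewrite cardfs_gt0; apply/fset0Pn; exists (yk x0); apply: yk_link.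
  exact/mem_prefix_fiber.
pose v0 := x0 ord0; pose e (i : 'I_N) := nth v0 W i.
pose idx v : 'I_N := insubd (Ordinal N0) (index v W).
have eW i : e i \in W by exact: mem_nth.
have eK : cancel e idx.
  by move=> i; apply: val_inj; rewrite val_insubd index_uniq ?fset_uniq // ltn_ord.
have idxK : {in W, cancel idx e}.
  by move=> v vW; rewrite /e val_insubd index_mem vW nth_index.
have nk : 0 < n%:R - k%:R :> R by rewrite subr_gt0 ltr_nat.
have sumW (M : nmodType) (F : V -> M) : \sum_(u <- W) F u = \sum_(i < N) F (e i).
  by rewrite (big_nth v0) big_mkord.
rewrite (sum_fiber2 (fun u v => rdot H (phi u) (phi v))).
rewrite (sum_fiber1 (fun u => rdot H (phi u) (phi u))).
move: phi0; rewrite sum_fiber1 !sumW => phi0.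
have -> : \sum_(i < N) \sum_(v <- W) rdot H (phi (e i)) (phi v) *+ count2 (e i) v =
  \sum_i \sum_j (count2 (e i) (e j))%:R * rdot H (phi (e i)) (phi (e j)).
  by apply: eq_bigr => i _; rewrite sumW; apply: eq_bigr => j _; rewrite mulr_natl.
have -> : \sum_(i < N) rdot H (phi (e i)) (phi (e i)) *+ count1 (e i) =
  \sum_i (count1 (e i))%:R * rdot H (phi (e i)) (phi (e i)).
  by apply: eq_bigr => i _; rewrite mulr_natl.
apply: (@markov_gap _ _ _ (fun i j => (count2 (e i) (e j))%:R)
  (fun i => (count1 (e i))%:R)).
- by [].
- by move=> i j; rewrite count2_sym.
- by move=> i; rewrite count1_sum sumW natr_sum.
- by move=> i; rewrite ltr0n count1_gt0.
- move=> f hf i j; have := hlink (t := t) (A := [set v | f i = f (idx v)]).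
  move=> /(_ (or_intror prefix_X)); rewrite prefix_card => /(_ kn).
  have h v : v \in W -> link_vert X t v by move/mem_link_verts.
  move=> /(_ _ _ (e j) (h _ (eW j))) /=; rewrite eK; apply.
    by exists (e i); [rewrite /= eK|exact: h].
  move=> u v -> /mem_link_verts uW /mem_link_verts vW Xuvt.
  have [->//|uv] := eqVneq u v.
  apply: hf; rewrite !idxK // pnatr_eq0 -lt0n; exact: count2_gt0.
(* An eigenvalue l > 0 of the generator gives the eigenvalue (n - k) l of the link Laplacian, so L
   is lambda/(n - k). *)
- move=> l l0 [f [i fi] hf]; rewrite ler_pdivrMr //.
  apply: ge_inf; first by exists 0 => b [/ltW].
  split; first exact: mulr_gt0.
  exists (fun u : link_vertex X t => f (idx (val u))).
    exists (exist _ (e i) (mem_set ((link_vertexE _).2 (eW i)))).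
    by rewrite /= eK.
  move=> v; rewrite (link_laplacianE f eW eK idxK).
  have vW : val v \in W by apply/link_vertexE; exact: set_valP.
  by have := hf (idx (val v)); rewrite (idxK _ vW) => ->; rewrite mulrA [_ * l]mulrC.
- rewrite -[RHS]phi0; apply: eq_bigr => i _.
  by rewrite rmorph_nat scaler_nat.
Qed.

End LocalGap.

(** * From the links to the gap at level k = c + 1 *)

Section BaseGap.
Context (R : realType) {V : choiceType} {X : simplicialComplex V} (n r c : nat).
Context {G : topGroupType} (a : simplicialAction G X).
Hypothesis hcoc : cocompact a.
Hypothesis hsep : hausdorff_space G.
Hypothesis hstab : forall t : {fset V}, X t -> has_dim r t ->
  compact (pointwise_stabilizer a t).
Hypothesis hctb : forall k, countable [set: osimplex X k].
Variable mu : {measure set (borel_group G) -> \bar R}.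
Hypothesis hmu : left_haar mu.
Hypothesis hmu_r : right_invariant mu.
Hypothesis hpure : pure X n.
Hypothesis hlink : links_connected X n.
Hypothesis hfin : forall t : {fset V}, X t -> has_dim r t ->
  finite_set [set s | link X t s].
Hypothesis rc : (r <= c)%N.
Hypothesis cn : (c.+1 < n)%N.

Local Notation "g ** x" := (osimplex_act a g x) (at level 40).
Local Notation S := (osimplex X n).
Local Notation w := (weight a mu).
Implicit Types (x y z : S) (g : G).

Let cn0 : (c <= n)%N. Proof. lia. Qed.
Let rn : (r <= n)%N. Proof. lia. Qed.
Let rc' : (r < c.+1)%N. Proof. by []. Qed.

Local Notation trunc := (trunc cn0).

Local Notation fib x := (prefix_fiber c.+1 x).
Let mem_fib := mem_prefix_fiber hfin rc' cn.

Lemma fiber_act g x y : (g ** y \in fib (g ** x)) = (y \in fib x).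
Proof.
apply/idP/idP => /mem_fib h; apply/mem_fib; last exact: agree_act.
by have := agree_act a g^-1%g h; rewrite !osimplex_actK.
Qed.

Lemma sum_fiber_act (M : nmodType) g x (F : S -> M) :
  \sum_(y <- fib (g ** x)) F y = \sum_(y <- fib x) F (g ** y).
Proof.
rewrite (perm_big [seq g ** y | y <- fib x]) ?big_map //=.
have actI : injective (fun y : S => g ** y) by exact: can_inj (osimplex_actK a g).
apply: uniq_perm; rewrite ?fset_uniq ?map_inj_uniq ?fset_uniq // => y.
apply/idP/mapP => [|[z zf ->]]; last by rewrite fiber_act.
rewrite -{1}(osimplex_actKV a g y) fiber_act => h.
by exists (g^-1%g ** y); rewrite ?osimplex_actKV.
Qed.

Lemma eq_fiber x y : agree c.+1 x y -> fib x = fib y.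
Proof.
move=> xy; apply/fsetP => z; apply/idP/idP => /mem_fib h; apply/mem_fib.
  exact: agree_trans h xy.
exact: agree_trans h (agree_sym xy).
Qed.

(* Mass transport: the number of [y] over [t] in the orbit of [z] is the index
   of the stabilizer of [z] in the one of [t]. *)
Lemma orbit_sum_fiber (ext : osimplex X c -> S) (F : S -> R) :
  (forall t, trunc (ext t) = t) -> (forall g x, F (g ** x) = F x) ->
  orbit_sum a (fun x : S => w x) F =
  \sum_(t <- reps a c) w t * \sum_(y <- fib (ext t)) F y.
Proof.
move=> extK FG.
have step t : \sum_(y <- fib (ext t)) F y =
    \sum_(z <- reps a n) #|` [fset y in fib (ext t) | orbit_rep a y == z]%fset|%:R * F z.
  rewrite (@sum_fset_fiber _ _ _ _ (reps a n) (fun y => orbit_rep a y)); last first.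
    by move=> y _; exact: orbit_rep_mem.
  apply: eq_bigr => z _; rewrite big_fset_condE (eq_big_seq (fun=> F z)).
    by rewrite big_const_seq count_predT iter_addr_0 mulr_natl.
  move=> y; rewrite !inE => /andP[_ /eqP <-].
  by have [g ->] := orbit_repP a y; rewrite FG.
under [RHS]eq_bigr do rewrite step mulr_sumr.
rewrite exchange_big /orbit_sum /= big_seq [RHS]big_seq; apply: eq_bigr => z zR.
under [RHS]eq_bigr do rewrite mulrA.
rewrite -mulr_suml; congr (_ * _).
(* Among the representatives, only that of [trunc z] can have points of the orbit of [z] above
   it. *)
pose t0 := orbit_rep a (trunc z).
rewrite (bigD1_seq t0) ?fset_uniq ?orbit_rep_mem //=.
have [g gE] := orbit_repP a (trunc z).
set Y := [fset y in _ | _]%fset.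
have wY : w t0 * #|` Y|%:R = w (g ** z).
  apply: (@orbit_stabilizer _ _ _ _ _ _ hsep hstab hctb _ hmu) => //.
    move=> h hz; rewrite /ostab /= /t0 gE -trunc_act -trunc_act.
    by congr trunc.
  move=> y; rewrite !inE /=; split.
    move=> /andP[/mem_fib/(trunc_eq cn0)]; rewrite extK /t0 gE -trunc_act => ty /eqP yz.
    have [h hE] : exists h, y = h ** (g ** z).
      apply: orbit_rep_rel; rewrite orbit_rep_act yz.
      by apply/eqP; rewrite -(mem_reps hcoc).
    by exists h => //; rewrite /ostab /= -trunc_act -hE.
  move=> [h ht ->]; apply/andP; split.
    apply/mem_fib/(trunc_eq cn0); rewrite extK /t0 gE !trunc_act.
    by move: ht; rewrite /ostab /= /t0 gE.
  by rewrite !orbit_rep_act -(mem_reps hcoc).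
rewrite wY (weight_act hsep hstab hmu hmu_r) // big_seq_cond big1 ?addr0 // => t.
move=> /andP[tR tt0]; rewrite (_ : [fset y in _ | _]%fset = fset0).
  by rewrite cardfs0 mulr0.
apply/fsetP => y; rewrite !inE /=; apply/negP => /andP[/mem_fib/(trunc_eq cn0)].
rewrite extK => ty /eqP yz; have [h hE] := orbit_repP a y.
move: tt0; rewrite /t0 -yz hE trunc_act ty orbit_rep_act.
by move: tR; rewrite (mem_reps hcoc) => /eqP ->; rewrite eqxx.
Qed.

Let w_gt0 (x : S) : 0 < w x.
Proof. exact: (weight_gt0 hsep hstab hctb hmu). Qed.

Let w_act g (x : S) : w (g ** x) = w x.
Proof. exact: (weight_act hsep hstab hmu hmu_r). Qed.

Let w_perm (x : S) s : w (osimplex_perm x s) = w x.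
Proof. exact: weight_perm. Qed.

Definition haar_tower (H : hilbertSpace R) (rho : unitaryRep G H) : tower (S -> H) n :=
  equivariant_tower hcoc w_gt0 w_act rho.

(** Both sides of the gap are disintegrated over the orbits of (x_0, ..., x_c), and [local_gap] is
    applied on each finite fibre. The bound 1 - lambda/(n - k) < 1/(k + 1) is the eigenvalue
    hypothesis. *)
Lemma base_gap : (forall t : {fset V}, X t -> has_dim c t ->
    c.+1%:R * (n%:R - c.+1%:R) / (c.+1%:R + 1) < link_lambda R X n t) ->
  exists2 nu, nu < (c.+2%:R)^-1 &
    forall (H : hilbertSpace R) (rho : unitaryRep G H), gap (haar_tower rho) c.+1 nu.
Proof.
move=> hlam; have /choice[ext extK] := trunc_surj hpure cn0.
have nk : 0 < n%:R - c.+1%:R :> R by rewrite subr_gt0 ltr_nat.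
pose lam t := link_lambda R X n (prefix c.+1 (ext t)).
have lamP t : c.+1%:R * (n%:R - c.+1%:R) / (c.+1%:R + 1) < lam t.
  apply: hlam; first exact: prefix_X rc' cn (ext t).
  by rewrite /has_dim card_prefix.
have lam0 t : 0 < lam t.
  by apply: lt_trans (lamP t); rewrite divr_gt0 ?mulr_gt0 ?ltr0n // ltr_wpDl.
(* Finitely many orbits allow a maximum that stays strictly below the threshold, uniformly in the
   representation. *)
have bound (s : seq (osimplex X c)) : exists2 nu, nu < (c.+2%:R)^-1 :> R &
    forall t, t \in s -> 1 - lam t / (n%:R - c.+1%:R) <= nu.
  elim: s => [|t s [nu nu1 nuP]].
    by exists 0; [rewrite invr_gt0 ltr0n|move=> t; rewrite in_nil].
  exists (Num.max nu (1 - lam t / (n%:R - c.+1%:R))).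
    rewrite gt_max nu1 /= ltrBlDr -ltrBlDl ltr_pdivlMr //.
    apply: le_lt_trans (lamP t); rewrite le_eqVlt; apply/orP; left; apply/eqP.
    rewrite -[c.+2%:R]natr1; field.
    by rewrite gt_eqF // ltr_wpDl // addr_ge0 ?ler0n.
  move=> t'; rewrite inE => /orP[/eqP ->|/nuP h]; first by rewrite le_max lexx orbT.
  by rewrite le_max h.
have [nu nu1 nuP] := bound (reps a c).
exists nu => // H rho f [ef df] fo.
(* The fibre sum is itself a function of x_0, ..., x_c. Testing the orthogonality of [f] against it
   gives a vanishing weighted sum of |m|^2, so [f] sums to zero on every representative fibre. *)
pose m x := \sum_(z <- fib x) f z.
have mU : prefix_space a rho c.+1 m.
  split=> [g x|x y xy]; last by rewrite /m (eq_fiber xy).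
  rewrite /m sum_fiber_act linear_sum; apply: eq_bigr => y _.
  by rewrite ef.
have card0 : 0 < #|{: 'S_n.+1}|%:R :> R.
  by rewrite ltr0n; apply/card_gt0P; exists 1%g.
have inv (f' : S -> H) : equivariant a rho f' ->
    forall g x, rdot H (f (g ** x)) (f' (g ** x)) = rdot H (f x) (f' x).
  by move=> ef' g x; rewrite ef ef' rdot_rep.
have dotE (f' : S -> H) : equivariant a rho f' -> tower_dot (haar_tower rho) f f' =
    #|{: 'S_n.+1}|%:R * \sum_(t <- reps a c) w t * \sum_(y <- fib (ext t)) rdot H (f y) (f' y).
  move=> ef'; rewrite -(orbit_sum_fiber extK (inv _ ef')).
  by apply: (perm_sum_invariant hcoc w_act w_perm); exact: inv.
have m0 t : t \in reps a c -> \sum_(y <- fib (ext t)) f y = 0.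
  move=> tR; have := fo m mU; rewrite (dotE _ mU.1) => /eqP.
  rewrite mulf_eq0 gt_eqF //= => /eqP s0.
  have mE t' : \sum_(y <- fib (ext t')) rdot H (f y) (m y) =
      rdot H (m (ext t')) (m (ext t')).
    rewrite [X in rdot H X _]/m sdot_suml; apply: eq_big_seq => y yf.
    by congr (rdot H _ _); apply: mU.2; exact/mem_fib.
  apply: rdot_eq0; have : w t * rdot H (m (ext t)) (m (ext t)) <= 0.
    rewrite -s0 (bigD1_seq t) ?fset_uniq //= mE lerDl.
    apply: sumr_ge0 => t' _; rewrite mE mulr_ge0 ?sdot_ge0 // ltW //.
    exact: (weight_gt0 hsep hstab hctb hmu).
  rewrite pmulr_rle0 ?(weight_gt0 hsep hstab hctb hmu) // => h.
  by apply/eqP; rewrite eq_le h sdot_ge0.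
have esf : equivariant a rho (swap c.+1 f).
  by move=> g x; rewrite /swap -ef osimplex_act_perm.
have -> : tower_swap (haar_tower rho) c.+1 f = swap c.+1 f by [].
rewrite (dotE _ esf) (dotE _ ef) mulrCA ler_pM2l // mulr_sumr.
rewrite big_seq [leRHS]big_seq; apply: ler_sum => t tR.
rewrite mulrCA ler_pM2l ?(weight_gt0 hsep hstab hctb hmu) //.
(* Over a fixed prefix, [f] depends on x_(c+1) alone and so descends to the link vertices; the value
   0 elsewhere is never read. *)
pose phi v : H := if pselect (exists z, agree c.+1 z (ext t) /\ z (inord c.+1) = v)
  is left h then f (sval (cid h)) else 0.
have phiE z : agree c.+1 z (ext t) -> phi (z (inord c.+1)) = f z.
  move=> zt; rewrite /phi; case: pselect => [h|[]]; last by exists z.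
  case: cid => /= z' [zt' zz']; apply: df => b; rewrite ltnS leq_eqVlt.
  move=> /orP[/eqP bc|bc]; first by rewrite -(inord_val b) bc.
  by rewrite zt' // zt.
have e1 y : y \in fib (ext t) -> f y = phi (y (inord c.+1)).
  by move=> /mem_fib yt; rewrite phiE.
have e2 y : y \in fib (ext t) -> swap c.+1 f y = phi (y (inord c.+2)).
  move=> /mem_fib yt; rewrite /swap -phiE /= ?tpermL // => b bc /=.
  by rewrite adj_tperm_id // yt.
have phi0 : \sum_(y <- fib (ext t)) phi (y (inord c.+1)) = 0.
  by rewrite -[RHS](m0 t tR); apply: eq_big_seq => y yf; rewrite e1.
have := local_gap hpure hlink hfin rc' cn (lam0 t) phi0.
rewrite (eq_big_seq (fun y => rdot H (f y) (swap c.+1 f y))); last first.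
  by move=> y yf; rewrite (e1 y yf) (e2 y yf).
rewrite [X in _ <= _ * X -> _](eq_big_seq (fun y => rdot H (f y) (f y))); last first.
  by move=> y yf; rewrite (e1 y yf).
move=> /le_trans; apply; apply: ler_wpM2r; last exact: nuP.
by apply: sumr_ge0 => y _; exact: sdot_ge0.
Qed.

End BaseGap.

(** * Cochains *)

Lemma adj_tperm_ind m (Q : 'S_m.+1 -> Prop) : Q 1%g ->
  (forall s t, Q s -> Q t -> Q (s * t)%g) ->
  (forall i, (i < m)%N -> Q (adj_tperm m i)) -> forall s, Q s.
Proof.
move=> Q1 QM Qadj.
have Qt d i : (i + d < m.+1)%N -> Q (tperm (inord i) (inord (i + d))).
  elim: d => [|d IHd] id; first by rewrite addn0 tperm1.
  have idm : (i + d < m)%N by lia.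
  have [->|d0] := eqVneq d 0%N; first by rewrite addn1; apply: Qadj; lia.
  have ne (b b' : nat) : (b < m.+1)%N -> (b' < m.+1)%N -> b != b' ->
      inord b != inord b' :> 'I_m.+1.
    by move=> bm bm'; rewrite -val_eqE /= !inordK.
  have -> : tperm (inord i) (inord (i + d.+1)) =
      (tperm (inord i) (inord (i + d)) ^ adj_tperm m (i + d))%g.
    by rewrite tpermJ tpermL tpermD ?addnS //; apply: ne; lia.
  rewrite conjgE tpermV; apply: (QM); last apply: (QM).
  - exact: Qadj.
  - by apply: IHd; lia.
  - exact: Qadj.
have Qtt (i j : 'I_m.+1) : Q (tperm i j).
  have [ij|ji] := leqP i j.
    by have := @Qt (j - i)%N i; rewrite subnKC // !inord_val; exact.
  by have := @Qt (i - j)%N j; rewrite subnKC ?(ltnW ji) // !inord_val tpermC; exact.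
move=> s; have [ts -> _] := prod_tpermP s.
by elim/big_rec: _ => // t u _; exact: QM.
Qed.

Section Cochains.
Context {V : choiceType} (X : simplicialComplex V) (n : nat).
Context {G : topGroupType} (a : simplicialAction G X).
Context {R : realType} {H : hilbertSpace R} (rho : unitaryRep G H).
Implicit Types (k j c : nat).

(** The permutation [s'] is [s] with the index [i] and its image deleted, and the signs are compared
    through [lift_perm]. *)
Lemma osimplex_face_perm k (x : osimplex X k.+1) (s : 'S_k.+2) i :
  exists2 s' : 'S_k.+1,
    osimplex_face (osimplex_perm x s) i = osimplex_perm (osimplex_face x (s i)) s' &
    (-1) ^+ i * (-1) ^+ s' = (-1) ^+ s * (-1) ^+ (s i) :> R[i].
Proof.
pose f b := odflt b (unlift (s i) (s (lift i b))).
have fE b : lift (s i) (f b) = s (lift i b).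
  rewrite /f; case: unliftP => [b' ->//|/perm_inj/eqP].
  by rewrite eq_sym (negbTE (neq_lift _ _)).
have fI : injective f.
  by move=> b b' fb; apply: (@lift_inj _ i); apply: (@perm_inj _ s); rewrite -!fE fb.
have sE : s = lift_perm i (s i) (perm fI).
  apply/permP => b; case: (unliftP i b) => [b' ->|->].
    by rewrite lift_perm_lift permE fE.
  by rewrite lift_perm_id.
exists (perm fI).
  by apply: osimplex_inj => b /=; rewrite permE fE.
rewrite [in X in _ = X * _]sE odd_lift_perm -[(-1) ^+ i]signr_odd.
rewrite -[(-1) ^+ s i]signr_odd -!signr_addb.
have e (A B C : bool) : A (+) B (+) C (+) B = A (+) C by case: A; case: B; case: C.
by rewrite e.
Qed.

Lemma differential_cochain k (phi : osimplex X k -> H) :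
  cochain a rho phi -> cochain a rho (differential phi).
Proof.
move=> [altp eqp]; split=> [s x|g x].
  rewrite /differential scaler_sumr [RHS](reindex_inj (@perm_inj _ s)) /=.
  apply: eq_bigr => i _; have [s' -> e] := osimplex_face_perm x s i.
  by rewrite altp !scalerA e.
rewrite /differential linear_sum; apply: eq_bigr => i _.
rewrite linearZ /= -eqp; congr (_ *: phi _).
exact: osimplex_inj.
Qed.

Lemma lift_swap m (i i' : 'I_m.+2) (l l' : 'I_m.+1) : i' = lift i l -> i = lift i' l' ->
  (forall b, lift i (lift l b) = lift i' (lift l' b)) /\
  odd (i + l) = ~~ odd (i' + l').
Proof.
move=> /(congr1 val) /= e1 /(congr1 val) /= e2.
by split=> [b|]; [apply: val_inj => /=|]; move: e1 e2; rewrite /bump; lia.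
Qed.

(** [T i i'] is the term omitting the vertices i and i' in this order. Omitting them in the other
    order reverses the sign, so the double sum equals its opposite. *)
Lemma differentialK k (phi : osimplex X k -> H) :
  differential (differential phi) = cst 0.
Proof.
apply/funext => x; rewrite /cst.
pose T (i i' : 'I_k.+3) : H := if unlift i i' is Some l
  then (-1) ^+ (i + l) *: phi (osimplex_face (osimplex_face x i) l) else 0.
have TE : differential (differential phi) x = \sum_i \sum_i' T i i'.
  apply: eq_bigr => i _; rewrite (bigD1_ord i) //= /T unlift_none add0r.
  rewrite /differential scaler_sumr; apply: eq_bigr => l _.
  by rewrite liftK scalerA exprD.
have Tanti i i' : T i' i = - T i i'.
  rewrite /T; case: (unliftP i i') => [l e|->]; last by rewrite unlift_none oppr0.
  case: (unliftP i' i) => [l' e'|e']; last first.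
    by have := neq_lift i l; rewrite -e e' eqxx.
  have [fe oe] := lift_swap e e'.
  rewrite -[in RHS]signr_odd oe -[in LHS]signr_odd signrN scaleNr opprK.
  congr (_ *: phi _); apply: osimplex_inj => b /=.
  by rewrite fe.
have : \sum_i \sum_i' T i i' = - \sum_i \sum_i' T i i'.
  rewrite {1}exchange_big -sumrN; apply: eq_bigr => i _.
  by rewrite -sumrN; apply: eq_bigr => i' _.
rewrite -TE => /eqP; rewrite -addr_eq0 -mulr2n -scaler_nat scaler_eq0.
by rewrite pnatr_eq0 /= => /eqP.
Qed.

Context (wt : osimplex X n -> R).
Hypothesis hpure : pure X n.
Hypothesis hcoc : cocompact a.
Hypothesis wt_gt0 : forall x, 0 < wt x.
Hypothesis wt_act : forall g x, wt (osimplex_act a g x) = wt x.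
Local Notation T := (equivariant_tower hcoc wt_gt0 wt_act rho).

Definition pull c (cn : (c <= n)%N) (psi : osimplex X c -> H) : osimplex X n -> H :=
  fun x => psi (trunc cn x).

Lemma pull_inj c (cn : (c <= n)%N) : injective (pull cn).
Proof.
move=> psi psi' e; apply/funext => t; have [x <-] := trunc_surj hpure cn t.
exact: (congr1 (fun f : osimplex X n -> H => f x) e).
Qed.

Lemma trunc_adj_tperm c (cn : (c <= n)%N) b (x : osimplex X n) : (b < c)%N ->
  trunc cn (osimplex_perm x (adj_tperm n b)) =
  osimplex_perm (trunc cn x) (adj_tperm c b).
Proof.
move=> bc; apply: osimplex_inj => i; rewrite /= !truncE /=; congr (x _).
apply: val_inj => /=; rewrite /adj_tperm.
case: (tpermP (inord b) (inord b.+1) i) => [->|->|/eqP h1 /eqP h2].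
- rewrite (_ : widen_ord _ _ = inord b) ?tpermL; last first.
    by apply: val_inj; rewrite /= !inordK //; lia.
  by rewrite !inordK //; lia.
- rewrite (_ : widen_ord _ _ = inord b.+1) ?tpermR; last first.
    by apply: val_inj; rewrite /= !inordK //; lia.
  by rewrite !inordK //; lia.
- by rewrite tpermD //; move: h1 h2; rewrite -!val_eqE /= !inordK; lia.
Qed.

Lemma sign_adj_tperm c b : (b < c)%N -> (-1) ^+ adj_tperm c b = -1 :> R[i].
Proof.
move=> bc; rewrite odd_tperm (_ : inord b != inord b.+1 :> 'I_c.+1) ?expr1 //.
by rewrite -val_eqE /= !inordK; lia.
Qed.

(** This identifies the alternating vectors of the tower with the cochains, so that [tower_exact]
    becomes a statement on cohomology. Purity extends each ordered c-simplex to an n-simplex on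
    which to read the cochain. *)
Lemma pull_alternating c (cn : (c <= n)%N) (f : osimplex X n -> H) :
  alternating T c f <-> exists2 psi, cochain a rho psi & f = pull cn psi.
Proof.
split=> [[[ef df] af]|[psi [altp eqp] ->]]; last first.
  split; first split.
  - by move=> g x; rewrite /pull trunc_act eqp.
  - by move=> x y xy; rewrite /pull (_ : trunc cn x = trunc cn y) //; apply/trunc_eq.
  move=> b bc; apply/funext => x; rewrite /= /swap /pull trunc_adj_tperm // altp.
  by rewrite sign_adj_tperm // scaleN1r.
have /choice[ext extK] := trunc_surj hpure cn.
have fE x y : trunc cn x = trunc cn y -> f x = f y by move/trunc_eq; exact: df.
exists (fun t => f (ext t)); last first.
  by apply/funext => x; apply: fE; rewrite extK.
split=> [s|g t]; last first.
  by rewrite -ef; apply: fE; rewrite trunc_act !extK.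
elim/(@adj_tperm_ind c): s => [t|s s' IHs IHs' t|i ic t].
- by rewrite osimplex_perm1 odd_perm1 scale1r.
- by rewrite osimplex_permM IHs IHs' scalerA odd_permM signr_addb.
rewrite sign_adj_tperm // scaleN1r.
have e : f (osimplex_perm (ext t) (adj_tperm n i)) = - f (ext t).
  exact: (congr1 (fun f' : osimplex X n -> H => f' (ext t)) (af i ic)).
by rewrite -e; apply: fE; rewrite extK trunc_adj_tperm // extK.
Qed.

(** Each swap moves the omitted position one index down, starting from c + 1. *)
Lemma pull_swap_chain c (cn : (c <= n)%N) (cn1 : (c.+1 <= n)%N) psi m x :
  (m <= c.+1)%N ->
  swap_chain T c m (pull cn psi) x =
  psi (osimplex_face (trunc cn1 x) (inord (c.+1 - m))).
Proof.
elim: m x => [|m IHm] x mc.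
  rewrite /pull; congr psi; apply: osimplex_inj => i /=.
  rewrite !truncE /=; congr (x _); apply: val_inj => /=.
  by rewrite subn0 inordK // /bump leqNgt ltn_ord.
rewrite [LHS]/= /swap IHm; last exact: ltnW.
congr psi; apply: osimplex_inj => i /=; rewrite !truncE /=; congr (x _).
apply: val_inj => /=; have := ltn_ord i => ilt.
have e1 : (inord (c.+1 - m) : 'I_c.+2) = (c.+1 - m)%N :> nat by rewrite inordK //; lia.
have e2 : (inord (c.+1 - m.+1) : 'I_c.+2) = (c - m)%N :> nat by rewrite inordK //; lia.
have e3 : (inord (c - m) : 'I_n.+1) = (c - m)%N :> nat by rewrite inordK //; lia.
have e4 : (inord (c - m).+1 : 'I_n.+1) = (c - m).+1 :> nat by rewrite inordK //; lia.
rewrite /adj_tperm; case: tpermP.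
- move=> /(congr1 (@nat_of_ord _)) /=; rewrite e1 e2 e3 e4 /bump; lia.
- move=> /(congr1 (@nat_of_ord _)) /=; rewrite e1 e2 e3 e4 /bump; lia.
- move=> /eqP + /eqP; rewrite -!(inj_eq val_inj) /= e1 e2 e3 e4 /bump; lia.
Qed.

Lemma pull_differential c (cn : (c <= n)%N) (cn1 : (c.+1 <= n)%N) psi :
  tower_d T c (pull cn psi) = pull cn1 (differential psi).
Proof.
apply/funext => x; rewrite /tower_d /pull /differential.
rewrite (_ : (\sum_(i < c.+2) _) x =
  \sum_(i < c.+2) (-1) ^+ i *: swap_chain T c (c.+1 - i) (pull cn psi) x); last first.
  by rewrite fct_sumE.
apply: eq_bigr => i _; rewrite (pull_swap_chain cn cn1) ?leq_subr //.
by rewrite subKn ?inord_val // -ltnS.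
Qed.

Lemma cohomology_vanishing j nu : (j.+1 < n)%N -> gap T j.+1 nu ->
  nu < (j.+2%:R)^-1 -> cohomology_eq0 a rho j.+1.
Proof.
move=> jn hg hnu phi [cphi dphi].
have jn0 : (j <= n)%N by lia. have jn1 : (j.+1 <= n)%N by lia.
have af : alternating T j.+1 (pull jn1 phi) by apply/pull_alternating; exists phi.
have hd g : alternating T j g -> alternating T j.+1 (tower_d T j g) /\
    tower_d T j.+1 (tower_d T j g) = 0.
  move=> /(pull_alternating jn0)[psi cpsi ->]; rewrite (pull_differential jn0 jn1).
  split.
    apply/pull_alternating; exists (differential psi) => //.
    exact: differential_cochain.
  by rewrite (pull_differential jn1 jn) differentialK.
have df0 : tower_d T j.+1 (pull jn1 phi) = 0.
  by rewrite (pull_differential jn1 jn) dphi.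
have [g /(pull_alternating jn0)[psi cpsi ->] e] := tower_exact jn hg hnu hd af df0.
exists psi => //; apply: (@pull_inj _ jn1).
by rewrite e (pull_differential jn0 jn1).
Qed.

End Cochains.

(** * Property (T) *)

Section Fixed.
Context (R : realType) (G : topGroupType) (H : hilbertSpace R) (rho : unitaryRep G H).

Lemma parallelogram (x y : H) : rdot H (x - y) (x - y) =
  2 * rdot H x x + 2 * rdot H y y -
  4 * rdot H ((2^-1)%:C%C *: (x + y)) ((2^-1)%:C%C *: (x + y)).
Proof. by rewrite !sdotE (sdotC _ y x); field. Qed.

(* The fixed vector is the element of least norm in the closed convex hull of
   the orbit, which is described by its supporting half-spaces. *)
Lemma fixed_vector_near (D : set G) (xi : H) (e : R) :
  (forall g h, D g -> D h -> D (g * h)%g) -> (forall g, D g -> D g^-1%g) ->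
  D 1%g -> (forall g, D g -> snorm (rdot H) (rho g xi - xi) <= e) ->
  exists2 p, (forall g, D g -> rho g p = p) & snorm (rdot H) (xi - p) <= e.
Proof.
move=> DM DV D1 he.
(* Half-spaces containing the orbit give closedness and convexity at once, and [D] permutes them. *)
pose C := [set y : H | forall z c, (forall g, D g -> rdot H (rho g xi) z <= c) ->
  rdot H y z <= c].
have C0 : C xi by move=> z c /(_ 1%g D1); rewrite rep1.
have mC x y : C x -> C y -> C ((2^-1)%:C%C *: (x + y)).
  move=> Cx Cy z c hc; rewrite !sdotE.
  by have := Cx z c hc; have := Cy z c hc; lra.
have cC : scomplete (rdot H) C.
  move=> u Cu cu; have [l _ ul] := @rdot_complete R H u (fun=> I) cu.
  exists l => // z c hc; apply: (@small_seq_le _ _ _ (snorm (rdot H) z)) => d d0 _.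
  have [N hN] := ul d d0.
  have -> : rdot H l z = rdot H (u N) z + rdot H (l - u N) z by rewrite -sdotDl addrC subrK.
  apply: lerD; first exact: Cu.
  apply: le_trans (sdot_le _ _ _) _; rewrite ler_wpM2r ?snorm_ge0 //.
  by rewrite snorm_distC hN.
have [p Cp pmin] := min_norm (ex_intro _ xi C0) cC mC.
exists p => [g Dg|].
  have Cg : C (rho g p).
    move=> z c hc; rewrite -(rdot_rep rho g^-1%g) repK; apply: Cp => h Dh.
    by rewrite -(rdot_rep rho g) -repM repKV; apply: hc; exact: DM.
  (* [rho g p] and [p] have the same minimal norm and their midpoint stays in [C], so the
     parallelogram law makes them equal. *)
  apply/eqP; rewrite -subr_eq0; apply/eqP; apply: rdot_eq0; apply/eqP.
  rewrite eq_le sdot_ge0 andbT parallelogram rdot_rep.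
  by have := pmin _ (mC _ _ Cg Cp); lra.
have [->|n0] := eqVneq (snorm (rdot H) (xi - p)) 0.
  by apply: le_trans (he 1%g D1); exact: snorm_ge0.
have ngt0 : 0 < snorm (rdot H) (xi - p) by rewrite lt_def n0 snorm_ge0.
rewrite -(ler_pM2r ngt0) -expr2 sqr_snorm.
(* The half-space in the direction p - xi contains the orbit, hence [p]; this reads |xi - p|^2 <= e
   |xi - p|. *)
have /Cp : forall g, D g -> rdot H (rho g xi) (- (xi - p)) <=
    - rdot H xi (xi - p) + e * snorm (rdot H) (xi - p).
  move=> g Dg; have -> : rdot H (rho g xi) (- (xi - p)) =
    - rdot H xi (xi - p) + rdot H (rho g xi - xi) (- (xi - p)).
    by rewrite !sdotE; ring.
  rewrite lerD2l; apply: le_trans (sdot_le _ _ _) _.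
  by rewrite snormN ler_wpM2r ?snorm_ge0 // he.
by rewrite sdotNr [X in _ -> X <= _]sdotBl; lra.
Qed.

End Fixed.

(** * Descent of almost invariant vectors to level 0 *)

Section Descent.
Context (R : realType) {V : choiceType} (X : simplicialComplex V) (n : nat).
Context (G : topGroupType) (a : simplicialAction G X) (wt : osimplex X n -> R).
Hypothesis hcoc : cocompact a.
Hypothesis wt_gt0 : forall x, 0 < wt x.
Hypothesis wt_act : forall g x, wt (osimplex_act a g x) = wt x.
Hypothesis wt_perm : forall x s, wt (osimplex_perm x s) = wt x.
Local Notation S := (osimplex X n).
Local Notation "g ** x" := (osimplex_act a g x) (at level 40).
Local Notation nrm H := (snorm (rdot H)).
Implicit Types (x y z : S) (g h : G) (l : nat).

(** [Q] and [K] precede the representation, the vector and [e], as property (T) requires. The linear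
    bound in [e] lets the estimates compose through the levels. *)
Definition fixed_near l x := exists (Q : set G) (K : R), [/\ compact Q, 0 <= K &
  forall (H : hilbertSpace R) (rho : unitaryRep G H) (xi : H) (e : R), 0 <= e ->
    (forall g, Q g -> nrm H (rho g xi - xi) <= e) ->
    exists2 p, (forall g, agree l (g ** x) x -> rho g p = p) &
      nrm H (xi - p) <= K * e].

Definition prefix_rel l x y := exists g, agree l (g ** x) y.

Lemma prefix_rel_refl l x : prefix_rel l x x.
Proof. by exists 1%g; rewrite osimplex_act1. Qed.

Lemma prefix_rel_sym l x y : prefix_rel l x y -> prefix_rel l y x.
Proof.
move=> [g /(agree_act a g^-1%g)]; rewrite osimplex_actK => h.
by exists g^-1%g; exact: agree_sym.
Qed.

Lemma prefix_rel_trans l x y z : prefix_rel l x y -> prefix_rel l y z -> prefix_rel l x z.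
Proof.
move=> [g /(agree_act a) gx] [h hy]; exists (h * g)%g.
by rewrite osimplex_actM; exact: agree_trans (gx h) hy.
Qed.

Definition prefix_rep l : S -> S := class_rep (@prefix_rel_refl l).

Lemma prefix_rep_eq l x y : prefix_rel l x y -> prefix_rep l x = prefix_rep l y.
Proof. exact: class_rep_eq (@prefix_rel_sym l) (@prefix_rel_trans l) _ _. Qed.

Lemma prefix_repP l x : prefix_rel l (prefix_rep l x) x.
Proof. exact/prefix_rel_sym/(class_repP (@prefix_rel_refl l)). Qed.

Lemma finite_prefix_rep l : finite_set (range (prefix_rep l)).
Proof.
have [Y fY hY] := orbit_cover hcoc n.
apply: sub_finite_set (finite_image (prefix_rep l) fY) => _ [x _ <-].
have [g gx] := hY x; exists (g ** x) => //; apply: prefix_rep_eq.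
by apply: prefix_rel_sym; exists g.
Qed.

Lemma conj_compact g (Q : set G) : compact Q -> compact [set (g^-1 * (q * g))%g | q in Q].
Proof.
move=> cQ.
have -> : [set (g^-1 * (q * g))%g | q in Q] =
   (fun h : G => (g^-1 * h)%g) @` ((fun h : G => (h * g)%g) @` Q).
  by rewrite image_comp.
apply: continuous_compact.
  by apply: continuous_subspaceT => h; exact: mulg_left_continuous.
apply: continuous_compact => //; apply: continuous_subspaceT => h.
apply: (@continuous_comp _ _ _ (fun h : G => (h, g)) (fun p : G * G => (p.1 * p.2)%g)).
  exact: (@cvg_pair _ _ _ (nbhs h) (nbhs h) (nbhs g) _ _ _ id (fun=> g) cvg_id (cvg_cst _)).
exact: mulg_continuous.
Qed.

(** The function [f] is spread from vectors fixed at level l + 1, and f z is within K e of rho(b z)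
    xi. The swap replaces z by [sw z] and hence b z by b (sw z). Both elements carry the first l
    vertices of x to those of z, so putting their quotients in [Q], for finitely many z, makes [f]
    almost unchanged by the swap. By [gap_dist], [f] is then close to its projection [q], and q x is
    the vector sought. *)
Lemma fixed_near_step l nu x : (l < n)%N -> nu < 1 ->
  (forall (H : hilbertSpace R) (rho : unitaryRep G H),
     gap (equivariant_tower hcoc wt_gt0 wt_act rho) l nu) ->
  (forall y, fixed_near l.+1 y) -> fixed_near l x.
Proof.
move=> ln nu1 hgap hnear.
(* The default 1 at unrelated [y] is harmless: [f] uses representatives related to [x] only. *)
have /choice[s sP] : forall y, exists g, prefix_rel l x y -> agree l (g ** x) y.
  move=> y; have [[g gx]|h] := pselect (prefix_rel l x y); first by exists g.
  by exists 1%g.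
have /choice[Qf /choice[Kf QKP]] := hnear.
have /choice[t tP] := prefix_repP l.+1.
pose rep := prefix_rep l.+1; rewrite -/rep in tP.
pose Rl : {fset S} := fset_set (range rep).
have repR y : rep y \in Rl.
  rewrite in_fset_set; first by rewrite inE; exists y.
  exact: finite_prefix_rep.
pose b z := (t z * s (rep z))%g.
have near_rep z : prefix_rel l x z -> prefix_rel l x (rep z).
  move=> /prefix_rel_trans; apply; apply: prefix_rel_sym; exists (t z).
  exact: agree_le (tP z).
have bP z : prefix_rel l x z -> agree l (b z ** x) z.
  move=> xz; rewrite osimplex_actM; apply: agree_trans (agree_le (leqnSn l) (tP z)).
  by apply: agree_act; apply: sP; exact: near_rep.
pose sw z := osimplex_perm z (adj_tperm n l).
have sw_agree z : agree l (sw z) z by move=> c cl; rewrite /sw /= adj_tperm_id.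
pose conjQ y := [set (s y)^-1 * (q * s y) | q in Qf y]%g.
(* The three parts make rho(s y) xi almost invariant under [Qf y], compare b z with b (sw z), and
   keep rho(b x) xi near xi. *)
pose Q := \big[setU/set0]_(y <- Rl) conjQ y `|`
  [set ((b z)^-1 * b (sw z))%g | z in [set` reps a n]] `|` [set b x].
pose K := \sum_(y <- Rl) Kf y.
have Kf0 y : 0 <= Kf y by have [_ + _] := QKP y.
have K0 : 0 <= K by apply: sumr_ge0 => y _.
have Kle y : y \in Rl -> Kf y <= K.
  move=> yR; rewrite /K (big_rem y) //= lerDl; apply: sumr_ge0 => z _; exact: Kf0.
pose W := \sum_(z <- reps a n) wt z.
(* On a representative the swap moves [f] by at most (2 K + 1) e: two approximations and one
   displacement of xi. Squaring, summing over orbits and orderings, then dividing by 2 (1 - nu) from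
   [gap_dist] and by the weight of [x] from [edot_ge] gives [M]. *)
pose M := #|{: 'S_n.+1}|%:R * W * (2 * K + 1) ^+ 2 / (2 * (1 - nu) * wt x).
have W0 : 0 <= W by apply: sumr_ge0 => z _; exact: ltW.
have nu0 : 0 < 1 - nu by rewrite subr_gt0.
have M0 : 0 <= M.
  apply: divr_ge0; first by rewrite mulr_ge0 ?sqr_ge0 // mulr_ge0.
  by apply: mulr_ge0; [apply: mulr_ge0 => //|]; exact: ltW.
exists Q, (1 + K + Num.sqrt M); split.
- apply: compactU; last exact: compact_set1.
  apply: compactU.
    apply: bigsetU_compact => y _; apply: conj_compact.
    by have [] := QKP y.
  by apply: finite_compact; apply: finite_image; exact: finite_fset.
- by rewrite addr_ge0 ?sqrtr_ge0 // addr_ge0.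
move=> H rho xi e e0 hQ.
have Qconj y q : y \in Rl -> Qf y q -> Q ((s y)^-1 * (q * s y))%g.
  move=> yR Qq; left; left; rewrite -bigcup_seq; exists y => //.
  by exists q.
have /choice[p pP] : forall y, exists p, y \in Rl ->
   (forall g, agree l.+1 (g ** y) y -> rho g p = p) /\
   nrm H (rho (s y) xi - p) <= Kf y * e.
  move=> y; have [yR|/negP yR] := boolP (y \in Rl); last by exists 0.
  have [_ _ h] := QKP y.
  have [|p p1 p2] := h H rho (rho (s y) xi) e e0; last by exists p.
  move=> q Qq; rewrite -repM -(snorm_rep rho (s y)^-1%g) linearB repK -repM.
  by apply: hQ; exact: Qconj.
(* Any element carrying the prefix of [rep z] to that of [z] may replace [t z], since [p (rep z)] is
   fixed by the prefix stabilizer; this makes [f] equivariant and a function of l + 1 vertices. *)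
have fE z h : agree l.+1 (h ** rep z) z -> rho (t z) (p (rep z)) = rho h (p (rep z)).
  move=> hz; rewrite -[LHS](repKV rho h) -(repM rho h^-1%g (t z)); congr (rho h _).
  apply: (pP _ (repR z)).1; rewrite osimplex_actM.
  have := agree_act a h^-1%g (agree_trans (tP z) (agree_sym hz)).
  by rewrite osimplex_actK.
pose f z : H := if pselect (prefix_rel l x z) then rho (t z) (p (rep z)) else 0.
have fU : prefix_space a rho l.+1 f.
  split=> [g z|z z' zz'].
    rewrite /f; have rE : rep (g ** z) = rep z.
      by apply/esym/prefix_rep_eq; exists g.
    case: pselect => [xgz|nxgz]; case: pselect => [xz|nxz].
    - rewrite (fE (g ** z) (g * t z)%g) rE ?repM //.
      by rewrite osimplex_actM; apply: agree_act; exact: tP.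
    - case: nxz; apply: prefix_rel_trans xgz _; apply: prefix_rel_sym.
      by exists g.
    - by case: nxgz; apply: prefix_rel_trans xz _; exists g.
    - by rewrite linear0.
  have rE : rep z = rep z' by apply: prefix_rep_eq; exists 1%g; rewrite osimplex_act1.
  have zz l' : (l' <= l.+1)%N -> prefix_rel l' z z'.
    by move=> h; exists 1%g; rewrite osimplex_act1; exact: agree_le zz'.
  rewrite /f; case: pselect => [xz|nxz]; case: pselect => [xz'|nxz'] //.
  - by rewrite (fE z' (t z)) -rE //; exact: agree_trans (tP z) zz'.
  - by case: nxz'; apply: prefix_rel_trans xz (zz _ (leqnSn l)).
  - by case: nxz; apply: prefix_rel_trans xz' (prefix_rel_sym (zz _ (leqnSn l))).
have fb z : prefix_rel l x z -> nrm H (f z - rho (b z) xi) <= K * e.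
  move=> xz; rewrite /f; case: pselect => // nx.
  rewrite repM -linearB snorm_rep snorm_distC.
  apply: le_trans (pP _ (repR z)).2 _.
  by rewrite ler_wpM2r // Kle.
have df z : z \in reps a n -> nrm H (f z - f (sw z)) <= (2 * K + 1) * e.
  move=> zR; have zs : prefix_rel l z (sw z).
    by exists 1%g; rewrite osimplex_act1; exact/agree_sym/sw_agree.
  have [xz|nxz] := pselect (prefix_rel l x z); last first.
    have nxs : ~ prefix_rel l x (sw z).
      by move=> /prefix_rel_trans/(_ (prefix_rel_sym zs)).
    rewrite /f; case: pselect => // nx1; case: pselect => // nx2.
    by rewrite subrr snorm0 mulr_ge0 // addr_ge0 // mulr_ge0.
  have xs := prefix_rel_trans xz zs.
  have h1 := fb z xz; have h2 := fb _ xs.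
  have h3 : nrm H (rho (b z) xi - rho (b (sw z)) xi) <= e.
    rewrite -(snorm_rep rho (b z)^-1%g) linearB repK -repM snorm_distC.
    by apply: hQ; left; right; exists z.
  have h4 := ler_snorm_dist (rdot H) (f z) (rho (b z) xi) (f (sw z)).
  have h5 := ler_snorm_dist (rdot H) (rho (b z) xi) (rho (b (sw z)) xi) (f (sw z)).
  rewrite snorm_distC in h2.
  by lra.
pose T := equivariant_tower hcoc wt_gt0 wt_act rho.
pose q := proj (tower_dot T) (tower_space T l) f.
have qU : prefix_space a rho l q := proj_spaceP T l f.
exists (q x).
  by move=> g gx; rewrite -qU.1; exact: qU.2.
have eqv (f' : S -> H) : equivariant a rho f' -> equivariant a rho (f - f').
  move=> ef' g z.
  change (f (g ** z) - f' (g ** z) = rho g (f z - f' z)).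
  by rewrite fU.1 ef' linearB.
have esf : equivariant a rho (swap l f).
  by move=> g z; rewrite /swap -fU.1 osimplex_act_perm.
have d1 := gap_dist ln (hgap H rho) fU; rewrite -/T -/q in d1.
have d2 : tower_dot T (f - swap l f) (f - swap l f) <=
    #|{: 'S_n.+1}|%:R * (((2 * K + 1) * e) ^+ 2 * W).
  rewrite [leLHS](perm_sum_invariant hcoc wt_act wt_perm (F := fun z =>
    rdot H ((f - swap l f) z) ((f - swap l f) z))); last first.
    by move=> g z; rewrite (eqv _ esf) rdot_rep.
  apply: ler_wpM2l => //; rewrite /orbit_sum /W mulr_sumr.
  rewrite big_seq [leRHS]big_seq; apply: ler_sum => z zR.
  rewrite mulrC ler_pM2r // -sqr_snorm ler_pXn2r ?nnegrE ?snorm_ge0 //.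
    exact: df.
  by rewrite mulr_ge0 // addr_ge0 // mulr_ge0.
have d3 : wt x * rdot H (f x - q x) (f x - q x) <= tower_dot T (f - q) (f - q).
  by apply: (edot_ge hcoc wt_gt0 wt_act); exact: eqv qU.1.
have d4 : nrm H (f x - q x) <= Num.sqrt M * e.
  rewrite -(@ler_pXn2r _ 2) ?nnegrE ?snorm_ge0 ?mulr_ge0 ?sqrtr_ge0 //.
  rewrite sqr_snorm exprMn sqr_sqrtr // /M.
  rewrite mulrAC ler_pdivlMr ?mulr_gt0 //.
  have d5 := ler_wpM2l (ltW (mulr_gt0 (ltr0Sn R 1) nu0)) d3.
  have d6 := le_trans d5 (le_trans d1 d2).
  have -> : rdot H (f x - q x) (f x - q x) * (2 * (1 - nu) * wt x) =
      2 * (1 - nu) * (wt x * rdot H (f x - q x) (f x - q x)) by ring.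
  apply: le_trans d6 _.
  by rewrite exprMn le_eqVlt; apply/orP; left; apply/eqP; ring.
have xx : prefix_rel l x x by exact: prefix_rel_refl.
have h1 := fb x xx.
have h2 : nrm H (rho (b x) xi - xi) <= e by apply: hQ; right.
have h4 := ler_snorm_dist (rdot H) xi (rho (b x) xi) (q x).
have h5 := ler_snorm_dist (rdot H) (rho (b x) xi) (f x) (q x).
rewrite snorm_distC in h1; rewrite snorm_distC in h2.
by lra.
Qed.

(** At level 0 the agreement condition is empty, so [p] is invariant under the whole group. With
    kappa = 1/(K + 1), a unit vector moved by less than kappa is at distance at most K/(K + 1) < 1
    from [p], so [p] is nonzero. *)
Lemma fixed_near_property_T : (exists x : S, True) -> (forall x, fixed_near 0 x) ->
  property_T R G.
Proof.
move=> [x _] /(_ x)[Q [K [cQ K0 hQ]]].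
have K1 : 0 < K + 1 by rewrite ltr_wpDl.
exists (K + 1)^-1, Q; split=> //; first by rewrite invr_gt0.
move=> H rho; have [h|h] := pselect (exists2 xi : H, xi != 0 & forall g, rho g xi = xi).
  by left.
right=> xi xi1; apply: contrapT => hg.
have sxi : nrm H xi = 1.
  by have := norm_rdot xi; rewrite xi1 => /eqP; rewrite eq_complex /= eqxx andbT => /eqP.
have [||p hp pd] := hQ H rho xi (K + 1)^-1.
- by rewrite invr_ge0 ltW.
- move=> g Qg; rewrite leNgt; apply/negP => lt; apply: hg; exists g => //.
  by rewrite norm_rdot lecR ltW.
have p0 : p = 0.
  apply/eqP; apply: contrapT => /negP p0; apply: h; exists p => // g.
  by apply: hp.
by move: pd; rewrite p0 subr0 sxi ler_pdivlMr // mul1r; lra.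
Qed.

End Descent.

(** The compact stabilizer itself serves as [Q], with K = 1 from [fixed_vector_near]. *)
Lemma fixed_near_compact (R : realType) (V : choiceType) (X : simplicialComplex V)
    (n : nat) (G : topGroupType) (a : simplicialAction G X) (l : nat)
    (x : osimplex X n) : (l <= n.+1)%N ->
  compact (pointwise_stabilizer a (prefix l x)) -> fixed_near R a l x.
Proof.
move=> ln cQ; have QE : pointwise_stabilizer a (prefix l x) =
    [set g | agree l (osimplex_act a g x) x].
  apply/seteqP; split=> g gx.
    by move=> b bl; apply: gx; rewrite /prefix in_fset; exact: mem_prefix_seq.
  move=> v; rewrite /prefix in_fset /= => /mapP[b]; rewrite mem_iota => /andP[_ il] ->.
  by apply: gx; rewrite inordK //; lia.
exists (pointwise_stabilizer a (prefix l x)), 1; split=> // H rho xi e e0 he.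
rewrite mul1r; rewrite QE in he; apply: fixed_vector_near he.
- move=> g h gx hx; rewrite /= osimplex_actM.
  exact: agree_trans (agree_act a g hx) gx.
- move=> g /(agree_act a g^-1%g); rewrite osimplex_actK; exact: agree_sym.
- by rewrite /= osimplex_act1.
Qed.

Theorem theorem1p1 (R : realType) (n : nat) (hn : (2 <= n)%N)
    (V : choiceType) (X : simplicialComplex V)
    (hcontr : contractible R (realization R X))
    (hpure : pure X n)
    (hlinks : forall (t : {fset V}) (d : nat), X t ->
       dimension_eq (link X t) d -> (0 < d)%N ->
       connected [set: realization R (link X t)])
    (r : nat) (hr : (r <= n - 2)%N)
    (hfin : forall t : {fset V}, X t -> has_dim r t ->
       finite_set [set s | link X t s])
    (G : topGroupType) (hlc : locally_compact_group G)
    (hunim : unimodular R G)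
    (a : simplicialAction G X) (hcoc : cocompact a)
    (hstab : forall t : {fset V}, X t -> has_dim r t ->
       compact (pointwise_stabilizer a t))
    (k : nat) (hrk : (r < k)%N) (hkn : (k <= n - 1)%N)
    (hlambda : forall t : {fset V}, X t -> has_dim k.-1 t ->
       k%:R * (n%:R - k%:R) / (k%:R + 1) < link_lambda R X n t) :
  (forall (j : nat), (r < j)%N -> (j <= k)%N ->
     forall (H : hilbertSpace R) (rho : unitaryRep G H),
       cohomology_eq0 a rho j) /\
  property_T R G.
Proof.
have [hconn [p0 _]] := contractible_connected hcontr.
have hne : exists s, X s by have [s Xs _] := baryP p0; exists s.
have hlink : links_connected X n := link_induction hconn hpure hlinks.
have hctb j : countable [set: osimplex X j].
  exact: osimplex_countable hconn hne hpure hlinks hr hn hfin j.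
have [hsep _] := hlc; have [mu hmu hmu_r] := hunim.
case: k hrk hkn hlambda => // c rc cn hlam.
have cn' : (c.+1 < n)%N by lia.
have rn : (r <= n)%N by lia.
pose w_gt0 := fun x : osimplex X n => weight_gt0 hsep hstab hctb hmu x rn.
pose w_act := fun g (x : osimplex X n) => weight_act hsep hstab hmu hmu_r g x rn.
pose w_perm := fun (x : osimplex X n) s => weight_perm a mu x s.
have [nu nu1 hgap] := base_gap hcoc hsep hstab hctb hmu hmu_r hpure hlink hfin rc cn' hlam.
pose T (H : hilbertSpace R) (rho : unitaryRep G H) :=
  equivariant_tower hcoc w_gt0 w_act rho.
have gaps j : (j <= c.+1)%N -> exists2 nu', nu' < (j.+1%:R)^-1 &
    forall (H : hilbertSpace R) (rho : unitaryRep G H), gap (T H rho) j nu'.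
  move=> jc; have [nu' nu'1 h] := gap_descent cn' jc nu1.
  exists nu' => // H rho; apply: h; last exact: hgap.
  by move=> l lc; apply: equivariant_connected => //; lia.
split.
  move=> [//|j] rj jc H rho; have [nu' nu'1 h] := gaps j.+1 jc.
  by apply: (cohomology_vanishing hpure _ (h H rho)) => //; lia.
have [x0 _] : exists x : osimplex X n, True.
  have [s /hpure[s' [Xs' ds' _]]] := hne.
  by have [x _] := osimplex_of_seq Xs' ds' (p := [::]) isT (fun v => ltac:(done)); exists x.
apply: (fixed_near_property_T (a := a)); first by exists x0.
(* The descent starts at level r + 1, where the prefix is an r-simplex and [hstab] applies; each
   further step uses the gap at level r - d, which is less than 1. *)
suff fixed : forall (d : nat) (x : osimplex X n),
    (d <= r.+1)%N -> fixed_near R a (r.+1 - d) x.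
  by move=> x; have := fixed r.+1 x (leqnn _); rewrite subnn.
elim=> [x _|d IHd x dr].
  rewrite subn0; apply: fixed_near_compact; first by lia.
  apply: (hstab); last by rewrite /has_dim card_prefix //; lia.
  have [p_0|//] := @prefix_simplex _ X n r.+1 x ltac:(lia).
  by have := @card_prefix _ X n r.+1 x ltac:(lia); rewrite p_0 cardfs0.
have [|nu' nu'1 h] := gaps (r.+1 - d.+1)%N; first by lia.
apply: (fixed_near_step w_perm x _ _ h); first by lia.
  apply: lt_le_trans nu'1 _; rewrite invf_le1 ?ltr0n // ler1n //.
by move=> y; rewrite -subSn // subSS; apply: IHd; exact: ltnW.
Qed.
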